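(* Let $r>0$ and let $Z_r$ be a gamma random variable with density $\rho_{Z_r}(t)=\frac{1}{\Gamma(r)}t^{r-1}e^{-t}$, $t>0$. Let $\alpha\in(0,1)$ and let $Y_{\alpha,r}$ be a positive random variable, independent of $Z_r$, with density $$\rho_{Y_{\alpha,r}}(t)=H_{1,1}^{1,0}\left(t\,\middle|\,\genfrac{}{}{0pt}{}{(r-\alpha,\alpha)}{(r-1,1)}\right),\quad t>0.$$ Then $$Z_{r}\overset{\mathcal{L}}{=}Z_{r}^{\alpha}\,Y_{\alpha,r}.$$
   Context: $\overset{\mathcal{L}}{=}$ denotes equality in law. For $t>0$, $r>0$ and $0<\alpha<1$, the Fox $H$-function is $$H_{1,1}^{1,0}\left(t\,\middle|\,\genfrac{}{}{0pt}{}{(r-\alpha,\alpha)}{(r-1,1)}\right):=\frac{1}{2\pi i}\int_{\mathscr{L}}\frac{\Gamma(r-1+s)}{\Gamma(r-\alpha+\alpha s)}\,t^{-s}\,\mathrm{d}s,$$ where $t^{-s}=e^{-s\log t}$ and $\mathscr{L}$ is a loop contained in a horizontal strip, with both ends at $-\infty$ (one along $\Im s=-1$, the other along $\Im s=1$), encircling counterclockwise all the poles $s=1-r-l$, $l=0,1,2,\dots$, of $s\mapsto\Gamma(r-1+s)$. This function of $t$ is a probability density on $(0,\infty)$. *)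

(* Defs.v *)
From HB Require Import structures.
From mathcomp Require Import all_boot all_order all_algebra.
From mathcomp Require Import all_classical all_reals all_analysis.
From mathcomp Require Import measurable_realfun complex.

Set Implicit Arguments.
Unset Strict Implicit.
Unset Printing Implicit Defensive.

Import Order.TTheory GRing.Theory Num.Theory.
Import numFieldNormedType.Exports.

Local Open Scope classical_set_scope.
Local Open Scope ring_scope.
Local Open Scope complex_scope.

(* projections of R[i] to R, shadowed by the MathComp ones valued in R[i] *)
Local Notation Re := complex.Re.
Local Notation Im := complex.Im.

Section complex_analysis.
Context {R : realType}.

Definition cexp (z : R[i]) : R[i] :=
  (expR (Re z) * cos (Im z)) +i* (expR (Re z) * sin (Im z)).

(* t ^ s for t > 0; the value is junk for t <= 0 *)
Definition cpow (t : R) (s : R[i]) : R[i] := cexp (s * (ln t)%:C).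

Definition cintegral (D : set R) (f : R -> R[i]) : R[i] :=
  (\int[lebesgue_measure]_(x in D) Re (f x)) +i*
  (\int[lebesgue_measure]_(x in D) Im (f x)).

(* Euler's integral of the second kind, meaningful for Re z > 0 *)
Definition euler_Gamma (z : R[i]) : R[i] :=
  cintegral `]0, +oo[ (fun x => cpow x (z - 1) * (expR (- x))%:C).

(* The Gamma function on the whole complex plane: Euler's integral continued by
   Gamma z = Gamma (z + n) / (z (z + 1) ... (z + n - 1)); the n chosen here
   satisfies Re z + n > 0. At the poles the product vanishes, so Gamma is 0
   there, and so is its inverse, in accordance with 1 / Gamma being entire. *)
Definition Gamma (z : R[i]) : R[i] :=
  let n := `|Num.floor (Re z)|%N.+1 in
  euler_Gamma (z + n%:R) / \prod_(k < n) (z + k%:R).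

Definition path_derive (g : R -> R[i]) (u : R) : R[i] :=
  derive1 (fun v => Re (g v)) u +i* derive1 (fun v => Im (g v)) u.

Definition path_integral (g : R -> R[i]) (D : set R) (f : R[i] -> R[i]) : R[i] :=
  cintegral D (fun u => f (g u) * path_derive g u).

Definition piecewise_C1 (f : R -> R) : Prop :=
  continuous f /\
  exists s : seq R,
    (forall u, u \notin s -> derivable f u 1 /\ {for u, continuous (derive1 f)}) /\
    (forall u, u \in s -> cvg (derive1 f x @[x --> u^'-]) /\
                          cvg (derive1 f x @[x --> u^'+])).

(* The loop g comes from -oo along Im s = -1 and returns to -oo along Im s = 1.
   Both ends are parametrized with unit speed, so that the two ends close up at
   -oo and the winding number of g around p is the limit of the truncated
   integrals (1 / (2 i pi)) int_{-T}^{T} g' / (g - p). Continuity of g between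
   the two ends keeps it in a horizontal strip. *)
Record loop_around (poles : nat -> R[i]) (g : R -> R[i]) : Prop := LoopAround {
  loop_C1_Re : piecewise_C1 (fun u => Re (g u)) ;
  loop_C1_Im : piecewise_C1 (fun u => Im (g u)) ;
  loop_start : exists a x, forall u, u <= a -> g u = (x + u) +i* (-1) ;
  loop_end : exists b x, forall u, b <= u -> g u = (x - u) +i* 1 ;
  loop_avoid : forall l u, g u != poles l ;
  loop_winding : forall l,
    let I T := path_integral g `[- T, T] (fun s => (s - poles l)^-1) in
    (Re (I T) @[T --> +oo] --> (0 : R)) /\
    (Im (I T) @[T --> +oo] --> (2 * pi : R))
}.

(* The poles of s |-> Gamma (b + B s) *)
Definition Gamma_poles (b B : R) (l : nat) : R[i] := (- (b + l%:R) / B)%:C.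

(* H_{1,1}^{1,0}(t | aA ; bB), the integral being taken along g. Its value is
   real for t > 0 and real parameters, but has type R[i]. *)
Definition foxH (g : R -> R[i]) (aA bB : R * R) (t : R) : R[i] :=
  (0 +i* (2 * pi))^-1 *
  path_integral g setT (fun s =>
    Gamma (bB.1%:C + bB.2%:C * s) / Gamma (aA.1%:C + aA.2%:C * s)
    * cpow t (- s)).

Definition gamma_density (r t : R) : R :=
  (Re (Gamma r%:C))^-1 * t `^ (r - 1) * expR (- t).

End complex_analysis.

Section random_variables.
Context d (T : measurableType d) (R : realType) (P : probability T R).

(* X is concentrated on ]0, +oo[ and has density f there *)
Definition has_density_pos (X : {RV P >-> R}) (f : R -> R) : Prop :=
  [/\ measurable_fun (`]0, +oo[ : set R) f,
      forall t, 0 < t -> 0 <= f t &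
      forall A : set R, measurable A -> distribution P X A =
        (\int[lebesgue_measure]_(t in A `&` `]0%R, +oo[) (f t)%:E)%E].

Definition independent_RV (X Y : {RV P >-> R}) : Prop :=
  forall A B : set R, measurable A -> measurable B ->
    P (X @^-1` A `&` Y @^-1` B) = (P (X @^-1` A) * P (Y @^-1` B))%E.

Definition eq_law (X Y : {RV P >-> R}) : Prop :=
  forall A : set R, measurable A -> distribution P X A = distribution P Y A.

Definition powR_mul (X Y : {RV P >-> R}) (a : R) : T -> R :=
  fun w => X w `^ a * Y w.

Lemma measurable_powR_mul X Y a : measurable_fun setT (powR_mul X Y a).
Proof.
by apply: measurable_funM => //; exact: (measurableT_comp (measurable_powR a)).
Qed.

HB.instance Definition _ X Y a :=
  isMeasurableFun.Build _ _ _ _ (powR_mul X Y a) (measurable_powR_mul X Y a).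

End random_variables.

Arguments has_density_pos {d T R} P X f.
Arguments independent_RV {d T R} P X Y.
Arguments eq_law {d T R} P X Y.

(* Main.v *)
(** Put z0 = r (1 - alpha) and g(z, t) = sum_l (-t)^l / (l! Gamma (z - alpha l)).
    Closing the loop by a vertical segment between two poles and moving the segment
    to -oo, the residues of Gamma give the density of Y as t^(r-1) g(z0, t).
    Conditioning on Z, the density of Z^alpha Y at w is therefore
    w^(r-1) / Gamma r times int_0^oo x^(z0-1) e^(-x) g(z0, w x^(-alpha)) dx, so all
    that is needed is that the latter integral is e^(-w).  Hankel's formula for
    1 / Gamma, summed over l, gives
    g(z, t) = (1 / 2 i pi) int e^(u - t u^alpha) u^(-z) du; the substitution u = x v
    and Fubini turn the integral into
    (1 / 2 i pi) int e^(-w v^alpha) v^(-z0) / (1 - v) dv over a contour passing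
    left of v = 1, and the residue there is e^(-w).  The case w = 0 of the same
    computation yields Hankel's formula itself. *)

Require Import Defs.
From mathcomp Require Import all_boot all_order all_algebra.
From mathcomp Require Import all_classical all_reals all_analysis.
From mathcomp Require Import complex measurable_realfun ring lra.
Set Implicit Arguments.
Unset Strict Implicit.
Unset Printing Implicit Defensive.
Import Order.TTheory GRing.Theory Num.Theory.
Import numFieldNormedType.Exports.
Local Open Scope classical_set_scope.
Local Open Scope ring_scope.
Local Open Scope complex_scope.
Local Notation Re := complex.Re.
Local Notation Im := complex.Im.

(** * Real integration *)

(** The angle theta of the rays is taken between pi / 2 and pi with alpha * theta < pi / 2, which is
    possible because alpha < 1: then e^u decays along the rays while |e^(-t u^alpha)| <= 1 for t >=
    0. Contours are described in zeta = ln v, where arcs and rays become sides of rectangles, so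
    that Cauchy's theorem on a rectangle is enough. The loop is known only through its ends and its
    limiting winding numbers, hence is not deformed: the kernel minus its first N + 1 principal
    parts has a primitive on a rectangle containing the truncated loop, and the principal parts are
    integrated by means of the winding numbers. The main obstacle is the size of Gamma s / Gamma (z0
    + alpha s) far to the left. The functional equation moves both arguments to the right, where
    Euler's integral has an upper bound in a vertical strip and a lower bound inside the parabola Re
    = 1 + Im^2; what remains is a quotient of factorials, small because alpha < 1. The same lower
    bound shows that 1 / Gamma is holomorphic, without the reflection formula. *)

Notation mu := lebesgue_measure.
Notation rint D f := (mu.-integrable D (EFin \o f)).

Section real_integration.
Context {R : realType}.
Implicit Types (f g F : R -> R) (D : set R) (a b : R).

Lemma rint_dominated D f g : measurable D -> measurable_fun D f ->
  rint D g -> (forall x, D x -> `|f x| <= g x) -> rint D f.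
Proof.
move=> mD mf ig fg; apply: le_integrable ig => //.
  exact/measurable_EFinP.
move=> x Dx; rewrite /= lee_fin (le_trans (fg x Dx))//.
exact: ler_norm.
Qed.

Lemma Rint_dominated_cvg D (f_ : nat -> R -> R) f g : measurable D ->
  (forall n, measurable_fun D (f_ n)) -> measurable_fun D f ->
  rint D g -> (forall n x, D x -> `|f_ n x| <= g x) ->
  (forall x, D x -> f_ n x @[n --> \oo] --> f x) ->
  (\int[mu]_(x in D) f_ n x) @[n --> \oo] --> \int[mu]_(x in D) f x.
Proof.
move=> mD mf_ mf ig fg ff.
have [|||||iF _ H] := @dominated_convergence _ _ _ mu D mD
  (fun n => EFin \o f_ n) (EFin \o f) (EFin \o g).
- by move=> n; apply/measurable_EFinP; exact: mf_.
- by apply/measurable_EFinP; exact: mf.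
- apply: aeW => x Dx; apply: cvg_EFin; first exact: nearW.
  exact: ff.
- exact: ig.
- by apply: aeW => x n Dx; rewrite /= lee_fin fg.
have -> : (fun n => \int[mu]_(x in D) f_ n x) =
          fine \o (fun n => \int[mu]_(x in D) (f_ n x)%:E)%E by [].
apply: fine_cvg; rewrite /Rintegral fineK; first exact: H.
exact: integrable_fin_num.
Qed.

Lemma Rint_exhaust D (D_ : nat -> set R) f : measurable D ->
  (forall n, measurable (D_ n)) -> (forall n, D_ n `<=` D) ->
  (forall x, D x -> \forall n \near \oo, D_ n x) -> rint D f ->
  (\int[mu]_(x in D_ n) f x) @[n --> \oo] --> \int[mu]_(x in D) f x.
Proof.
move=> mD mD_ D_D Dn If.
have mf : measurable_fun D f by apply/measurable_EFinP; exact: measurable_int If.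
have -> : (fun n => \int[mu]_(x in D_ n) f x) =
          (fun n => \int[mu]_(x in D) (f \_ (D_ n)) x).
  apply/funext => n.
  by rewrite -Rintegral_mkcondr setIidr.
apply: (@Rint_dominated_cvg _ _ _ (fun x => `|f x|)) => //.
- move=> n; apply/(measurable_restrict f (mD_ n) mD).
  by apply: measurable_funS mf.
- exact: integrable_norm.
- by move=> n x Dx; rewrite patchE; case: ifPn => //; rewrite normr0.
- move=> x Dx; apply: cvg_near_cst.
  near=> n; rewrite patchE ifT//; apply/mem_set; near: n.
  exact: Dn.
Unshelve. all: by end_near. Qed.

Lemma FTC_cc f F a b : a < b -> {within `[a, b], continuous f} ->
  {within `[a, b], continuous F} ->
  (forall x, a < x < b -> is_derive x 1 F (f x)) ->
  \int[mu]_(x in `[a, b]) f x = F b - F a.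
Proof.
move=> ab cf cF dF; rewrite /Rintegral (@continuous_FTC2 _ f F)//.
- move/(continuous_within_itvP _ ab) : cF => -[_ H1 H2]; split => //.
  by move=> x /[!in_itv]/= xab; have [] := dF x xab.
- by move=> x /[!in_itv]/= xab; rewrite derive1E; have [_] := dF x xab.
Qed.

End real_integration.

(** * The fundamental theorem of calculus on open and unbounded intervals *)

Section ftc.
Context {R : realType}.
Implicit Types (f g F : R -> R) (D : set R) (a b : R).

Lemma rint_continuous_cc f a b : {within `[a, b], continuous f} ->
  rint `[a, b] f.
Proof.
by move=> cf; apply: continuous_compact_integrable => //; exact: segment_compact.
Qed.

Lemma continuous_at_within D f : (forall x, D x -> {for x, continuous f}) ->
  {within D, continuous f}.
Proof.
move=> cf; apply: continuous_in_subspaceT => x /set_mem; exact: cf.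
Qed.

(** Only the limits of F along the ends of an exhausting sequence of segments enter, so that one
    argument serves bounded intervals and half-lines. *)
Lemma FTC_exhaust D (a_ b_ : nat -> R) f F (la lb : R) : measurable D -> rint D f ->
  (forall n, a_ n < b_ n) -> (forall n, `[a_ n, b_ n] `<=` D) ->
  (forall x, D x -> \forall n \near \oo, a_ n <= x <= b_ n) ->
  (forall x, D x -> {for x, continuous f}) ->
  (forall x, D x -> is_derive x 1 F (f x)) ->
  F (a_ n) @[n --> \oo] --> la -> F (b_ n) @[n --> \oo] --> lb ->
  \int[mu]_(x in D) f x = lb - la.
Proof.
move=> mD If ab abD abn cf dF Fa Fb.
have H : (\int[mu]_(x in `[a_ n, b_ n]) f x) @[n --> \oo] -->
    \int[mu]_(x in D) f x.
  apply: (@Rint_exhaust _ D (fun n => `[a_ n, b_ n]%classic)) => //.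
apply: (cvg_unique _ H) => //.
have -> : (fun n => \int[mu]_(x in `[a_ n, b_ n]) f x) =
    (fun n => F (b_ n) - F (a_ n)).
  apply/funext => n; apply: FTC_cc => //.
  - by apply: continuous_at_within => x /abD; exact: cf.
  - apply: continuous_at_within => x /abD /dF [dx _].
    exact/differentiable_continuous/derivable1_diffP.
  - move=> x /andP[/ltW ax /ltW xb]; apply: dF; apply: (abD n).
    by rewrite /= in_itv/= ax.
exact: cvgB.
Qed.

Lemma rint_exhaust_bounded D (D_ : nat -> set R) f (M : R) :
  measurable_fun D f -> (forall x, D x -> 0 <= f x) ->
  nondecreasing_seq D_ -> (forall n, measurable (D_ n)) -> \bigcup_n D_ n = D ->
  (forall n, rint (D_ n) f /\ \int[mu]_(x in D_ n) f x <= M) -> rint D f.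
Proof.
move=> mf f0 nD mD UD fM.
have sub n : D_ n `<=` D by rewrite -UD => x Dx; exists n.
apply/integrableP; split; first exact/measurable_EFinP.
have -> : (\int[mu]_(x in D) `|(EFin \o f) x| = \int[mu]_(x in D) (f x)%:E)%E.
  by apply: eq_integral => x /set_mem /f0 fx; rewrite /= ger0_norm.
have lim : (\int[mu]_(x in D_ n) (f x)%:E @[n --> \oo] --> \int[mu]_(x in D) (f x)%:E)%E.
  rewrite -UD; apply: ge0_nondecreasing_set_cvg_integral => //.
  - by move=> n; apply/measurable_EFinP; apply: measurable_funS mf => //; rewrite -UD; exact: bigcupT_measurable.
  - by move=> n x /sub /f0; rewrite lee_fin.
apply: (@le_lt_trans _ _ M%:E); last exact: ltry.
rewrite -(cvg_lim _ lim)//; apply: lime_le; first by apply/cvg_ex; eexists; exact: lim.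
near=> n; have [iD iM] := fM n.
have -> : (\int[mu]_(x in D_ n) (f x)%:E = (\int[mu]_(x in D_ n) f x)%R%:E)%E.
  by rewrite /Rintegral fineK//; apply: (integrable_fin_num _ iD); exact: mD.
by rewrite lee_fin.
Unshelve. all: by end_near. Qed.

Lemma inv_nat_cvg0 : n.+1%:R^-1 @[n --> \oo] --> (0 : R).
Proof. exact: cvg_harmonic. Qed.

Lemma FTC_oo a b f F (la lb : R) : a < b -> rint `]a, b[ f ->
  (forall x, a < x < b -> {for x, continuous f}) ->
  (forall x, a < x < b -> is_derive x 1 F (f x)) ->
  F x @[x --> a^'+] --> la -> F x @[x --> b^'-] --> lb ->
  \int[mu]_(x in `]a, b[) f x = lb - la.
Proof.
move=> ab If cf dF /cvg_at_rightP Fa /cvg_at_leftP Fb.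
(* The factor 1 / 3 keeps [a + h n] below [b - h n] already for n = 0. *)
pose h n : R := (b - a) / 3 * n.+1%:R^-1.
have h0 n : 0 < h n by rewrite mulr_gt0// ?divr_gt0 ?subr_gt0.
have hs n : h n <= (b - a) / 3.
  rewrite /h ler_piMr//; first by rewrite divr_ge0// subr_ge0 ltW.
  by rewrite invf_le1// ler1n.
have ch : h n @[n --> \oo] --> (0 : R).
  rewrite -[0](mulr0 ((b - a) / 3)); apply: cvgM; first exact: cvg_cst.
  exact: inv_nat_cvg0.
have ca : a + h n @[n --> \oo] --> a.
  by rewrite -[X in _ --> X]addr0; apply: cvgD => //; exact: cvg_cst.
have cb : b - h n @[n --> \oo] --> b.
  by rewrite -[X in _ --> X]subr0; apply: cvgB => //; exact: cvg_cst.
apply: (@FTC_exhaust _ (fun n => a + h n) (fun n => b - h n) f F) => //.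
- by move=> n; have := hs n; have := h0 n; lra.
- move=> n x /=; rewrite !in_itv/= => /andP[]; have := h0 n.
  by move=> *; apply/andP; split; lra.
- move=> x /=; rewrite in_itv/= => /andP[ax xb]; near=> n.
  have : h n <= x - a /\ h n <= b - x; last by move=> [? ?]; apply/andP; split; lra.
  split; near: n.
    by apply: (cvgr_le (0:R)) => //; rewrite subr_gt0.
  by apply: (cvgr_le (0:R)) => //; rewrite subr_gt0.
- by apply: Fa; split=> // n; rewrite ltrDl.
- by apply: Fb; split=> // n; rewrite gtrBl.
Unshelve. all: by end_near. Qed.

Lemma FTC_oy a f F (la lb : R) : rint `]a, +oo[ f ->
  (forall x, a < x -> {for x, continuous f}) ->
  (forall x, a < x -> is_derive x 1 F (f x)) ->
  F x @[x --> a^'+] --> la -> F x @[x --> +oo] --> lb ->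
  \int[mu]_(x in `]a, +oo[) f x = lb - la.
Proof.
move=> If cf dF /cvg_at_rightP Fa /cvg_pinftyP Fb.
have h0 n : 0 < n.+1%:R^-1 :> R by rewrite invr_gt0.
have ca : a + n.+1%:R^-1 @[n --> \oo] --> a.
  rewrite -[X in _ --> X]addr0; apply: cvgD; first exact: cvg_cst.
  exact: inv_nat_cvg0.
(* The right ends start at a + 2, strictly beyond the first left end a + 1. *)
have cb : a + n.+2%:R @[n --> \oo] --> (+oo : set_system R).
  apply/cvgryPge => M; near=> n.
  have : M - a <= n%:R by near: n; exact: nbhs_infty_ger.
  rewrite -(@natr1 _ n.+1) -(@natr1 _ n); lra.
apply: (@FTC_exhaust _ (fun n => a + n.+1%:R^-1) (fun n => a + n.+2%:R) f F) => //.
- move=> n; rewrite ltrD2l (@le_lt_trans _ _ 1)// ?invf_le1 ?ler1n//.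
  by rewrite ltr1n.
- move=> n x /=; rewrite !in_itv/= andbT => /andP[+ _]; apply: lt_le_trans.
  by rewrite ltrDl.
- move=> x /=; rewrite in_itv/= andbT => ax; near=> n.
  apply/andP; split; near: n.
    apply: (cvgr_le a) => //.
  by move/cvgryPge : cb; apply.
- by move=> x /=; rewrite in_itv/= andbT; exact: cf.
- by move=> x /=; rewrite in_itv/= andbT; exact: dF.
- by apply: Fa; split=> // n; rewrite ltrDl.
- exact: Fb.
Unshelve. all: by end_near. Qed.

End ftc.

(** Splitting at a break point c removes c from the count of interior break points; this is the
    measure of the induction in [piecewise_ind]. *)
Lemma count_lt (T : eqType) (P Q : pred T) (s : seq T) c : subpred P Q ->
  c \in s -> ~~ P c -> Q c -> (count P s < count Q s)%N.
Proof.
move=> PQ; elim: s => //= x s IH; rewrite inE => /predU1P[<- nP -> |cs nP Qc].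
  by rewrite (negbTE nP) add0n add1n ltnS sub_count.
rewrite -addnS leq_add//; last exact: IH.
by case: (boolP (P x)) => // /PQ ->.
Qed.

(** * Piecewise continuous integrands *)

Section ftc_piecewise.
Context {R : realType}.
Implicit Types (f g F : R -> R) (D : set R) (a b A B : R) (s : seq R).

Lemma rint_setU f (A B : set R) : measurable A -> measurable B ->
  [disjoint A & B] -> rint A f -> rint B f -> rint (A `|` B) f.
Proof.
move=> mA mB AB /integrableP[/measurable_EFinP mfA ifA].
move=> /integrableP[/measurable_EFinP mfB ifB].
have mf : measurable_fun (A `|` B) f by apply/measurable_funU.
apply/integrableP; split; first by apply/measurable_EFinP; exact: mf.
rewrite ge0_integral_setU//; first by rewrite lte_add_pinfty.
by apply: measurableT_comp => //; apply/measurable_EFinP; exact: mf.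
Qed.

Lemma rint_oo_cc a b f : rint `]a, b[ f -> rint `[a, b] f.
Proof.
move=> If.
have /measurable_EFinP mf := measurable_int _ If.
have mf1 : measurable_fun `[a, b[ f.
  by apply/measurable_fun_itv_obnd_cbndP; exact: mf.
have mf2 : measurable_fun `[a, b] f.
  by apply/measurable_fun_itv_bndo_bndcP; exact: mf1.
have mn D : measurable_fun D f -> measurable_fun D (fun x => `|(EFin \o f) x|)%E.
  by move=> m; apply: measurableT_comp => //; apply/measurable_EFinP; exact: m.
apply/integrableP; split; first by apply/measurable_EFinP; exact: mf2.
rewrite -integral_itv_bndo_bndc; last exact: mn.
rewrite -integral_itv_obnd_cbnd; last exact: mn.
by have /integrableP[] := If.
Qed.

Lemma Rint_oo_cc a b f : rint `]a, b[ f ->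
  \int[mu]_(x in `]a, b[) f x = \int[mu]_(x in `[a, b]) f x.
Proof.
move=> If; have If2 := rint_oo_cc If.
rewrite -Rintegral_itv_bndo_bndc; last first.
  by apply: (integrableS _ _ _ If2) => //; apply: subset_itvl; rewrite bnd_simp.
by rewrite Rintegral_itv_obnd_cbnd.
Qed.

Lemma rint_lim a b f : a < b -> (forall x, a < x < b -> {for x, continuous f}) ->
  cvg (f x @[x --> a^'+]) -> cvg (f x @[x --> b^'-]) -> rint `]a, b[ f.
Proof.
move=> ab cf /cvg_ex[/= la fa] /cvg_ex[/= lb fb].
(* Giving f its limits as end values makes it continuous on the closed interval without changing it
   inside. *)
pose f1 x := if x == a then la else if x == b then lb else f x.
have f1E x : a < x < b -> f1 x = f x.
  by move=> /andP[ax xb]; rewrite /f1 gt_eqF// lt_eqF.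
have cf1 : {within `[a, b], continuous f1}.
  apply/(continuous_within_itvP _ ab); split.
  - move=> x /[!in_itv]/= xab; have := cf x xab.
    rewrite /prop_for /continuous_at f1E//; apply: cvg_trans.
    apply: near_eq_cvg; near=> y; rewrite f1E//.
    by near: y; apply: near_in_itvoo; rewrite in_itv.
  - rewrite {2}/f1 eqxx; apply: cvg_trans fa; apply: near_eq_cvg.
    near=> y; rewrite f1E//; apply/andP; split; near: y.
      exact: nbhs_right_gt.
    exact: nbhs_right_lt.
  - rewrite {2}/f1 (gt_eqF ab) eqxx; apply: cvg_trans fb; apply: near_eq_cvg.
    near=> y; rewrite f1E//; apply/andP; split; near: y.
      exact: nbhs_left_gt.
    exact: nbhs_left_lt.
have : rint `]a, b[ f1.
  apply: (integrableS _ _ _ (rint_continuous_cc cf1)) => //.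
  exact: subset_itv_oo_cc.
apply: eq_integrable => //= x /set_mem/= /[!in_itv]/= xab.
by rewrite f1E.
Unshelve. all: by end_near. Qed.

(** Induction on the number of break points strictly between a and b: cutting at one of them leaves
    fewer on either side. *)
Lemma piecewise_ind s (P : R -> R -> Prop) :
  (forall a c b, a < c -> c < b -> P a c -> P c b -> P a b) ->
  (forall a b, a < b -> (forall x, a < x < b -> x \notin s) -> P a b) ->
  forall a b, a < b -> P a b.
Proof.
move=> Pcat P0 a b ab; have [n] := ubnP (size [seq x <- s | a < x < b]).
elim: n a b ab => // n IH a b ab Hn.
have [/hasP[c cs /andP[ac cb]]|/hasPn Hs] := boolP (has (fun x => a < x < b) s); last first.
  by apply: P0 => // x xab; apply/negP => /Hs; rewrite xab.
apply: (Pcat a c b ac cb); apply: IH => //; rewrite -ltnS; apply: leq_trans Hn;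
    rewrite !size_filter ltnS; apply: (@count_lt _ _ _ _ c) => //;
    rewrite ?ltxx ?andbF ?ac ?cb//.
  by move=> x /andP[-> xc]; rewrite (lt_trans xc).
by move=> x /andP[cx ->]; rewrite (lt_trans ac).
Qed.

Definition one_sided_lim f u := cvg (f x @[x --> u^'-]) /\ cvg (f x @[x --> u^'+]).

Lemma rint_cat f a c b : a <= c -> c <= b -> rint `[a, c] f -> rint `[c, b] f ->
  rint `[a, b] f /\
  \int[mu]_(x in `[a, b]) f x = \int[mu]_(x in `[a, c]) f x + \int[mu]_(x in `[c, b]) f x.
Proof.
move=> ac cb i1 i2.
have U : `[a, c]%classic `|` `]c, b] = `[a, b]%classic.
  by rewrite -itv_bndbnd_setU// bnd_simp.
have i2' : rint `]c, b] f.
  by apply: (integrableS _ _ _ i2) => //; apply: subset_itvr; rewrite bnd_simp.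
have dU : [disjoint `[a, c]%classic & `]c, b]%classic].
  apply/disj_setPS => y [/=]; rewrite 2!in_itv/= => /andP[_ yx] /andP[].
  by rewrite ltNge yx.
have I : rint (`[a, c] `|` `]c, b]) f by exact: rint_setU.
rewrite -U; split => //; rewrite Rintegral_setU//.
by rewrite Rintegral_itv_obnd_cbnd.
Qed.

(** The margins A < a and b < B make a and b interior points, so that the one-sided limits needed at
    the ends are among those assumed; a and b may themselves be break points. *)
Lemma rint_piecewise s f A B a b : a < b -> A < a -> b < B ->
  (forall u, A < u < B -> u \notin s -> {for u, continuous f}) ->
  (forall u, A < u < B -> one_sided_lim f u) -> rint `[a, b] f.
Proof.
move=> ab + + cf lf; move: a b ab.
apply: (@piecewise_ind s (fun a b => A < a -> b < B -> rint `[a, b] f)).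
  move=> a c b ac cb IH1 IH2 Aa bB.
  have [] := rint_cat (ltW ac) (ltW cb) (IH1 Aa (lt_trans cb bB)) (IH2 (lt_trans Aa ac) bB).
  by [].
move=> a b ab xs Aa bB; apply: rint_oo_cc; apply: rint_lim => //.
- move=> x xab; apply: cf (xs _ xab); case/andP: xab => ax xb.
  by rewrite (lt_trans Aa)// (lt_trans xb).
- by apply: (lf a _).2; rewrite Aa (lt_trans ab).
- by apply: (lf b _).1; rewrite bB (lt_trans Aa).
Qed.

Lemma FTC_piecewise s f F A B a b : a < b -> A < a -> b < B ->
  (forall u, A < u < B -> u \notin s -> {for u, continuous f} /\ is_derive u 1 F (f u)) ->
  (forall u, A < u < B -> one_sided_lim f u) ->
  (forall u, A < u < B -> {for u, continuous F}) ->
  rint `[a, b] f /\ \int[mu]_(x in `[a, b]) f x = F b - F a.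
Proof.
move=> + + + dF lf cF.
have cf u : A < u < B -> u \notin s -> {for u, continuous f}.
  by move=> uAB us; exact: (dF u uAB us).1.
have I c d : c < d -> A < c -> d < B -> rint `[c, d] f.
  by move=> cd Ac dB; exact: rint_piecewise cd Ac dB cf lf.
move=> ab Aa bB; split; first exact: I.
move: a b ab Aa bB; apply: (@piecewise_ind s (fun a b => A < a -> b < B ->
    \int[mu]_(x in `[a, b]) f x = F b - F a)).
  move=> a c b ac cb IH1 IH2 Aa bB; have cB := lt_trans cb bB; have Ac := lt_trans Aa ac.
  have [_ ->] := rint_cat (ltW ac) (ltW cb) (I _ _ ac Aa cB) (I _ _ cb Ac bB).
  by rewrite IH1// IH2//; ring.
move=> a b ab xs Aa bB.
have inAB x : a < x < b -> A < x < B.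
  by move=> /andP[ax xb]; rewrite (lt_trans Aa)// (lt_trans xb).
have Is : rint `]a, b[ f.
  by apply: integrableS (I _ _ ab Aa bB) => //; exact: subset_itv_oo_cc.
rewrite -Rint_oo_cc//; apply: FTC_oo => //.
- by move=> x xab; exact: cf (inAB x xab) (xs x xab).
- by move=> x xab; exact: (dF x (inAB x xab) (xs x xab)).2.
- by apply: cvg_at_right_filter; apply: cF; rewrite Aa (lt_trans ab).
- by apply: cvg_at_left_filter; apply: cF; rewrite bB (lt_trans Aa).
Qed.

End ftc_piecewise.

(** * Complex-valued functions *)

Import Normc.

Section complex_numbers.
Context {R : realType}.
Implicit Types (z w : R[i]) (x y : R).

Lemma ReD z w : Re (z + w) = Re z + Re w. Proof. by case: z w => [? ?] []. Qed.
Lemma ImD z w : Im (z + w) = Im z + Im w. Proof. by case: z w => [? ?] []. Qed.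
Lemma ReN z : Re (- z) = - Re z. Proof. by case: z. Qed.
Lemma ImN z : Im (- z) = - Im z. Proof. by case: z. Qed.
Lemma ReB z w : Re (z - w) = Re z - Re w. Proof. by rewrite ReD ReN. Qed.
Lemma ImB z w : Im (z - w) = Im z - Im w. Proof. by rewrite ImD ImN. Qed.
Lemma ReM z w : Re (z * w) = Re z * Re w - Im z * Im w.
Proof. by case: z w => [? ?] []. Qed.
Lemma ImM z w : Im (z * w) = Re z * Im w + Im z * Re w.
Proof. by case: z w => [? ?] []. Qed.
Lemma ReC x : Re x%:C = x. Proof. by []. Qed.
Lemma ImC x : Im x%:C = 0. Proof. by []. Qed.
Lemma ReI x y : Re (x +i* y) = x. Proof. by []. Qed.
Lemma ImI x y : Im (x +i* y) = y. Proof. by []. Qed.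
Lemma Re1 : Re (1 : R[i]) = 1. Proof. by []. Qed.
Lemma Im1 : Im (1 : R[i]) = 0. Proof. by []. Qed.
Lemma Re0 : Re (0 : R[i]) = 0. Proof. by []. Qed.
Lemma Im0 : Im (0 : R[i]) = 0. Proof. by []. Qed.
Lemma natC n : (n%:R : R[i]) = (n%:R)%:C. Proof. by rewrite rmorph_nat. Qed.
Lemma Renat n : Re (n%:R : R[i]) = n%:R. Proof. by rewrite natC. Qed.
Lemma Imnat n : Im (n%:R : R[i]) = 0. Proof. by rewrite natC. Qed.

Definition complexRI := (ReD, ImD, ReN, ImN, ReM, ImM, ReC, ImC, ReI, ImI,
  Re1, Im1, Re0, Im0, Renat, Imnat).

Lemma complexP z w : Re z = Re w -> Im z = Im w -> z = w.
Proof. by case: z w => [? ?] [? ?] /= -> ->. Qed.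

Lemma Re_sum I (s : seq I) (P : pred I) (F : I -> R[i]) :
  Re (\sum_(i <- s | P i) F i) = \sum_(i <- s | P i) Re (F i).
Proof. by elim/big_rec2 : _ => // i x z _ <-; rewrite ReD. Qed.

Lemma Im_sum I (s : seq I) (P : pred I) (F : I -> R[i]) :
  Im (\sum_(i <- s | P i) F i) = \sum_(i <- s | P i) Im (F i).
Proof. by elim/big_rec2 : _ => // i x z _ <-; rewrite ImD. Qed.

Lemma normc_sqrt z : normc z = Num.sqrt (Re z ^+ 2 + Im z ^+ 2).
Proof. by case: z. Qed.

Lemma normc_ge0 z : 0 <= normc z. Proof. by rewrite normc_sqrt sqrtr_ge0. Qed.

Lemma normc_gt0 z : z != 0 -> 0 < normc z.
Proof.
move=> z0; rewrite lt_neqAle normc_ge0 andbT eq_sym; apply: contra z0 => /eqP.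
by move/eq0_normc => ->.
Qed.

Lemma normc_sqr z : normc z ^+ 2 = Re z ^+ 2 + Im z ^+ 2.
Proof. by rewrite normc_sqrt sqr_sqrtr// addr_ge0// sqr_ge0. Qed.

Lemma normcX z n : normc (z ^+ n) = normc z ^+ n.
Proof. by elim: n => [|n IH]; rewrite ?expr0 ?normc1// !exprS normcM IH. Qed.

Lemma normrRe z : `|Re z| <= normc z.
Proof. by rewrite normc_sqrt -sqrtr_sqr ler_wsqrtr// lerDl sqr_ge0. Qed.

Lemma normrIm z : `|Im z| <= normc z.
Proof. by rewrite normc_sqrt -sqrtr_sqr ler_wsqrtr// lerDr sqr_ge0. Qed.

Lemma normc_leRI z : normc z <= `|Re z| + `|Im z|.
Proof.
rewrite -(@ler_pXn2r _ 2)// ?nnegrE ?normc_ge0 ?addr_ge0//.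
rewrite normc_sqr sqrrD !real_normK ?num_real// lerD2r lerDl mulrn_wge0//.
Qed.

Lemma normcC x : normc x%:C = `|x|.
Proof. by rewrite normc_sqrt ReC ImC expr0n addr0 sqrtr_sqr. Qed.

Lemma normc_triangle z w : normc (z + w) <= normc z + normc w.
Proof. exact: le_normcD. Qed.

Lemma normc_opp z : normc (- z) = normc z. Proof. exact: normcN. Qed.

Lemma normc_distrC z w : normc (z - w) = normc (w - z).
Proof. by rewrite -normc_opp opprB. Qed.

Lemma le_normcB z w : normc z - normc w <= normc (z - w).
Proof. by rewrite lerBlDr (le_trans _ (normc_triangle _ _))// subrK. Qed.

Lemma cexp0 : cexp (0 : R[i]) = 1.
Proof. by apply: complexP; rewrite /cexp /= expR0 ?cos0 ?sin0 mul1r. Qed.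

Lemma cexpD z w : cexp (z + w) = cexp z * cexp w.
Proof.
apply: complexP; rewrite ?ReM ?ImM /cexp !ReI !ImI !ReD !ImD expRD.
  by rewrite cosD; ring.
by rewrite sinD; ring.
Qed.

Lemma normc_cexp z : normc (cexp z) = expR (Re z).
Proof.
rewrite normc_sqrt /cexp ReI ImI !exprMn -mulrDr cos2Dsin2 mulr1 sqrtr_sqr.
by rewrite gtr0_norm// expR_gt0.
Qed.

Lemma cexpC x : cexp x%:C = (expR x)%:C.
Proof. by rewrite /cexp ReC ImC cos0 sin0 mulr1 mulr0. Qed.

Lemma Re_invc z : Re z^-1 = Re z / normc z ^+ 2.
Proof. by rewrite normc_sqr; case: z. Qed.

Lemma Im_invc z : Im z^-1 = - Im z / normc z ^+ 2.
Proof. by rewrite normc_sqr; case: z => a b /=; rewrite mulNr. Qed.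

End complex_numbers.

Section paths.
Context {R : realType}.
Implicit Types (f g : R -> R[i]) (x : R) (d e : R[i]).

(** Componentwise, so that the real fundamental theorem and the real chain rule apply to each part
    of a path. *)
Definition cderiv f x d := is_derive x 1 (fun t => Re (f t)) (Re d) /\
  is_derive x 1 (fun t => Im (f t)) (Im d).

Definition ccont f x := {for x, continuous (fun t => Re (f t))} /\
  {for x, continuous (fun t => Im (f t))}.

Lemma is_derive_cont (h : R -> R) x l : is_derive x 1 h l -> {for x, continuous h}.
Proof.
by move=> [dx _]; exact/differentiable_continuous/derivable1_diffP.
Qed.

Lemma cderiv_ccont f x d : cderiv f x d -> ccont f x.
Proof. by move=> [/is_derive_cont ? /is_derive_cont]. Qed.

Lemma is_derive_ext (h k : R -> R) x l m :
  (forall y, h y = k y) -> l = m -> is_derive x 1 h l -> is_derive x 1 k m.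
Proof. by move=> /funext -> ->. Qed.

Lemma cderiv_eq f x d e : cderiv f x d -> d = e -> cderiv f x e.
Proof. by move=> ? <-. Qed.

Lemma cderiv_cst c x : cderiv (fun _ => c) x 0.
Proof. by split => /=; exact: is_derive_cst. Qed.

Lemma cderiv_id x : cderiv (fun t => t%:C) x 1.
Proof. by split => /=; [exact: is_derive_id|exact: is_derive_cst]. Qed.

Lemma cderivD f g x d e : cderiv f x d -> cderiv g x e ->
  cderiv (fun t => f t + g t) x (d + e).
Proof.
move=> [f1 f2] [g1 g2]; split.
  by apply: is_derive_ext (is_deriveD f1 g1) => [y|]; rewrite ReD.
by apply: is_derive_ext (is_deriveD f2 g2) => [y|]; rewrite ImD.
Qed.

Lemma cderivN f x d : cderiv f x d -> cderiv (fun t => - f t) x (- d).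
Proof.
move=> [f1 f2]; split.
  by apply: is_derive_ext (is_deriveN f1) => [y|]; rewrite ReN.
by apply: is_derive_ext (is_deriveN f2) => [y|]; rewrite ImN.
Qed.

Lemma cderivB f g x d e : cderiv f x d -> cderiv g x e ->
  cderiv (fun t => f t - g t) x (d - e).
Proof. by move=> df /cderivN; exact: cderivD. Qed.

Lemma cderivM f g x d e : cderiv f x d -> cderiv g x e ->
  cderiv (fun t => f t * g t) x (d * g x + f x * e).
Proof.
move=> [f1 f2] [g1 g2]; split.
  apply: is_derive_ext (is_deriveB (is_deriveM f1 g1) (is_deriveM f2 g2)).
    by move=> y; rewrite ReM.
  by rewrite ReD !ReM /GRing.scale /=; ring.
apply: is_derive_ext (is_deriveD (is_deriveM f1 g2) (is_deriveM f2 g1)).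
  by move=> y; rewrite ImM.
by rewrite ImD !ImM /GRing.scale /=; ring.
Qed.

Lemma cderivZ c f x d : cderiv f x d -> cderiv (fun t => c * f t) x (c * d).
Proof.
move=> df; apply: cderiv_eq (cderivM (cderiv_cst c x) df) _.
by rewrite mul0r add0r.
Qed.

Lemma cderiv_cexp f x d : cderiv f x d ->
  cderiv (fun t => cexp (f t)) x (d * cexp (f x)).
Proof.
move=> [f1 f2].
have e1 := is_derive1_comp (is_derive_expR (Re (f x))) f1.
have c1 := is_derive1_comp (is_derive_cos (Im (f x))) f2.
have s1 := is_derive1_comp (is_derive_sin (Im (f x))) f2.
split.
  apply: is_derive_ext (is_deriveM e1 c1) => //.
  by rewrite ReM /cexp !ReI !ImI /GRing.scale /=; ring.
apply: is_derive_ext (is_deriveM e1 s1) => //.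
by rewrite ImM /cexp !ReI !ImI /GRing.scale /=; ring.
Qed.

Lemma cont_ext (h k : R -> R) x : (forall y, k y = h y) ->
  {for x, continuous h} -> {for x, continuous k}.
Proof. by move=> /funext ->. Qed.

Lemma cont_sqr (h : R -> R) x : {for x, continuous h} ->
  {for x, continuous (fun t => h t ^+ 2)}.
Proof. by move=> ch; apply: (cont_ext (fun y => expr2 _)); exact: continuousM. Qed.

Lemma ccont_cst c x : ccont (fun _ => c) x.
Proof. exact: cderiv_ccont (cderiv_cst _ _). Qed.

Lemma ccont_id x : ccont (fun t => t%:C) x.
Proof. exact: cderiv_ccont (cderiv_id _). Qed.

Lemma ccontD f g x : ccont f x -> ccont g x -> ccont (fun t => f t + g t) x.
Proof.
move=> [f1 f2] [g1 g2]; split.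
  by apply: (cont_ext (fun y => ReD _ _)); exact: continuousD.
by apply: (cont_ext (fun y => ImD _ _)); exact: continuousD.
Qed.

Lemma ccontN f x : ccont f x -> ccont (fun t => - f t) x.
Proof.
move=> [f1 f2]; split.
  by apply: (cont_ext (fun y => ReN _)); exact: continuousN.
by apply: (cont_ext (fun y => ImN _)); exact: continuousN.
Qed.

Lemma ccontM f g x : ccont f x -> ccont g x -> ccont (fun t => f t * g t) x.
Proof.
move=> [f1 f2] [g1 g2]; split.
  by apply: (cont_ext (fun y => ReM _ _)); apply: continuousB; exact: continuousM.
by apply: (cont_ext (fun y => ImM _ _)); apply: continuousD; exact: continuousM.
Qed.

Lemma cont_normc f x : ccont f x -> {for x, continuous (fun t => normc (f t))}.
Proof.
move=> [f1 f2]; apply: (cont_ext (fun y => normc_sqrt _)).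
apply: (@continuous_comp _ _ _ (fun t => Re (f t) ^+ 2 + Im (f t) ^+ 2) Num.sqrt).
  by apply: continuousD; exact: cont_sqr.
exact: sqrt_continuous.
Qed.

Lemma ccontV f x : ccont f x -> f x != 0 -> ccont (fun t => (f t)^-1) x.
Proof.
move=> cf f0.
have n0 : normc (f x) ^+ 2 != 0 by rewrite expf_neq0// gt_eqF// normc_gt0.
have cn : {for x, continuous (fun t => (normc (f t) ^+ 2)^-1)}.
  apply: continuousV => //.
  by apply: cont_sqr; exact: cont_normc.
case: (cf) => f1 f2; split.
  by apply: (cont_ext (fun y => Re_invc _)); exact: continuousM.
apply: (cont_ext (fun y => Im_invc _)).
by apply: continuousM => //; exact: continuousN.
Qed.

Lemma ccont_cexp f x : ccont f x -> ccont (fun t => cexp (f t)) x.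
Proof.
move=> [f1 f2].
have e1 : {for x, continuous (fun t => expR (Re (f t)))}.
  by apply: continuous_comp f1 _; exact: continuous_expR.
split; rewrite /cexp /=; apply: continuousM => //.
  by apply: continuous_comp f2 _; exact: continuous_cos.
by apply: continuous_comp f2 _; exact: continuous_sin.
Qed.

End paths.

(** * Uniform differentiability and primitives *)

Section holomorphic.
Context {R : realType}.
Implicit Types (Q : set R[i]) (F G : R[i] -> R[i]) (z w : R[i]).

(* A quadratic remainder that is uniform on Q: no compactness argument is needed to
   bound F and F', or to find primitives on bounded convex sets. *)
Definition holo Q F F' := exists2 C : R, 0 <= C & forall z, Q z ->
  [/\ normc (F z) <= C, normc (F' z) <= C & forall w, Q w ->
    normc (F w - F z - F' z * (w - z)) <= C * normc (w - z) ^+ 2].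

Definition cbounded Q := exists2 B : R, 0 <= B & forall z, Q z -> normc z <= B.

Lemma cbounded_dist Q : cbounded Q ->
  exists2 B : R, 0 <= B & forall z w, Q z -> Q w -> normc (w - z) <= B.
Proof.
move=> [B B0 HB]; exists (B + B); first by rewrite addr_ge0.
move=> z w Qz Qw; apply: le_trans (normc_triangle _ _) _.
by rewrite normc_opp lerD// HB.
Qed.

Lemma eq_holo Q F F' G G' : (forall z, Q z -> F z = G z) ->
  (forall z, Q z -> F' z = G' z) -> holo Q F F' -> holo Q G G'.
Proof.
move=> FG FG' [C C0 H]; exists C => // z Qz; have [? ? K] := H z Qz.
rewrite -FG// -FG'//; split => // w Qw; rewrite -FG//; exact: K.
Qed.

(** Boundedness of Q turns the quadratic remainder into a linear one. *)
Lemma holo_lip Q F F' : cbounded Q -> holo Q F F' ->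
  exists2 C : R, 0 <= C & forall z w, Q z -> Q w -> normc (F w - F z) <= C * normc (w - z).
Proof.
move=> /cbounded_dist[B B0 HB] [C C0 H]; exists (C * B + C).
  by rewrite addr_ge0// mulr_ge0.
move=> z w Qz Qw; have [_ F'z /(_ w Qw) K] := H z Qz.
have -> : F w - F z = F w - F z - F' z * (w - z) + F' z * (w - z) by ring.
apply: le_trans (normc_triangle _ _) _; rewrite normcM mulrDl lerD//.
  apply: le_trans K _; rewrite expr2 mulrA ler_wpM2r ?normc_ge0// ler_wpM2l//.
  exact: HB.
by rewrite ler_wpM2r// normc_ge0.
Qed.

Lemma holo_cst Q c : holo Q (fun _ => c) (fun _ => 0).
Proof.
exists (normc c) => [|z _]; first exact: normc_ge0.
rewrite normc0 normc_ge0; split => // w _.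
by rewrite subrr mul0r subr0 normc0 mulr_ge0 ?normc_ge0// exprn_ge0// normc_ge0.
Qed.

Lemma holo_id Q : cbounded Q -> holo Q id (fun _ => 1).
Proof.
move=> [B B0 HB]; exists (B + 1) => [|z Qz]; first by rewrite addr_ge0.
split => [||w _]; first by rewrite ler_wpDr// HB.
  by rewrite normc1 ler_wpDl.
rewrite mul1r subrr normc0 mulr_ge0 ?addr_ge0//.
by rewrite exprn_ge0// normc_ge0.
Qed.

Lemma holoD Q F F' G G' : holo Q F F' -> holo Q G G' ->
  holo Q (fun z => F z + G z) (fun z => F' z + G' z).
Proof.
move=> [C C0 HC] [D D0 HD]; exists (C + D); first by rewrite addr_ge0.
move=> z Qz; have [a1 a2 a3] := HC z Qz; have [b1 b2 b3] := HD z Qz; split.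
- by apply: le_trans (normc_triangle _ _) _; rewrite lerD.
- by apply: le_trans (normc_triangle _ _) _; rewrite lerD.
- move=> w Qw; have -> : F w + G w - (F z + G z) - (F' z + G' z) * (w - z) =
    F w - F z - F' z * (w - z) + (G w - G z - G' z * (w - z)) by ring.
  by apply: le_trans (normc_triangle _ _) _; rewrite mulrDl lerD ?a3 ?b3.
Qed.

Lemma holoM Q F F' G G' : cbounded Q -> holo Q F F' -> holo Q G G' ->
  holo Q (fun z => F z * G z) (fun z => F' z * G z + F z * G' z).
Proof.
move=> bQ hF hG; have [LF LF0 lF] := holo_lip bQ hF.
have [LG LG0 lG] := holo_lip bQ hG.
move: hF hG => [C C0 HC] [D D0 HD].
exists (C * D + C * D + LF * LG); first by rewrite !addr_ge0// mulr_ge0.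
move=> z Qz; have [a1 a2 a3] := HC z Qz; have [b1 b2 b3] := HD z Qz; split.
- rewrite normcM -addrA ler_wpDr ?addr_ge0 ?mulr_ge0//.
  by apply: ler_pM => //; exact: normc_ge0.
- apply: le_trans (normc_triangle _ _) _; rewrite !normcM ler_wpDr ?mulr_ge0//.
  by rewrite lerD//; apply: ler_pM => //; exact: normc_ge0.
(* Besides the two remainders there is a product of increments, which is quadratic by the Lipschitz
   bounds. *)
- move=> w Qw; have -> : F w * G w - F z * G z - (F' z * G z + F z * G' z) * (w - z) =
    (F w - F z - F' z * (w - z)) * G z + F z * (G w - G z - G' z * (w - z)) +
    (F w - F z) * (G w - G z) by ring.
  have h1 : normc ((F w - F z - F' z * (w - z)) * G z) <=
      C * D * normc (w - z) ^+ 2.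
    by rewrite normcM mulrAC; apply: ler_pM; rewrite ?normc_ge0// a3.
  have h2 : normc (F z * (G w - G z - G' z * (w - z))) <=
      C * D * normc (w - z) ^+ 2.
    by rewrite normcM -mulrA; apply: ler_pM; rewrite ?normc_ge0// b3.
  have h3 : normc ((F w - F z) * (G w - G z)) <= LF * LG * normc (w - z) ^+ 2.
    have -> : LF * LG * normc (w - z) ^+ 2 =
      (LF * normc (w - z)) * (LG * normc (w - z)) by ring.
    by rewrite normcM; apply: ler_pM; rewrite ?normc_ge0// ?lF ?lG.
  apply: le_trans (normc_triangle _ _) _.
  rewrite [leRHS]mulrDl lerD// [leRHS]mulrDl.
  by apply: le_trans (normc_triangle _ _) _; rewrite lerD.
Qed.

Lemma holo_comp Q Q2 F F' G G' : cbounded Q -> (forall z, Q z -> Q2 (G z)) ->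
  holo Q2 F F' -> holo Q G G' ->
  holo Q (fun z => F (G z)) (fun z => F' (G z) * G' z).
Proof.
move=> bQ QQ2 [C C0 HC] hG; have [L L0 lG] := holo_lip bQ hG.
move: hG => [D D0 HD].
exists (C + C * D + C * L ^+ 2); first by rewrite !addr_ge0 ?mulr_ge0 ?exprn_ge0.
move=> z Qz; have [a1 a2 a3] := HC _ (QQ2 z Qz); have [b1 b2 b3] := HD z Qz.
split.
- by rewrite -addrA ler_wpDr// ?addr_ge0 ?mulr_ge0 ?exprn_ge0.
- rewrite normcM ler_wpDr ?mulr_ge0 ?exprn_ge0// ler_wpDl//.
  by apply: ler_pM => //; exact: normc_ge0.
- move=> w Qw; have -> : F (G w) - F (G z) - F' (G z) * G' z * (w - z) =
    (F (G w) - F (G z) - F' (G z) * (G w - G z)) +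
    F' (G z) * (G w - G z - G' z * (w - z)) by ring.
  apply: le_trans (normc_triangle _ _) _.
  have h1 : normc (F (G w) - F (G z) - F' (G z) * (G w - G z)) <=
      C * L ^+ 2 * normc (w - z) ^+ 2.
    apply: le_trans (a3 _ (QQ2 w Qw)) _; rewrite -mulrA ler_wpM2l// -exprMn.
    by rewrite lerXn2r ?nnegrE ?normc_ge0// ?mulr_ge0 ?normc_ge0// lG.
  have h2 : normc (F' (G z) * (G w - G z - G' z * (w - z))) <=
      C * D * normc (w - z) ^+ 2.
    by rewrite normcM -mulrA; apply: ler_pM; rewrite ?normc_ge0// b3.
  apply: le_trans (lerD h1 h2) _.
  rewrite -mulrDl ler_wpM2r ?exprn_ge0 ?normc_ge0//; lra.
Qed.

End holomorphic.

(** * Second-order estimates for exp, sin and cos *)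

Section elementary_bounds.
Context {R : realType}.
Implicit Types (a b x y : R).

Lemma lerV2_pos x y : 0 < x -> x <= y -> y^-1 <= x^-1.
Proof. by move=> x0 xy; rewrite lef_pV2// posrE (lt_le_trans x0). Qed.

Lemma MVT_norm (f df : R -> R) (M : R) x y : (forall t : R, is_derive t 1 f (df t)) ->
  (forall t : R, `|t - x| <= `|y - x| -> `|df t| <= M) ->
  `|f y - f x| <= M * `|y - x|.
Proof.
move=> dF Mdf.
have cf s t : {within `[s, t], continuous f}.
  by apply: continuous_at_within => u _; exact: is_derive_cont (dF u).
have [xy|yx] := leP x y.
  have [c /[!in_itv]/= /andP[xc cy] ->] := MVT_segment xy (fun t _ => dF t) (cf _ _).
  by rewrite normrM ler_wpM2r// Mdf// !ger0_norm ?subr_ge0// lerD2r.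
have [c /[!in_itv]/= /andP[yc cx] E] := MVT_segment (ltW yx) (fun t _ => dF t) (cf _ _).
rewrite -normrN opprB E normrM [`|x - y|]distrC ler_wpM2r// Mdf//.
by rewrite [`|c - x|]distrC [`|y - x|]distrC !ger0_norm ?subr_ge0// ?(ltW yx)// lerD2l lerN2.
Qed.

Lemma norm_sin_le x : `|sin x| <= `|x|.
Proof.
have := @MVT_norm sin cos 1 0 x (fun t => is_derive_sin t).
rewrite sin0 !subr0 mul1r; apply => t _; exact: cos_max.
Qed.

Lemma norm_cosB1_le x : `|cos x - 1| <= x ^+ 2.
Proof.
(* Between 0 and x the derivative is at most |x| by [norm_sin_le], whence the square. *)
have := @MVT_norm cos (fun t => - sin t) `|x| 0 x (fun t => is_derive_cos t).
rewrite cos0 !subr0 -expr2 real_normK ?num_real//; apply => t.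
by rewrite subr0 normrN; apply: le_trans; exact: norm_sin_le.
Qed.

(** Half-angle formula: 1 - cos x is twice the square of sin (x / 2). *)
Lemma cos_ge1B x : 1 - x ^+ 2 / 2 <= cos x.
Proof.
have -> : x = (x / 2) *+ 2 by rewrite mulr2n; lra.
rewrite cos_mulr2n cos2sin2 mulr2n.
have : sin (x / 2) ^+ 2 <= (x / 2) ^+ 2.
  rewrite -[leLHS]real_normK ?num_real// -[leRHS]real_normK ?num_real//.
  by rewrite lerXn2r ?nnegrE// norm_sin_le.
have -> : (x / 2 + x / 2) ^+ 2 = 4 * (x / 2) ^+ 2 by ring.
move: (sin _ ^+ 2) ((x / 2) ^+ 2) => s t st; rewrite -mulr_natr; lra.
Qed.

Lemma norm_sinB_le x : `|sin x - x| <= x ^+ 2.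
Proof.
have d (t : R) : is_derive t 1 (fun t => sin t - t) (cos t - 1).
  exact: (is_deriveB (is_derive_sin t) (is_derive_id t 1)).
have := @MVT_norm (fun t => sin t - t) (fun t => cos t - 1) `|x| 0 x d.
rewrite sin0 !subr0 -expr2 real_normK ?num_real//; apply => t.
rewrite subr0; apply: le_trans.
have d2 (u : R) : is_derive u 1 (fun t : R => cos t - 1) (- sin u).
  have c1 : is_derive u 1 (fun _ : R => 1 : R) 0 by exact: is_derive_cst.
  by rewrite -[- sin u]subr0; exact: (is_deriveB (is_derive_cos u) c1).
have := @MVT_norm (fun t : R => cos t - 1) (fun t => - sin t) 1 0 t d2.
rewrite cos0 subrr !subr0 mul1r; apply => u _.
by rewrite normrN; exact: sin_max.
Qed.

Lemma expRB1_le a : expR a - 1 <= a * expR a.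
Proof.
have := expR_ge1Dx (- a); rewrite expRN => h.
have e0 := expR_gt0 a.
have : (1 - a) * expR a <= 1.
  by rewrite -ler_pdivlMr// div1r.
lra.
Qed.

Lemma norm_expRB1_le a : `|expR a - 1| <= `|a| * (1 + expR a).
Proof.
have h1 := expRB1_le a; have h2 := expR_ge1Dx a; have e0 := expR_gt0 a.
rewrite ler_norml; have [a0|a0] := leP 0 a.
  rewrite ger0_norm//; apply/andP; split; nra.
rewrite ltr0_norm//; apply/andP; split; nra.
Qed.

Lemma expRB1B_le a : `|expR a - 1 - a| <= a ^+ 2 * (1 + expR a).
Proof.
have h1 := expRB1_le a; have h2 := expR_ge1Dx a; have e0 := expR_gt0 a.
rewrite ger0_norm; last by lra.
apply: (@le_trans _ _ (a * (expR a - 1))); first by lra.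
apply: le_trans (ler_norm _) _; rewrite normrM.
apply: le_trans (ler_wpM2l (normr_ge0 a) (norm_expRB1_le a)) _.
by rewrite mulrA -expr2 real_normK ?num_real.
Qed.

(** Combined with cexp (z + h) = cexp z * cexp h, this gives both the holomorphy of the exponential
    on bounded sets and the differentiation of Euler's integral under the integral sign. *)
Lemma cexp_second_order (w : R[i]) :
  normc (cexp w - 1 - w) <= 2 * (1 + expR (Re w)) * normc w ^+ 2.
Proof.
apply: le_trans (normc_leRI _) _; rewrite normc_sqr.
case: w => a b; rewrite !complexRI /cexp ?(ReI, ImI) subr0.
have e0 := expR_gt0 a.
have h1 : `|expR a * cos b - 1 - a| <= expR a * b ^+ 2 + a ^+ 2 * (1 + expR a).
  have -> : expR a * cos b - 1 - a = expR a * (cos b - 1) + (expR a - 1 - a) by ring.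
  apply: le_trans (ler_normD _ _) _; rewrite lerD ?expRB1B_le//.
  rewrite normrM gtr0_norm//; apply: ler_wpM2l; [exact: ltW|exact: norm_cosB1_le].
have h2 : `|expR a * sin b - b| <= `|a| * (1 + expR a) * `|b| + b ^+ 2.
  have -> : expR a * sin b - b = (expR a - 1) * sin b + (sin b - b) by ring.
  apply: le_trans (ler_normD _ _) _; rewrite lerD ?norm_sinB_le//.
  by rewrite normrM ler_pM ?norm_expRB1_le ?norm_sin_le.
apply: le_trans (lerD h1 h2) _.
have h3 : `|a| * `|b| * 2 <= a ^+ 2 + b ^+ 2.
  rewrite -(real_normK (num_real a)) -(real_normK (num_real b)).
  have := sqr_ge0 (`|a| - `|b|); lra.
have h4 : 0 <= a ^+ 2 by exact: sqr_ge0.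
have h5 : 0 <= b ^+ 2 by exact: sqr_ge0.
set A := a ^+ 2 in h3 h4 *; set B := b ^+ 2 in h3 h5 *; set E := expR a in e0 *.
set n1 := `|a| in h3 *; set n2 := `|b| in h3 *.
have : (n1 * n2 * 2) * (1 + E) <= (A + B) * (1 + E) by rewrite ler_wpM2r//; lra.
have : 0 <= A * E by rewrite mulr_ge0// ltW.
have : 0 <= B * E by rewrite mulr_ge0// ltW.
nra.
Qed.

End elementary_bounds.

Section holomorphic_examples.
Context {R : realType}.
Implicit Types (Q : set R[i]) (F G : R[i] -> R[i]) (z w : R[i]).

Lemma holo_cexp Q : cbounded Q -> holo Q cexp cexp.
Proof.
move=> [B B0 HB]; exists (expR B * (2 * (1 + expR (B + B))) + expR B).
  have := expR_ge0 B; have := expR_ge0 (B + B); nra.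
move=> z Qz.
have Rz w : Q w -> expR (Re w) <= expR B.
  by move=> /HB h; rewrite ler_expR (le_trans (ler_norm _))// (le_trans (normrRe _)).
have N : normc (cexp z) <= expR B * (2 * (1 + expR (B + B))) + expR B.
  rewrite normc_cexp ler_wpDl ?Rz//.
split => // w Qw.
have -> : cexp w - cexp z - cexp z * (w - z) = cexp z * (cexp (w - z) - 1 - (w - z)).
  have -> : cexp w = cexp z * cexp (w - z) by rewrite -cexpD addrC subrK.
  by ring.
rewrite normcM normc_cexp.
apply: le_trans (ler_wpM2l (expR_ge0 _) (cexp_second_order _)) _.
rewrite [leLHS]mulrA; apply: ler_wpM2r; first by rewrite exprn_ge0 ?normc_ge0.
apply: ler_wpDr; first exact: expR_ge0.
apply: ler_pM; [exact: expR_ge0|by rewrite mulr_ge0 ?addr_ge0 ?expR_ge0|exact: Rz|].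
rewrite ler_wpM2l// lerD2l ler_expR ReB lerD//.
  by rewrite (le_trans (ler_norm _))// (le_trans (normrRe _))// HB.
by rewrite (le_trans (ler_norm _))// normrN (le_trans (normrRe _))// HB.
Qed.

Lemma normc_neq0 z : 0 < normc z -> z != 0.
Proof. by apply: contraTneq => ->; rewrite normc0 ltxx. Qed.

Lemma holo_inv (c : R) : 0 < c ->
  holo (fun z : R[i] => c <= normc z) (fun z => z^-1) (fun z => - (z ^+ 2)^-1).
Proof.
move=> c0; have ci : 0 <= c^-1 by rewrite invr_ge0 ltW.
exists (c^-1 + c^-1 ^+ 2 + c^-1 ^+ 3); first by rewrite !addr_ge0 ?exprn_ge0.
have inv_le z : c <= normc z -> normc z^-1 <= c^-1.
  by move=> cz; rewrite normcV lef_pV2// posrE// (lt_le_trans c0).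
move=> z cz; split.
- by rewrite -addrA ler_wpDr ?addr_ge0 ?exprn_ge0// inv_le.
- rewrite normc_opp -exprVn normcX addrAC ler_wpDl ?addr_ge0 ?exprn_ge0//.
  by rewrite lerXn2r ?nnegrE ?normc_ge0// inv_le.
- move=> w cw.
  have z0 : z != 0 by apply: normc_neq0; exact: lt_le_trans cz.
  have w0 : w != 0 by apply: normc_neq0; exact: lt_le_trans cw.
  have -> : w^-1 - z^-1 - - (z ^+ 2)^-1 * (w - z) = z^-1 ^+ 2 * w^-1 * (w - z) ^+ 2.
    by field; rewrite z0 w0.
  rewrite normcM normcX ler_wpM2r ?exprn_ge0 ?normc_ge0//.
  rewrite ler_wpDl ?addr_ge0 ?exprn_ge0// normcM normcX.
  have -> : c^-1 ^+ 3 = c^-1 ^+ 2 * c^-1 by rewrite -exprSr.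
  apply: ler_pM; rewrite ?exprn_ge0 ?normc_ge0// ?inv_le//.
  by rewrite lerXn2r ?nnegrE ?normc_ge0// inv_le.
Qed.

Lemma holoV Q F F' (c : R) : cbounded Q -> 0 < c -> (forall z, Q z -> c <= normc (F z)) ->
  holo Q F F' -> holo Q (fun z => (F z)^-1) (fun z => - (F z ^+ 2)^-1 * F' z).
Proof. by move=> bQ c0 cF; apply: holo_comp bQ _ (holo_inv c0) => z /cF. Qed.

Lemma holo_affine Q (a b : R[i]) : cbounded Q -> holo Q (fun z => a + b * z) (fun _ => b).
Proof.
move=> bQ; have := holoD (holo_cst Q a) (holoM bQ (holo_cst Q b) (holo_id bQ)).
by apply: eq_holo => // z _; rewrite mul0r !add0r mulr1.
Qed.

Lemma holo_cexp_affine Q (a b : R[i]) : cbounded Q ->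
  holo Q (fun z => cexp (a + b * z)) (fun z => b * cexp (a + b * z)).
Proof.
move=> bQ; have [B B0 HB] := bQ.
have H := holo_affine a b bQ.
pose Q2 : set R[i] := fun z => normc z <= normc a + normc b * B.
have bQ2 : cbounded Q2.
  by exists (normc a + normc b * B) => //; rewrite addr_ge0 ?mulr_ge0 ?normc_ge0.
apply: eq_holo (holo_comp bQ _ (holo_cexp bQ2) H) => // z Qz.
  by rewrite mulrC.
rewrite /Q2; apply: le_trans (normc_triangle _ _) _; rewrite normcM lerD2l.
by rewrite ler_wpM2l ?normc_ge0// HB.
Qed.

(** Caratheodory's form of the derivative: the increment of F along g is k y * (y - x) with k
    continuous at x. The factor k is F' (g x) times the slope of g, plus the remainder divided by y
    - x, which tends to 0 because the remainder is of order (y - x)^2. *)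
Lemma holo_path Q F F' (g : R -> R[i]) x d : holo Q F F' ->
  (\forall y \near x, Q (g y)) -> cderiv g x d ->
  cderiv (fun t => F (g t)) x (F' (g x) * d).
Proof.
move=> [C C0 HC] nQ [/is_derive1_caratheodory[u [uE cu ud]]].
move=> /is_derive1_caratheodory[v [vE cv vd]].
have Qgx : Q (g x) by exact: nbhs_singleton nQ.
have [_ _ K] := HC _ Qgx.
pose h y := u y +i* v y.
have gE y : g y - g x = h y * (y - x)%:C.
  by apply: complexP; rewrite !complexRI ?uE ?vE; ring.
have ch : ccont h x by split.
pose E y := F (g y) - F (g x) - F' (g x) * (g y - g x).
pose e y := E y * ((y - x)%:C)^-1.
have Ex : E x = 0 by rewrite /E !subrr mulr0 subrr.
have eE y : E y = e y * (y - x)%:C.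
  have [->|yx] := eqVneq y x; first by rewrite Ex subrr mulr0.
  rewrite /e -mulrA mulVf ?mulr1//; apply: normc_neq0.
  by rewrite normcC normr_gt0 subr_eq0.
have ex : e x = 0 by rewrite /e Ex mul0r.
have en : \forall y \near x, normc (e y) <= C * normc (h y) ^+ 2 * `|y - x|.
  near=> y; have Qy : Q (g y) by near: y.
  have [->|yx] := eqVneq y x; first by rewrite ex normc0 subrr normr0 mulr0.
  have yx0 : 0 < `|y - x| by rewrite normr_gt0 subr_eq0.
  rewrite /e normcM normcV normcC ler_pdivrMr//.
  apply: le_trans (K _ Qy) _.
  by rewrite gE normcM normcC exprMn -[`|y - x| ^+ 2]/(`|y - x| * `|y - x|) !mulrA.
have cbnd : (fun y => C * normc (h y) ^+ 2 * `|y - x|) y @[y --> x] --> (0 : R).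
  have : {for x, continuous (fun y : R => C * normc (h y) ^+ 2 * `|y - x|)}.
    apply: (@continuousM _ _ (fun y : R => C * normc (h y) ^+ 2) (fun y => `|y - x|)).
      apply: (@continuousM _ _ (fun=> C) (fun y => normc (h y) ^+ 2)).
        exact: cst_continuous.
      by apply: cont_sqr; exact: cont_normc.
    apply: (@continuous_comp _ _ _ (fun y => y - x) Num.norm); last exact: norm_continuous.
    apply: (@continuousB _ _ _ id (fun=> x)); [exact: cvg_id|exact: cst_continuous].
  by rewrite /prop_for /continuous_at subrr normr0 mulr0.
have ce : ccont e x.
  have H (p : R[i] -> R) : p 0 = 0 -> (forall z, `|p z| <= normc z) ->
      {for x, continuous (fun y => p (e y))}.
    move=> p0 pn; rewrite /prop_for /continuous_at ex p0.
    apply/cvgr0Pnorm_le => eps eps0; near=> y.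
    apply: le_trans (pn _) _; apply: (@le_trans _ _ (C * normc (h y) ^+ 2 * `|y - x|)).
      by near: y.
    apply: le_trans (ler_norm _) _.
    by near: y; move/cvgr0Pnorm_le : cbnd; apply.
  split; [apply: H => //; exact: normrRe|apply: H => //; exact: normrIm].
pose k y := F' (g x) * h y + e y.
have ck : ccont k x by exact: (ccontD (ccontM (ccont_cst _ _) ch) ce).
have kx : k x = F' (g x) * d.
  by rewrite /k ex addr0; congr (_ * _); apply: complexP; rewrite /h /= ?ud ?vd.
have FE y : F (g y) - F (g x) = k y * (y - x)%:C.
  by rewrite /k mulrDl -eE /E gE; ring.
split; apply/is_derive1_caratheodory.
  exists (fun y => Re (k y)); rewrite kx; split => //; last exact: ck.1.
  by move=> y; rewrite -ReB FE ReM ReC ImC mulr0 subr0.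
exists (fun y => Im (k y)); rewrite kx; split => //; last exact: ck.2.
by move=> y; rewrite -ImB FE ImM ReC ImC mulr0 add0r.
Unshelve. all: by end_near. Qed.

End holomorphic_examples.

(** * Integrals of complex-valued functions of a real variable *)

Section complex_integration.
Context {R : realType}.
Implicit Types (D : set R) (f g F : R -> R[i]) (h k : R -> R) (a b : R).

Definition cintable D f := rint D (fun x => Re (f x)) /\ rint D (fun x => Im (f x)).

Definition cmeasurable D f := measurable_fun D (fun x => Re (f x)) /\
  measurable_fun D (fun x => Im (f x)).

Lemma cintable_dominated D f h : measurable D -> cmeasurable D f ->
  rint D h -> (forall x, D x -> normc (f x) <= h x) -> cintable D f.
Proof.
move=> mD [m1 m2] ih fh; split; apply: (rint_dominated mD _ ih) => // x Dx.
  exact: le_trans (normrRe _) (fh x Dx).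
exact: le_trans (normrIm _) (fh x Dx).
Qed.

Lemma eq_cintegral D f g : (forall x, D x -> f x = g x) ->
  cintegral D f = cintegral D g.
Proof.
move=> fg; rewrite /cintegral; congr (_ +i* _); apply: eq_Rintegral => x /set_mem/fg ->//.
Qed.

Lemma eq_rint D h k : measurable D -> (forall x, D x -> h x = k x) -> rint D h -> rint D k.
Proof. by move=> mD hk; apply: eq_integrable => //= x /set_mem/hk ->. Qed.

Lemma eq_cintable D f g : measurable D -> (forall x, D x -> f x = g x) ->
  cintable D f -> cintable D g.
Proof.
move=> mD fg [i1 i2]; split; first by apply: eq_rint i1 => // x /fg ->.
by apply: eq_rint i2 => // x /fg ->.
Qed.

Lemma rint_measurable D h : rint D h -> measurable_fun D h.
Proof. by move=> ih; apply/measurable_EFinP; exact: measurable_int _ ih. Qed.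

Lemma rintD D h k : measurable D -> rint D h -> rint D k -> rint D (fun x => h x + k x).
Proof. move=> mD i1 i2; exact: (integrableD _ i1 i2). Qed.

Lemma rintN D h : measurable D -> rint D h -> rint D (fun x => - h x).
Proof. move=> mD i1; exact: (integrableN i1). Qed.

Lemma rintB D h k : measurable D -> rint D h -> rint D k -> rint D (fun x => h x - k x).
Proof. by move=> mD i1 i2; apply: rintD => //; exact: rintN. Qed.

Lemma rintZ D h c : measurable D -> rint D h -> rint D (fun x => c * h x).
Proof. move=> mD i1; exact: (integrableZl _ c i1). Qed.

Lemma RintD D h k : measurable D -> rint D h -> rint D k ->
  \int[mu]_(x in D) (h x + k x) = \int[mu]_(x in D) h x + \int[mu]_(x in D) k x.
Proof. by move=> mD f1 g1; rewrite RintegralD. Qed.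

Lemma RintB D h k : measurable D -> rint D h -> rint D k ->
  \int[mu]_(x in D) (h x - k x) = \int[mu]_(x in D) h x - \int[mu]_(x in D) k x.
Proof. by move=> mD f1 g1; rewrite RintegralB. Qed.

Lemma RintZ D c h : measurable D -> rint D h ->
  \int[mu]_(x in D) (c * h x) = c * \int[mu]_(x in D) h x.
Proof. by move=> mD h1; rewrite RintegralZl. Qed.

Lemma cintableD D f g : measurable D -> cintable D f -> cintable D g ->
  cintable D (fun x => f x + g x).
Proof.
move=> mD [f1 f2] [g1 g2]; split.
  by apply: eq_rint (rintD mD f1 g1) => // x _; rewrite ReD.
by apply: eq_rint (rintD mD f2 g2) => // x _; rewrite ImD.
Qed.

Lemma cintableZ D f c : measurable D -> cintable D f -> cintable D (fun x => c * f x).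
Proof.
move=> mD [f1 f2]; split.
  apply: (eq_rint mD _ (rintB mD (rintZ (Re c) mD f1) (rintZ (Im c) mD f2))).
  by move=> x _; rewrite ReM.
apply: (eq_rint mD _ (rintD mD (rintZ (Re c) mD f2) (rintZ (Im c) mD f1))).
by move=> x _; rewrite ImM.
Qed.

Lemma cintableN D f : measurable D -> cintable D f -> cintable D (fun x => - f x).
Proof.
move=> mD /(cintableZ (-1) mD); apply: eq_cintable => // x _; by rewrite mulN1r.
Qed.

Lemma cintableB D f g : measurable D -> cintable D f -> cintable D g ->
  cintable D (fun x => f x - g x).
Proof. by move=> mD i1 i2; apply: cintableD => //; exact: cintableN. Qed.

Lemma cintegralD D f g : measurable D -> cintable D f -> cintable D g ->
  cintegral D (fun x => f x + g x) = cintegral D f + cintegral D g.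
Proof.
move=> mD [f1 f2] [g1 g2]; apply: complexP; rewrite ?(ReD, ImD) /cintegral ?(ReI, ImI).
  by under eq_Rintegral do rewrite ReD; rewrite RintegralD.
by under eq_Rintegral do rewrite ImD; rewrite RintegralD.
Qed.

Lemma cintegralZ D f c : measurable D -> cintable D f ->
  cintegral D (fun x => c * f x) = c * cintegral D f.
Proof.
move=> mD [f1 f2]; apply: complexP; rewrite ?(ReM, ImM) /cintegral ?(ReI, ImI).
  under eq_Rintegral do rewrite ReM.
  rewrite RintegralB ?RintegralZl//; exact: rintZ.
under eq_Rintegral do rewrite ImM.
rewrite RintegralD ?RintegralZl//; exact: rintZ.
Qed.

Lemma cintegralN D f : measurable D -> cintable D f ->
  cintegral D (fun x => - f x) = - cintegral D f.
Proof.
move=> mD i; rewrite -mulN1r -cintegralZ//; apply: eq_cintegral => x _.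
by rewrite mulN1r.
Qed.

Lemma cintegralB D f g : measurable D -> cintable D f -> cintable D g ->
  cintegral D (fun x => f x - g x) = cintegral D f - cintegral D g.
Proof. by move=> mD i1 i2; rewrite cintegralD ?cintegralN//; exact: cintableN. Qed.

Lemma le_normr_Rint D h k : measurable D -> rint D h -> rint D k ->
  (forall x, D x -> `|h x| <= k x) ->
  `|\int[mu]_(x in D) h x| <= \int[mu]_(x in D) k x.
Proof.
move=> mD ih ik hk; apply: le_trans; first exact: le_normr_Rintegral.
by apply: le_Rintegral => //; exact: integrable_norm.
Qed.

(** Bounding the real and imaginary parts separately costs the factor 2. *)
Lemma le_normc_cintegral D f h : measurable D -> cintable D f -> rint D h ->
  (forall x, D x -> normc (f x) <= h x) ->
  normc (cintegral D f) <= 2 * \int[mu]_(x in D) h x.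
Proof.
move=> mD [f1 f2] ih fh; apply: le_trans (normc_leRI _) _.
rewrite mulr2n mulrDl mul1r /cintegral ReI ImI lerD//; apply: le_normr_Rint => // x Dx.
  exact: le_trans (normrRe _) (fh x Dx).
exact: le_trans (normrIm _) (fh x Dx).
Qed.

Lemma ccont_measurable D f : open D -> (forall x, D x -> ccont f x) -> cmeasurable D f.
Proof.
move=> oD cf; split; apply: open_continuous_measurable_fun => // x /set_mem /cf [].
  by [].
by [].
Qed.

Lemma ccont_lip f x (M : R) : (\forall y \near x, normc (f y - f x) <= M * `|y - x|) ->
  ccont f x.
Proof.
move=> H.
have K (p : R[i] -> R) : (forall z w, p (z - w) = p z - p w) ->
    (forall z, `|p z| <= normc z) -> {for x, continuous (fun y => p (f y))}.
  move=> pB pn; rewrite /prop_for /continuous_at.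
  apply/cvgrPdist_le => e e0; near=> y.
  rewrite -normrN opprB -pB; apply: le_trans (pn _) _.
  apply: (@le_trans _ _ (M * `|y - x|)); first by near: y.
  apply: (@le_trans _ _ ((`|M| + 1) * `|y - x|)).
    by rewrite ler_wpM2r// (le_trans (ler_norm _))// lerDl.
  have M1 : 0 < `|M| + 1 by rewrite ltr_wpDl.
  rewrite -ler_pdivlMl// distrC; near: y.
  by apply: cvgr_dist_le; [exact: cvg_id|rewrite mulr_gt0// invr_gt0].
split; [apply: K => [z w|z]; [exact: ReB|exact: normrRe]|].
by apply: K => [z w|z]; [exact: ImB|exact: normrIm].
Unshelve. all: by end_near. Qed.

Lemma rint_cst_oo a b c : rint `]a, b[ (fun=> c).
Proof.
apply: measurable_bounded_integrable => //=.
  by rewrite lebesgue_measure_itv/=; case: ifPn => // _; rewrite ltry.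
by exists `|c|; split => // y cy x _; exact: ltW.
Qed.

Lemma Rint_cst_oo a b c : a <= b -> \int[mu]_(x in `]a, b[) c = c * (b - a).
Proof.
rewrite le_eqVlt => /predU1P[<-|ab].
  by rewrite set_itvoo0 Rintegral_set0 subrr mulr0.
rewrite mulrBr; have d (x : R) : is_derive x 1 (fun t : R => c * t) c.
  by apply: is_derive_ext (is_deriveZ c (is_derive_id x 1)) => //; rewrite /GRing.scale/= mulr1.
apply: (@FTC_oo _ a b (fun=> c) (fun t => c * t)) => //.
- exact: rint_cst_oo.
- by move=> x _; exact: cst_continuous.
- by apply: cvg_at_right_filter; exact: is_derive_cont (d a).
- by apply: cvg_at_left_filter; exact: is_derive_cont (d b).
Qed.

(** The Lipschitz bound up to the ends provides the one-sided limits of F there, so that the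
    derivative is required only inside. *)
Lemma cFTC_lip a b f F (M : R) : a < b ->
  (forall x, a < x < b -> [/\ ccont f x, cderiv F x (f x) & normc (f x) <= M]) ->
  (forall x y, a <= x <= b -> a <= y <= b -> normc (F y - F x) <= M * `|y - x|) ->
  cintable `]a, b[ f /\ cintegral `]a, b[ f = F b - F a.
Proof.
move=> ab H lF.
have If : cintable `]a, b[ f.
  apply: (@cintable_dominated _ _ (fun=> M)) => //.
  - by apply: ccont_measurable => // x /=; rewrite in_itv/= => /H[].
  - exact: rint_cst_oo.
  - by move=> x /=; rewrite in_itv/= => /H[].
split => //.
have M0 : 0 <= M.
  have [|_ _ h] := H ((a + b) / 2); first by apply/andP; split; lra.
  exact: le_trans (normc_ge0 _) h.
have K (p : R[i] -> R) : (forall z w, p (z - w) = p z - p w) ->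
    (forall z, `|p z| <= normc z) ->
    (forall x, a <= x <= b -> forall e : R, 0 < e -> exists2 d : R, 0 < d &
      forall y, a <= y <= b -> `|y - x| <= d -> `|p (F x) - p (F y)| <= e).
  move=> pB pn x xab e e0; exists (e / (M + 1)).
    by rewrite divr_gt0// ltr_wpDl.
  move=> y yab; rewrite ler_pdivlMr ?ltr_wpDl// => yx.
  rewrite -normrN opprB -pB; apply: le_trans (pn _) _; apply: le_trans (lF _ _ xab yab) _.
  by apply: le_trans yx; rewrite mulrC ler_wpM2l// lerDl.
have KL (p : R[i] -> R) : (forall z w, p (z - w) = p z - p w) ->
    (forall z, `|p z| <= normc z) ->
    p (F x) @[x --> a^'+] --> p (F a) /\ p (F x) @[x --> b^'-] --> p (F b).
  move=> pB pn; split; apply/cvgrPdist_le => e e0.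
    have [|d d0 Hd] := K p pB pn a _ e e0; first by rewrite lexx ltW.
    near=> y; have ay : a < y by near: y; exact: nbhs_right_gt.
    apply: Hd.
      by rewrite ltW//=; near: y; apply: nbhs_right_le.
    rewrite gtr0_norm ?subr_gt0// lerBlDl; near: y.
    by apply: nbhs_right_le; rewrite ltrDl.
  have [|d d0 Hd] := K p pB pn b _ e e0; first by rewrite lexx ltW.
  near=> y; have yb : y < b by near: y; exact: nbhs_left_lt.
  apply: Hd.
    by rewrite (ltW yb) andbT; near: y; apply: nbhs_left_ge.
  rewrite distrC gtr0_norm ?subr_gt0// lerBlDl -lerBlDr; near: y.
  by apply: nbhs_left_ge; rewrite gtrBl.
have [RL RR] := KL _ (@ReB R) (@normrRe R).
have [IL IR] := KL _ (@ImB R) (@normrIm R).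
apply: complexP; rewrite /cintegral ?(ReB, ImB) ?(ReI, ImI).
  apply: (FTC_oo ab If.1 _ _ RL RR) => x xab; first by have [[]] := H x xab.
  by have [_ []] := H x xab.
apply: (FTC_oo ab If.2 _ _ IL IR) => x xab; first by have [[]] := H x xab.
by have [_ []] := H x xab.
Unshelve. all: by end_near. Qed.

End complex_integration.

(** * Primitives by averaging over segments *)

Section cauchy_primitive.
Context {R : realType}.

Lemma ccont_measurable_oo (a b : R) (f : R -> R[i]) :
  (forall x, a < x < b -> ccont f x) -> cmeasurable `]a, b[ f.
Proof.
move=> cf; apply: ccont_measurable; first exact: interval_open.
by move=> x /=; rewrite in_itv /=; exact: cf.
Qed.

Implicit Types (Q : set R[i]) (K F : R[i] -> R[i]) (p z w s : R[i]).

Definition cconvex Q := forall z w (t : R), Q z -> Q w -> 0 <= t <= 1 ->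
  Q (z + t%:C * (w - z)).

(** Adding the quadratic estimates at (z, w) and at (w, z) leaves (K' w - K' z) * (w - z):
    continuity of the derivative is built into [holo]. *)
Lemma holo_lip_deriv Q K K' : holo Q K K' ->
  exists2 C : R, 0 <= C & forall z w, Q z -> Q w -> normc (K' w - K' z) <= C * normc (w - z).
Proof.
move=> [C C0 HC]; exists (C + C) => [|z w Qz Qw]; first by rewrite addr_ge0.
have [->|wz] := eqVneq w z; first by rewrite !subrr !normc0 mulr0.
have n0 : 0 < normc (w - z) by rewrite normc_gt0// subr_eq0.
have [_ _ /(_ w Qw) h1] := HC z Qz; have [_ _ /(_ z Qz) h2] := HC w Qw.
rewrite -(ler_pM2r n0) -normcM.
have -> : (K' w - K' z) * (w - z) =
  (K w - K z - K' z * (w - z)) + (K z - K w - K' w * (z - w)) by ring.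
apply: le_trans (normc_triangle _ _) _; apply: le_trans (lerD h1 h2) _.
by rewrite [normc (z - w)]normc_distrC expr2 !mulrA mulrDl mulrDl.
Qed.

(* psi K p is a primitive of s |-> (K s - K p) / (s - p); its derivative is dpsi K' p (see dpsiE). *)
Definition psi K p s : R[i] :=
  cintegral `]0, 1[ (fun t => (K (p + t%:C * (s - p)) - K p) / t%:C).

Definition dpsi K' p s : R[i] := cintegral `]0, 1[ (fun t => K' (p + t%:C * (s - p))).

Lemma cderiv_segment p (e : R[i]) x : cderiv (fun t => p + t%:C * e) x e.
Proof.
apply: cderiv_eq (cderivD (cderiv_cst p x) (cderivM (cderiv_id x) (cderiv_cst e x))) _.
by ring.
Qed.

Section primitive.
Variables (Q : set R[i]) (K K' : R[i] -> R[i]) (p : R[i]).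
Hypotheses (bQ : cbounded Q) (cQ : cconvex Q) (Qp : Q p) (hK : holo Q K K').

Let seg s (t : R) : R[i] := p + t%:C * (s - p).

Let Qseg s t : Q s -> 0 <= t <= 1 -> Q (seg s t).
Proof. by move=> Qs t01; exact: cQ. Qed.

Let near_seg s (x : R) : Q s -> 0 < x < 1 -> \forall y \near x, Q (seg s y).
Proof.
move=> Qs /andP[x0 x1]; near=> y; apply: Qseg => //; apply/andP; split; near: y.
  by apply: cvgr_ge; [exact: cvg_id|].
by apply: cvgr_le; [exact: cvg_id|].
Unshelve. all: by end_near. Qed.

Let ccontK' s x : Q s -> 0 < x < 1 -> ccont (fun t => K' (seg s t)) x.
Proof.
move=> Qs x01; have [C C0 HC] := holo_lip_deriv hK.
apply: (@ccont_lip _ _ _ (C * normc (s - p))).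
have Qx : Q (seg s x) by exact: nbhs_singleton (near_seg Qs x01).
near=> y; apply: (le_trans (HC _ _ Qx _)); first by near: y; exact: near_seg.
have -> : seg s y - seg s x = (y - x)%:C * (s - p) by rewrite /seg rmorphB /=; ring.
by rewrite normcM normcC mulrA mulrAC.
Unshelve. all: by end_near. Qed.

Lemma dpsi_int s : Q s -> cintable `]0, 1[ (fun t => K' (seg s t)).
Proof.
move=> Qs; have [C C0 HC] := hK.
apply: (@cintable_dominated _ _ _ (fun=> C)) => //.
- by apply: ccont_measurable_oo => x x01; exact: ccontK'.
- exact: rint_cst_oo.
- move=> x /=; rewrite in_itv/= => /andP[/ltW x0 /ltW x1].
  by have [|_ +] := HC (seg s x); first by apply: Qseg => //; rewrite x0 x1.
Qed.

Lemma psi_int s : Q s -> cintable `]0, 1[ (fun t => (K (seg s t) - K p) / t%:C).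
Proof.
move=> Qs; have [C C0 HC] := holo_lip bQ hK.
apply: (@cintable_dominated _ _ _ (fun=> C * normc (s - p))) => //.
- apply: ccont_measurable_oo => x x01.
  have x0 : 0 < x by case/andP: x01.
  apply: ccontM; last first.
    by apply: ccontV; [exact: ccont_id|apply: normc_neq0; rewrite normcC gtr0_norm].
  apply: ccontD; last exact: ccont_cst.
  exact: (cderiv_ccont (holo_path hK (near_seg Qs x01) (cderiv_segment p (s - p) x))).
- exact: rint_cst_oo.
- move=> x /=; rewrite in_itv/= => /andP[x0 /ltW x1].
  rewrite normcM normcV normcC gtr0_norm// ler_pdivrMr//.
  apply: (le_trans (HC _ _ Qp _)); first by apply: Qseg => //; rewrite ltW.
  by rewrite /seg addrC addKr normcM normcC gtr0_norm// mulrA mulrAC.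
Qed.

(** Fundamental theorem along the segment from p to s. Off p it identifies [dpsi] with the
    difference quotient, while [dpsi] stays meaningful at s = p, where it removes the
    singularity. *)
Lemma dpsiE s : Q s -> (s - p) * dpsi K' p s = K s - K p.
Proof.
move=> Qs; rewrite /dpsi -cintegralZ//; last exact: dpsi_int.
have [C C0 HC] := hK; have [L L0 HL] := holo_lip bQ hK.
have [|x y x01 y01|_ ->] := @cFTC_lip R 0 1 (fun t => (s - p) * K' (seg s t))
  (fun t => K (seg s t)) (normc (s - p) * (C + L)) ltr01.
- move=> x x01; have Qx : Q (seg s x) by exact: nbhs_singleton (near_seg Qs x01).
  have dK := holo_path hK (near_seg Qs x01) (cderiv_segment p (s - p) x).
  split; [|by apply: cderiv_eq dK _; rewrite mulrC|].
    by apply: ccontM; [exact: ccont_cst|exact: ccontK'].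
  rewrite normcM ler_wpM2l ?normc_ge0// ler_wpDr//.
  by have [] := HC _ Qx.
- apply: (le_trans (HL _ _ (Qseg Qs x01) (Qseg Qs y01))).
  have -> : seg s y - seg s x = (y - x)%:C * (s - p) by rewrite /seg rmorphB /=; ring.
  rewrite normcM normcC mulrA mulrAC ler_wpM2r// mulrC ler_wpM2l ?normc_ge0//.
  by rewrite lerDr.
- by rewrite /seg rmorph1 rmorph0 mul1r mul0r addr0 (addrC p) subrK.
Qed.

(** The points of parameter x on the segments to z and w differ by x (w - z), so the quadratic
    estimate of K between them carries the factor x^2, which absorbs the division by x. Integrating
    over x gives the estimate for [psi]. *)
Lemma holo_psi : holo Q (psi K p) (dpsi K' p).
Proof.
have [B B0 HB] := cbounded_dist bQ.
have [C C0 HC] := hK; have [L L0 HL] := holo_lip bQ hK.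
exists (2 * (C + L * B)); first by rewrite mulr_ge0// addr_ge0// mulr_ge0.
move=> z Qz; split.
- have := @le_normc_cintegral R `]0, 1[ _ (fun=> L * B) _ (psi_int Qz) (rint_cst_oo _ _ _).
  move=> /(_ (measurable_itv _)) H; apply: le_trans (H _) _.
    move=> x /=; rewrite in_itv/= => /andP[x0 /ltW x1].
    rewrite normcM normcV normcC gtr0_norm// ler_pdivrMr//.
    apply: (le_trans (HL _ _ Qp _)); first by apply: Qseg => //; rewrite ltW.
    rewrite /seg addrC addKr normcM normcC gtr0_norm// -mulrA ler_wpM2l//.
    by rewrite mulrC; apply: ler_wpM2r; [exact: ltW|exact: HB].
  by rewrite Rint_cst_oo// subr0 mulr1 ler_wpM2l// lerDr.
- have := @le_normc_cintegral R `]0, 1[ _ (fun=> C) _ (dpsi_int Qz) (rint_cst_oo _ _ _).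
  move=> /(_ (measurable_itv _)) H; apply: le_trans (H _) _.
    move=> x /=; rewrite in_itv/= => /andP[/ltW x0 /ltW x1].
    by have [|_ +] := HC (seg z x); first by apply: Qseg => //; rewrite x0 x1.
  by rewrite Rint_cst_oo// subr0 mulr1 ler_wpM2l// lerDl mulr_ge0.
- move=> w Qw; rewrite [dpsi _ _ _ * _]mulrC /psi /dpsi.
  have i1 := cintableB (measurable_itv _) (psi_int Qw) (psi_int Qz).
  have i2 := cintableZ (w - z) (measurable_itv _) (dpsi_int Qz).
  rewrite -(cintegralB (measurable_itv _) (psi_int Qw) (psi_int Qz)).
  rewrite -(cintegralZ (w - z) (measurable_itv _) (dpsi_int Qz)).
  rewrite -(cintegralB (measurable_itv _) i1 i2).
  apply: (@le_trans _ _ (2 * \int[mu]_(x in `]0, 1[) (C * normc (w - z) ^+ 2))).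
    apply: le_normc_cintegral => //.
    + exact: cintableB.
    + exact: rint_cst_oo.
    + move=> x /=; rewrite in_itv/= => /andP[x0 /ltW x1].
      have x0' : x%:C != 0 :> R[i] by apply: normc_neq0; rewrite normcC gtr0_norm.
      have x01 : 0 <= x <= 1 by rewrite (ltW x0) x1.
      have [_ _ /(_ _ (Qseg Qw x01)) h] := HC _ (Qseg Qz x01).
      set E := (X in normc X <= _).
      have -> : E = (K (seg w x) - K (seg z x) - K' (seg z x) * (seg w x - seg z x)) / x%:C.
        by rewrite /E /seg; field.
      rewrite normcM normcV normcC gtr0_norm// ler_pdivrMr//.
      apply: le_trans h _.
      have -> : seg w x - seg z x = x%:C * (w - z) by rewrite /seg; ring.
      rewrite normcM normcC gtr0_norm// exprMn mulrCA mulrC ler_wpM2l//.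
        by rewrite mulr_ge0 ?exprn_ge0 ?normc_ge0.
      by rewrite expr2 ler_piMr// ltW.
  rewrite Rint_cst_oo// subr0 mulr1 -[leRHS]mulrA ler_wpM2l// ler_wpM2r//.
    by rewrite exprn_ge0// normc_ge0.
  by rewrite lerDl mulr_ge0.
Qed.

End primitive.

Lemma cFTC_segment Q F' F (z0 e : R[i]) (a b : R) : a < b -> cbounded Q -> holo Q F F' ->
  (forall x : R, a <= x <= b -> Q (z0 + x%:C * e)) ->
  cintable `]a, b[ (fun x => F' (z0 + x%:C * e) * e) /\
  cintegral `]a, b[ (fun x => F' (z0 + x%:C * e) * e) =
    F (z0 + b%:C * e) - F (z0 + a%:C * e).
Proof.
move=> ab bQ hF Qab; have [C C0 HC] := hF; have [L L0 HL] := holo_lip bQ hF.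
have [L' L'0 HL'] := holo_lip_deriv hF.
have diffE x y : (z0 + y%:C * e) - (z0 + x%:C * e) = (y - x)%:C * e.
  by rewrite rmorphB /=; ring.
apply: (@cFTC_lip _ _ _ _ (fun x => F (z0 + x%:C * e)) (normc e * (C + L))) => //.
- move=> x xab; have nQ : \forall y \near x, Q (z0 + y%:C * e).
    move/andP : xab => [ax xb]; near=> y; apply: Qab; apply/andP; split; near: y.
      by apply: cvgr_ge; [exact: cvg_id|].
    by apply: cvgr_le; [exact: cvg_id|].
  have Qx := nbhs_singleton nQ; split.
  + apply: ccontM; last exact: ccont_cst.
    apply: (@ccont_lip _ _ _ (L' * normc e)); near=> y.
    apply: (le_trans (HL' _ _ Qx _)); first by near: y.
    by rewrite diffE normcM normcC mulrA mulrAC.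
  + exact: (holo_path hF nQ (cderiv_segment z0 e x)).
  + rewrite normcM mulrC ler_wpM2l ?normc_ge0// ler_wpDr//.
    by have [] := HC _ Qx.
- move=> x y xab yab; apply: (le_trans (HL _ _ (Qab _ xab) (Qab _ yab))).
  rewrite diffE normcM normcC mulrA mulrAC ler_wpM2r// mulrC ler_wpM2l ?normc_ge0//.
  by rewrite lerDr.
Unshelve. all: by end_near. Qed.

End cauchy_primitive.

(** * Cauchy's theorem on a rectangle *)

Section cauchy_rectangle.
Context {R : realType}.
Implicit Types (Q : set R[i]) (f F : R[i] -> R[i]) (a b c d : R).

Lemma Re_i : Re ('i : R[i]) = 0. Proof. by []. Qed.
Lemma Im_i : Im ('i : R[i]) = 1. Proof. by []. Qed.

Definition cRI := ((@ReD R, @ImD R, @ReN R, @ImN R, @ReM R, @ImM R),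
  (Re_i, Im_i, @Renat R, @Imnat R, @ReC R, @ImC R, @Re1 R, @Im1 R, @Re0 R, @Im0 R),
  @ReI R, @ImI R).

(** Apply [psi] to z |-> f z * (z - p): its difference quotient at p is f, so f is itself a
    derivative. *)
Lemma holo_primitive Q f f' p : cbounded Q -> cconvex Q -> Q p -> holo Q f f' ->
  exists F, holo Q F f.
Proof.
move=> bQ cQ Qp hf.
have hK : holo Q (fun z => f z * (z - p)) (fun z => f' z * (z - p) + f z * 1).
  apply: holoM => //; have := holo_affine (- p) 1 bQ.
  by apply: eq_holo => // z _; rewrite mul1r addrC.
exists (psi (fun z => f z * (z - p)) p).
apply: eq_holo (holo_psi bQ cQ Qp hK) => // z Qz.
have [->|zp] := eqVneq z p.
  rewrite /dpsi; under eq_cintegral => t _.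
    rewrite subrr !mulr0 !addr0 subrr mulr0 add0r mulr1; over.
  apply: complexP; rewrite /cintegral ?(ReI, ImI) Rint_cst_oo// subr0 mulr1//.
have zp0 : z - p != 0 by rewrite subr_eq0.
by apply: (mulfI zp0); rewrite (dpsiE bQ cQ Qp hK)// subrr mulr0 subr0 mulrC.
Qed.

Definition rect a b c d : set R[i] := [set z | a <= Re z <= b /\ c <= Im z <= d].

Lemma rect_bounded a b c d : cbounded (rect a b c d).
Proof.
exists (`|a| + `|b| + (`|c| + `|d|)); first by rewrite !addr_ge0.
have H (x y t : R) : x <= t <= y -> `|t| <= `|x| + `|y|.
  move=> /andP[xt ty]; rewrite ler_norml; apply/andP; split.
    rewrite opprD (le_trans _ xt)// lerBlDr (le_trans (lerNnormlW (lexx `|x|)))//.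
    by rewrite lerDl.
  by rewrite (le_trans ty)// (le_trans (ler_norm _))// lerDr.
by move=> z [r i]; apply: le_trans (normc_leRI _) _; rewrite lerD// H.
Qed.

Lemma rect_convex a b c d : cconvex (rect a b c d).
Proof.
have H (l u x y t : R) : l <= x <= u -> l <= y <= u -> 0 <= t <= 1 ->
    l <= x + t * (y - x) <= u.
  by move=> /andP[? ?] /andP[? ?] /andP[? ?]; apply/andP; split; nra.
move=> z w t [z1 z2] [w1 w2] t01; rewrite /rect /=.
rewrite !complexRI !mul0r subr0 addr0; split; exact: H.
Qed.

(** Formulated for the derivative of F because [residue_square] applies it to a difference quotient
    that is known only through its primitive; [cauchy_rectangle] obtains F from [holo_primitive]. *)
Lemma rectangle_primitive a b c d F f : a < b -> c < d -> holo (rect a b c d) F f ->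
  [/\ cintable `]a, b[ (fun x => f (x +i* c)),
      cintable `]a, b[ (fun x => f (x +i* d)),
      cintable `]c, d[ (fun y => f (a +i* y)) &
      cintable `]c, d[ (fun y => f (b +i* y))] /\
  cintegral `]a, b[ (fun x => f (x +i* c)) + 'i * cintegral `]c, d[ (fun y => f (b +i* y)) =
  cintegral `]a, b[ (fun x => f (x +i* d)) + 'i * cintegral `]c, d[ (fun y => f (a +i* y)).
Proof.
move=> ab cd hF; have bQ := rect_bounded a b c d.
have hor (y x : R) : y%:C * 'i + x%:C * 1 = x +i* y.
  by apply: complexP; rewrite !cRI; ring.
have ver (y x : R) : x%:C + y%:C * 'i = x +i* y.
  by apply: complexP; rewrite !cRI; ring.
have i0 : 'i * (- 'i) = 1 :> R[i] by rewrite mulrN -expr2 sqr_i opprK.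
have H1 y : c <= y <= d -> cintable `]a, b[ (fun x => f (x +i* y)) /\
    cintegral `]a, b[ (fun x => f (x +i* y)) = F (b +i* y) - F (a +i* y).
  move=> ycd; have [|] := @cFTC_segment R _ _ _ (y%:C * 'i) 1 _ _ ab bQ hF.
    by move=> x xab; rewrite hor; split.
  move=> i1; rewrite !hor => <-; split; last first.
    by apply: eq_cintegral => x _; rewrite mulr1 hor.
  by apply: eq_cintable i1 => // x _; rewrite mulr1 hor.
have H2 x : a <= x <= b -> cintable `]c, d[ (fun y => f (x +i* y)) /\
    'i * cintegral `]c, d[ (fun y => f (x +i* y)) = F (x +i* d) - F (x +i* c).
  move=> xab; have [|] := @cFTC_segment R _ _ _ (x%:C) 'i _ _ cd bQ hF.
    by move=> y ycd; rewrite ver; split.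
  move=> i1; rewrite !ver => <-.
  have i2 : cintable `]c, d[ (fun y => f (x +i* y)).
    apply: eq_cintable (cintableZ (- 'i) _ i1) => // y _.
    by rewrite mulrC -mulrA i0 mulr1 ver.
  split=> //; rewrite -cintegralZ//; apply: eq_cintegral => y _.
  by rewrite ver mulrC.
have [|Ic ->] := H1 c; first by rewrite lexx ltW.
have [|Id ->] := H1 d; first by rewrite lexx ltW.
have [|Ia ->] := H2 a; first by rewrite lexx ltW.
have [|Ib ->] := H2 b; first by rewrite lexx ltW.
by split => //; ring.
Qed.

Lemma cauchy_rectangle a b c d f f' : a < b -> c < d -> holo (rect a b c d) f f' ->
  [/\ cintable `]a, b[ (fun x => f (x +i* c)),
      cintable `]a, b[ (fun x => f (x +i* d)),
      cintable `]c, d[ (fun y => f (a +i* y)) &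
      cintable `]c, d[ (fun y => f (b +i* y))] /\
  cintegral `]a, b[ (fun x => f (x +i* c)) + 'i * cintegral `]c, d[ (fun y => f (b +i* y)) =
  cintegral `]a, b[ (fun x => f (x +i* d)) + 'i * cintegral `]c, d[ (fun y => f (a +i* y)).
Proof.
move=> ab cd hf.
have [|F hF] := holo_primitive (rect_bounded a b c d) (@rect_convex a b c d)
    (_ : rect a b c d (a +i* c)) hf.
  by split; rewrite /= !lexx/= ltW.
exact: rectangle_primitive hF.
Qed.

End cauchy_rectangle.

Lemma set_itvoo (R : realType) (a b x : R) : `]a, b[%classic x -> a < x < b.
Proof. by rewrite /= in_itv. Qed.

Section real_values.
Context {R : realType}.
Implicit Types (z w : R[i]).

Lemma Im0D z w : Im z = 0 -> Im w = 0 -> Im (z + w) = 0.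
Proof. by rewrite ImD => -> ->; rewrite addr0. Qed.
Lemma Im0N z : Im z = 0 -> Im (- z) = 0.
Proof. by rewrite ImN => ->; rewrite oppr0. Qed.
Lemma Im0M z w : Im z = 0 -> Im w = 0 -> Im (z * w) = 0.
Proof. by rewrite ImM => -> ->; rewrite mulr0 mul0r addr0. Qed.
Lemma Im0V z : Im z = 0 -> Im z^-1 = 0.
Proof. by rewrite Im_invc => ->; rewrite oppr0 mul0r. Qed.
Lemma Im0cexp z : Im z = 0 -> Im (cexp z) = 0.
Proof. by rewrite /cexp ImI => ->; rewrite sin0 mulr0. Qed.

Lemma Im0cintegral (D : set R) (f : R -> R[i]) :
  (forall x, D x -> Im (f x) = 0) -> Im (cintegral D f) = 0.
Proof.
move=> f0; rewrite /cintegral ImI.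
rewrite (@eq_Rintegral _ _ _ _ _ (fun=> 0)).
  by rewrite /Rintegral integral0.
by move=> x /set_mem /f0.
Qed.

End real_values.

(** * The removable singularity of (exp z - 1) / z *)

Section exp_quotient.
Context {R : realType}.
Implicit Types (Q : set R[i]) (f : R[i] -> R[i]) (p z w s : R[i]).

(** The averaging used for [psi], with no division: the point of parameter t moves t times as fast
    as s, hence the factor t in the derivative. *)
Lemma holo_segment_int Q f f' p : cbounded Q -> cconvex Q -> Q p -> holo Q f f' ->
  (forall s, Q s -> cintable `]0, 1[ (fun t => f (p + t%:C * (s - p)))) ->
  (forall s, Q s -> cintable `]0, 1[ (fun t => t%:C * f' (p + t%:C * (s - p)))) ->
  holo Q (dpsi f p) (fun s => cintegral `]0, 1[ (fun t => t%:C * f' (p + t%:C * (s - p)))).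
Proof.
move=> bQ cQ Qp hf I1 I2; have [C C0 HC] := hf.
have Qseg s t : Q s -> 0 <= t <= 1 -> Q (p + t%:C * (s - p)) by move=> Qs ?; exact: cQ.
have bnd (g : R -> R[i]) M : cintable `]0, 1[ g ->
    (forall x : R, 0 < x < 1 -> normc (g x) <= M) -> normc (cintegral `]0, 1[ g) <= 2 * M.
  move=> ig gM; apply: le_trans (le_normc_cintegral (h := fun=> M) _ ig _ _) _ => //.
  - exact: rint_cst_oo.
  - by rewrite Rint_cst_oo// subr0 mulr1.
exists (2 * C); first by rewrite mulr_ge0.
move=> z Qz; split.
- apply: bnd; first exact: I1.
  move=> x /andP[/ltW x0 /ltW x1]; have [|//] := HC (p + x%:C * (z - p)).
  by apply: Qseg; rewrite ?x0 ?x1.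
- apply: bnd; first exact: I2.
  move=> x /andP[x0 /ltW x1]; have [|_ h _] := HC (p + x%:C * (z - p)).
    by apply: Qseg; rewrite ?(ltW x0) ?x1.
  by rewrite normcM normcC gtr0_norm// (le_trans _ h)// ler_piMl ?normc_ge0.
- move=> w Qw; rewrite [X in _ - X]mulrC -cintegralZ; [|by []|exact: I2].
  have i1 := cintableB (measurable_itv _) (I1 _ Qw) (I1 _ Qz).
  have i2 := cintableZ (w - z) (measurable_itv _) (I2 _ Qz).
  rewrite /dpsi -(cintegralB (measurable_itv _) (I1 _ Qw) (I1 _ Qz)).
  rewrite -(cintegralB (measurable_itv _) i1 i2) -mulrA.
  apply: bnd; first exact: cintableB.
  move=> x /andP[x0 /ltW x1]; have x01 : 0 <= x <= 1 by rewrite (ltW x0) x1.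
  have [_ _ /(_ _ (Qseg _ _ Qw x01)) h] := HC _ (Qseg _ _ Qz x01).
  set E := (X in normc X <= _).
  have -> : E = f (p + x%:C * (w - p)) - f (p + x%:C * (z - p)) -
      f' (p + x%:C * (z - p)) * (p + x%:C * (w - p) - (p + x%:C * (z - p))).
    by rewrite /E; ring.
  apply: le_trans h _.
  have -> : p + x%:C * (w - p) - (p + x%:C * (z - p)) = x%:C * (w - z) by ring.
  rewrite normcM normcC gtr0_norm// exprMn ler_wpM2l// ler_piMl ?exprn_ge0 ?normc_ge0//.
  by rewrite expr_le1// ltW.
Qed.

(* The entire function (exp z - 1) / z *)
Definition expquo : R[i] -> R[i] := dpsi cexp 0.

Lemma ccont_cexp_segment s x : ccont (fun t => cexp (0 + t%:C * (s - 0))) x.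
Proof.
by apply: ccont_cexp; apply: ccontD; [exact: ccont_cst|];
  apply: ccontM; [exact: ccont_id|exact: ccont_cst].
Qed.

Lemma normc_cexp_segment s x : 0 < x < 1 -> normc (cexp (0 + x%:C * (s - 0))) <= expR (normc s).
Proof.
move=> /andP[x0 /ltW x1]; rewrite normc_cexp ler_expR add0r subr0 ReM ReC ImC mul0r subr0.
apply: le_trans (ler_norm _) _; rewrite normrM gtr0_norm//.
apply: le_trans (ler_piMl _ x1) _ => //; exact: normrRe.
Qed.

Lemma expquo_int s : cintable `]0, 1[ (fun t => cexp (0 + t%:C * (s - 0))).
Proof.
apply: (@cintable_dominated _ _ _ (fun=> expR (normc s))) => //.
- by apply: ccont_measurable_oo => x _; exact: ccont_cexp_segment.
- exact: rint_cst_oo.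
- by move=> x /=; rewrite in_itv/=; exact: normc_cexp_segment.
Qed.

Lemma expquo_int' s : cintable `]0, 1[ (fun t => t%:C * cexp (0 + t%:C * (s - 0))).
Proof.
apply: (@cintable_dominated _ _ _ (fun=> expR (normc s))) => //.
- apply: ccont_measurable_oo => x _.
  by apply: ccontM; [exact: ccont_id|exact: ccont_cexp_segment].
- exact: rint_cst_oo.
- move=> x /set_itvoo x01; rewrite normcM normcC.
  apply: le_trans (normc_cexp_segment _ x01); rewrite ler_piMl ?normc_ge0//.
  by case/andP: x01 => /ltW x0 /ltW x1; rewrite ger0_norm.
Qed.

Lemma holo_expquo Q : cbounded Q -> cconvex Q -> Q 0 -> exists f', holo Q expquo f'.
Proof.
move=> bQ cQ Q0; eexists; apply: holo_segment_int bQ cQ Q0 (holo_cexp bQ) _ _.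
  by move=> s _; exact: expquo_int.
by move=> s _; exact: expquo_int'.
Qed.

Lemma expquoE z : z * expquo z = cexp z - 1.
Proof.
pose Q : set R[i] := fun w => normc w <= normc z.
have bQ : cbounded Q by exists (normc z) => //; exact: normc_ge0.
have cQ : cconvex Q.
  move=> u v t Qu Qv /andP[t0 t1]; rewrite /Q.
  have -> : u + t%:C * (v - u) = (1 - t)%:C * u + t%:C * v by rewrite rmorphB rmorph1; ring.
  apply: le_trans (normc_triangle _ _) _.
  have -> : normc z = (1 - t) * normc z + t * normc z by ring.
  by rewrite !normcM !normcC !ger0_norm ?subr_ge0// lerD// ler_wpM2l// subr_ge0.
have Q0 : Q 0 by rewrite /Q normc0 normc_ge0.
have := dpsiE bQ cQ Q0 (holo_cexp bQ) (_ : Q z); rewrite subr0 cexp0; apply.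
exact: lexx.
Qed.

Lemma expquo0 : expquo 0 = 1.
Proof.
rewrite /expquo /dpsi; under eq_cintegral do rewrite subr0 mulr0 addr0 cexp0.
by apply: complexP; rewrite /cintegral ?(ReI, ImI) Rint_cst_oo// subr0 mulr1.
Qed.

(** [expquo z] is the mean of exp over the segment from 0 to z. Where Re >= -1 and |Im| <= 1, the
    real part of exp is at least e^(-1) (1 - 1 / 2), and so is its mean. This permits dividing by
    [expquo] around the pole. *)
Lemma expquo_lower z : -1 <= Re z -> -1 <= Im z <= 1 -> expR (-1) / 2 <= normc (expquo z).
Proof.
move=> Rz /andP[Iz1 Iz2]; apply: le_trans (normrRe _); apply: le_trans (ler_norm _).
rewrite /expquo /dpsi /cintegral ReI.
rewrite -[leLHS]mulr1 -[X in _ * X](subr0 1) -Rint_cst_oo//.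
apply: le_Rintegral => //; [exact: rint_cst_oo|exact: (expquo_int z).1|].
move=> x /set_itvoo/andP[x0 /ltW x1].
rewrite /cexp ReI add0r subr0 ReM ImM ReC ImC !mul0r subr0 addr0.
apply: ler_pM => //; rewrite ?expR_ge0 ?ler_expR//; first nra.
apply: le_trans (cos_ge1B _); have : (x * Im z) ^+ 2 <= 1.
  rewrite -real_normK ?num_real// expr_le1// normrM -[leRHS]mulr1 ler_pM//.
    by rewrite gtr0_norm.
  by rewrite ler_norml Iz1.
lra.
Qed.

End exp_quotient.

(** * Half-contours in the logarithmic variable *)

Section contour.
Context {R : realType}.
Implicit Types (f : R[i] -> R[i]) (a b s u z w t kappa : R).

Lemma rint_expR_ray a (c : R) : 0 < c -> rint `]a, +oo[ (fun s => expR (- (c * s))) /\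
  \int[mu]_(s in `]a, +oo[) expR (- (c * s)) = expR (- (c * a)) / c.
Proof.
move=> c0.
have ce : continuous (fun s => expR (- (c * s))).
  move=> s; apply: continuous_comp; last exact: continuous_expR.
  by apply: continuousN; apply: continuousM; [exact: cst_continuous|exact: cvg_id].
have dF s : is_derive s 1 (fun s => - (c^-1 * expR (- (c * s)))) (expR (- (c * s))).
  have d1 : is_derive s 1 (fun s : R => - (c * s)) (- c).
    apply: is_derive_ext (is_deriveN (is_deriveZ c (is_derive_id s 1))) => //.
    by rewrite /GRing.scale /= mulr1.
  have d2 := @is_derive1_comp _ expR (fun s : R => - (c * s)) s _ _ (is_derive_expR _) d1.
  apply: is_derive_ext (is_deriveN (is_deriveZ c^-1 d2)) => //.
  by rewrite /GRing.scale /=; field; rewrite gt_eqF.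
have lim : - (c^-1 * expR (- (c * s))) @[s --> +oo] --> (0 : R).
  rewrite -[X in _ --> X]oppr0; apply: cvgN.
  rewrite -[X in _ --> X](mulr0 c^-1); apply: cvgM; first exact: cvg_cst.
  have := @cvg_comp _ _ _ (fun s => c * s) (fun y : R => expR (- y)) _ _ _ _ (@cvgr_expR R).
  apply; apply/cvgryPge => M; near=> s.
  by rewrite -ler_pdivrMl//; near: s; exact: nbhs_pinfty_ge.
have E : (\int[mu]_(x in `[a, +oo[) (expR (- (c * x)))%:E)%E =
    (0%:E - (- (c^-1 * expR (- (c * a))))%:E)%E.
  apply: (ge0_continuous_FTC2y _ _ lim) => //.
  - exact: continuous_subspaceT.
  - by apply: cvg_at_right_filter; exact: is_derive_cont (dF a).
  - by move=> x _; rewrite derive1E; have [_] := dF x.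
have I : rint `[a, +oo[ (fun s => expR (- (c * s))).
  apply/integrableP; split.
    apply/measurable_EFinP; apply: measurable_funS (continuous_measurable_fun ce) => //.
  under eq_integral do rewrite /= ger0_norm ?expR_ge0//.
  by rewrite E -EFinB ltry.
have I2 : rint `]a, +oo[ (fun s => expR (- (c * s))).
  by apply: (integrableS _ _ _ I) => //; apply: subset_itvr; rewrite bnd_simp.
split => //.
by rewrite Rintegral_itv_obnd_cbnd// /Rintegral E /= sub0r opprK mulrC.
Unshelve. all: by end_near. Qed.

(** For s >= 0, e^s >= 1 + s^2 / 2 and completing the square give the first term in the exponent of
    the constant; for a <= s < 0 the second one bounds the linear term. *)
Lemma expR_expR_dominated (kappa m a : R) : 0 < kappa -> exists2 C : R, 0 <= C &
  forall s, a <= s -> expR (- (kappa * expR s) + m * s) <= C * expR (- (1 * s)).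
Proof.
move=> k0; exists (expR ((m + 1) ^+ 2 / (2 * kappa) + `|m + 1| * `|a|)).
  exact: expR_ge0.
move=> s as_; rewrite -expRD ler_expR.
have h0 : 0 <= (m + 1) ^+ 2 / (2 * kappa) by rewrite divr_ge0 ?sqr_ge0// mulr_ge0// ltW.
have h1 : 0 <= `|m + 1| * `|a| by rewrite mulr_ge0.
have [s0|s0] := leP 0 s.
  have h2 : 1 + s ^+ 2 / 2 <= expR s := @expR_ge1Dxn R s 1 s0.
  have h3 : 0 <= kappa / 2 * (s - (m + 1) / kappa) ^+ 2.
    by rewrite mulr_ge0 ?sqr_ge0// divr_ge0// ltW.
  have h4 : kappa / 2 * (s - (m + 1) / kappa) ^+ 2 =
      kappa * (s ^+ 2 / 2) - (m + 1) * s + (m + 1) ^+ 2 / (2 * kappa).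
    by field; rewrite gt_eqF.
  have h5 : kappa * (1 + s ^+ 2 / 2) <= kappa * expR s by rewrite ler_wpM2l// ltW.
  rewrite h4 in h3; move: h0 h1 h3 h5.
  set X := _ / (2 * kappa); set Y := `|_| * _; set E := expR s.
  rewrite mulrDr mulr1; set Z := s ^+ 2 / 2; lra.
have h2 : (m + 1) * s <= `|m + 1| * `|a|.
  apply: le_trans (ler_norm _) _; rewrite normrM ler_wpM2l//.
  rewrite !ltr0_norm ?(le_lt_trans as_)// lerN2//.
have h3 : 0 <= kappa * expR s by rewrite mulr_ge0 ?expR_ge0// ltW.
move: h0 h2 h3; set X := _ / (2 * kappa); set Y := `|_| * _; set E := kappa * _; lra.
Qed.

Lemma ccont_hline u s : ccont (fun s => s +i* u) s.
Proof. by split => /=; [exact: cvg_id|exact: cst_continuous]. Qed.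

Lemma ccont_vline a u : ccont (fun u => a +i* u) u.
Proof. by split => /=; [exact: cst_continuous|exact: cvg_id]. Qed.

(* In the variable zeta = ln u, the upper half of a Hankel contour: the arc
   |u| = e^a, 0 <= arg u <= theta, then the ray arg u = theta.  The lower half is its
   conjugate, so that hankel theta a f / pi is (1 / 2 i pi) times the full integral. *)
Definition hankel (theta a : R) f : R :=
  \int[mu]_(u in `]0, theta[) Re (f (a +i* u)) +
  \int[mu]_(s in `]a, +oo[) Im (f (s +i* theta)).

(** The lower side of the rectangle lies on the real axis, where f is real and contributes nothing
    to the imaginary part of Cauchy's theorem; the upper side is the piece of ray by which the two
    contours differ. *)
Lemma hankel_shift theta a b f f' : 0 < theta -> a < b ->
  holo (rect a b 0 theta) f f' -> (forall x, a < x < b -> Im (f (x +i* 0)) = 0) ->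
  rint `]a, +oo[ (fun s => Im (f (s +i* theta))) ->
  hankel theta a f = hankel theta b f.
Proof.
move=> th0 ab hf f0 fi.
have [[i1 i2 i3 i4] E] := cauchy_rectangle ab th0 hf.
have := congr1 (@Im R) E; rewrite !ImD !ImM !Re_i !Im_i !mul0r !mul1r !add0r.
rewrite (_ : Im (cintegral _ (fun x => f (x +i* 0))) = 0); last first.
  by apply: Im0cintegral => x /set_itvoo; exact: f0.
rewrite add0r /cintegral ?(ReI, ImI) => E1.
rewrite /hankel E1 [X in _ = X + _]addrC -addrA; congr (_ + _).
have U : `]a, b]%classic `|` `]b, +oo[ = `]a, +oo[%classic.
  by rewrite -itv_bndbnd_setU// bnd_simp ltW.
rewrite -U Rintegral_setU//; last 2 first.
- by rewrite U.
- apply/disj_setPS => y [/=]; rewrite !in_itv/= => /andP[_ yx] /andP[].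
  by rewrite ltNge yx.
congr (_ + _); apply/esym.
exact: (Rintegral_itv_bndo_bndc i2.2).
Qed.

End contour.

Section fubini_real.
Context {R : realType}.
Implicit Types (D : set R).

(** Tonelli turns the bound g on the inner integrals of |f| into integrability on the product;
    indicators extend f to the whole plane. *)
Lemma Fubini_dominated D1 D2 (f : R -> R -> R) (g : R -> R) :
  measurable D1 -> measurable D2 ->
  measurable_fun setT (fun p : R * R => f p.1 p.2) ->
  (forall x, D1 x -> rint D2 (f x)) ->
  (forall y, D2 y -> rint D1 (f ^~ y)) ->
  (forall y, D2 y -> \int[mu]_(x in D1) `|f x y| <= g y) -> rint D2 g ->
  rint D1 (fun x => \int[mu]_(y in D2) f x y) /\
  \int[mu]_(x in D1) \int[mu]_(y in D2) f x y =
  \int[mu]_(y in D2) \int[mu]_(x in D1) f x y.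
Proof.
move=> mD1 mD2 mf f1 f2 fg ig.
pose h (p : R * R) : R := \1_D1 p.1 * \1_D2 p.2 * f p.1 p.2.
have mh : measurable_fun setT (EFin \o h).
  apply/measurable_EFinP; apply: measurable_funM => //.
  apply: measurable_funM.
    by apply: measurableT_comp => //; exact: measurable_indic.
  by apply: measurableT_comp => //; exact: measurable_indic.
have hE x y : h (x, y) = (\1_D1 x) * (\1_D2 y) * f x y by [].
have inner1 y : D2 y -> (\int[mu]_x (h (x, y))%:E = \int[mu]_(x in D1) (f x y)%:E)%E.
  move=> Dy; rewrite [RHS]integral_mkcond; apply: eq_integral => x _.
  rewrite patchE hE !indicE (mem_set Dy) mulr1; case: ifPn => _; rewrite ?mul1r// mul0r//.
have inner1' y : D2 y -> (\int[mu]_x `|(h (x, y))%:E| = \int[mu]_(x in D1) `|(f x y)%:E|)%E.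
  move=> Dy; rewrite [RHS]integral_mkcond; apply: eq_integral => x _.
  rewrite patchE hE !indicE (mem_set Dy) mulr1; case: ifPn => _; rewrite ?mul1r// mul0r abse0//.
have inner2 x : D1 x -> (\int[mu]_y (h (x, y))%:E = \int[mu]_(y in D2) (f x y)%:E)%E.
  move=> Dx; rewrite [RHS]integral_mkcond; apply: eq_integral => y _.
  rewrite patchE hE !indicE (mem_set Dx) mul1r; case: ifPn => _; rewrite ?mul1r// mul0r//.
have ih : (mu \x mu)%E.-integrable setT (EFin \o h).
  apply/(integrable21ltyP _ _ _) => //=.
  apply: (@le_lt_trans _ _ (\int[mu]_(y in D2) (g y)%:E)%E); last first.
    by apply: integrable_lty.
  rewrite [leRHS]integral_mkcond; apply: ge0_le_integral => //.
  - by move=> y _; exact: integral_ge0.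
  - have := @measurable_fun_fubini_tonelli_G _ _ _ _ _ mu (fun p => `|(EFin \o h) p|%E).
    apply => //; exact: measurableT_comp.
  - have mg := measurable_int _ ig.
    exact: (iffLR (measurable_restrictT (EFin \o g) mD2) mg).
  - move=> y _; rewrite patchE; case: ifPn => [/set_mem Dy|/negP nDy]; last first.
      rewrite integral0_eq// => x _; rewrite hE !indicE.
      by rewrite (memNset (fun h => nDy (mem_set h))) mulr0 mul0r normr0.
    apply: (@le_trans _ _ (\int[mu]_(x in D1) `|(f x y)%:E|)%E).
      by rewrite -inner1'.
    rewrite -[leLHS]fineK; first by rewrite lee_fin; exact: fg.
    by apply: integrable_fin_num => //; exact: integrable_abse (f2 y Dy).
split.
  have I := integrable_fubini_F ih.
  have {}I : mu.-integrable D1 (fubini_F mu (EFin \o h)).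
    by apply: (integrableS _ _ _ I).
  apply: eq_integrable I => // x /set_mem Dx; rewrite /fubini_F /= inner2//.
  by rewrite /Rintegral fineK//; apply: integrable_fin_num => //; exact: f1.
have := Fubini ih.
rewrite /= => E.
rewrite /Rintegral; congr fine; move: E.
have -> : (\int[mu]_x \int[mu]_y (h (x, y))%:E =
   \int[mu]_(x in D1) (\int[mu]_(y in D2) f x y)%:E)%E.
  rewrite [RHS]integral_mkcond; apply: eq_integral => x _.
  rewrite patchE; case: ifPn => [/set_mem Dx|/negP nDx]; last first.
    by rewrite integral0_eq// => y _; rewrite hE !indicE (memNset (fun h => nDx (mem_set h))) !mul0r.
  rewrite inner2// /Rintegral fineK//; apply: integrable_fin_num => //; exact: f1.
move=> ->.
rewrite [RHS]integral_mkcond; apply: eq_integral => y _.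
rewrite patchE; case: ifPn => [/set_mem Dy|/negP nDy]; last first.
  by rewrite integral0_eq// => x _; rewrite hE !indicE (memNset (fun h => nDy (mem_set h))) mulr0 !mul0r.
by rewrite inner1// /Rintegral fineK//; apply: integrable_fin_num => //; exact: f2.
Qed.

End fubini_real.

(** * Affine substitutions *)

Section affine_change.
Context {R : realType}.
Implicit Types (D A : set R).

Lemma measurable_affine (c e : R) : measurable_fun setT (fun x : R => c * x + e).
Proof.
apply: continuous_measurable_fun => x.
apply: (@continuousD _ _ _ (fun x => c * x) (fun=> e)); last exact: cst_continuous.
by apply: (@continuousM _ _ (fun=> c) id); [exact: cst_continuous|exact: cvg_id].
Qed.

(* The image measure is a canonical measure only up to a proof of measurability. *)
Lemma affine_pushforward (c e : R) :
  exists m : {measure set (measurableTypeR R) -> \bar R},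
    m = pushforward mu (fun x : measurableTypeR R => (c * x + e)%R : measurableTypeR R)
      :> (set (measurableTypeR R) -> \bar R).
Proof.
pose F := (fun x : R => c * x + e) : measurableTypeR R -> measurableTypeR R.
have mF : measurable_fun setT F by exact: measurable_affine.
by exists (measure_function_pushforward__canonical__measure_function_Measure mu mF).
Qed.

(** c times the image measure agrees with Lebesgue measure on half-open intervals, hence everywhere
    by uniqueness. *)
Lemma lebesgue_affine (c e : R) A : 0 < c -> measurable A ->
  (c%:E * mu ((fun x : R => (c * x + e)%R) @^-1` A))%E = mu A.
Proof.
move=> c0 mA; have [m mE] := affine_pushforward c e.
pose M : {measure set (measurableTypeR R) -> \bar R} := mscale (NngNum (ltW c0)) m.
have H X : M X = (c%:E * mu ((fun x : R => (c * x + e)%R) @^-1` X))%E.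
  by rewrite -[LHS]/(c%:E * m X)%E mE.
rewrite -H -(@lebesgue_measure_unique R M) // => X [[a b] /= _ <-]; rewrite H.
have -> : (fun x : R => c * x + e) @^-1` `]a, b]%classic = `](a - e) / c, (b - e) / c]%classic.
  apply/seteqP; split => x /=; rewrite !in_itv /= ltr_pdivrMr// ler_pdivlMr//.
    by rewrite mulrC ltrBlDr lerBrDr.
  by rewrite mulrC ltrBlDr lerBrDr.
rewrite !lebesgue_measure_itv /= !lte_fin ltr_pM2r ?invr_gt0// ltrD2r.
case: ifPn => ab; last by rewrite mule0.
by rewrite -!EFinB -EFinM; congr EFin; field; rewrite gt_eqF.
Qed.

Lemma ge0_integral_affine (c e : R) D (f : R -> \bar R) : 0 < c -> measurable D ->
  measurable_fun D f -> (forall x, D x -> 0 <= f x)%E ->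
  (\int[mu]_(x in D) f x =
   c%:E * \int[mu]_(x in (fun x => (c * x + e)%R) @^-1` D) f (c * x + e)%R)%E.
Proof.
move=> c0 mD mf f0; have [m mE] := affine_pushforward c e.
have -> : (\int[mu]_(x in D) f x = \int[mscale (NngNum (ltW c0)) m]_(x in D) f x)%E.
  apply: eq_measure_integral => A mA _.
  by rewrite -[RHS]/(c%:E * m A)%E mE; apply/esym; exact: lebesgue_affine.
rewrite ge0_integral_mscale//= mE.
by rewrite ge0_integral_pushforward//; [exact: measurable_affine|move=> y /set_mem; exact: f0].
Qed.

Lemma Rint_translate (e a : R) (f : R -> R) : measurable_fun setT f ->
  rint `]a, +oo[ (fun x => f (x + e)) ->
  \int[mu]_(x in `]a + e, +oo[) f x = \int[mu]_(x in `]a, +oo[) f (x + e).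
Proof.
move=> mf fi; have [m mE] := affine_pushforward 1 e.
have FD : (fun x : R => 1 * x + e) @^-1` `]a + e, +oo[%classic = `]a, +oo[%classic.
  by apply/seteqP; split => x /=; rewrite !in_itv /= !andbT mul1r ltrD2r.
rewrite /Rintegral; congr fine.
have -> : (\int[mu]_(x in `](a + e)%R, +oo[) (f x)%:E =
    \int[m]_(x in `](a + e)%R, +oo[) (f x)%:E)%E.
  apply: eq_measure_integral => A mA _.
  by rewrite mE; have := @lebesgue_affine 1 e A ltr01 mA; rewrite mul1e => /esym.
rewrite mE integral_pushforward//.
- by rewrite FD; apply: eq_integral => x _ /=; rewrite mul1r.
- exact: measurable_affine.
- by apply/measurable_EFinP.
- by rewrite FD; apply: eq_integrable fi => // x _ /=; rewrite mul1r.
Qed.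

End affine_change.

Section complex_measurable.
Context d (T : measurableType d) {R : realType}.
Implicit Types (f g : T -> R[i]).

Definition cmeas f := measurable_fun setT (fun x => Re (f x)) /\
  measurable_fun setT (fun x => Im (f x)).

Lemma measurable_ext (h k : T -> R) : (forall x, k x = h x) ->
  measurable_fun setT h -> measurable_fun setT k.
Proof. by move=> /funext ->. Qed.

Lemma cmeas_real (h : T -> R) : measurable_fun setT h -> cmeas (fun x => (h x)%:C).
Proof. by move=> mh; split => //=; exact: measurable_cst. Qed.

Lemma cmeas_cst c : cmeas (fun=> c).
Proof. by split; exact: measurable_cst. Qed.

Lemma cmeasD f g : cmeas f -> cmeas g -> cmeas (fun x => f x + g x).
Proof.
move=> [f1 f2] [g1 g2]; split.
  by apply: measurable_ext (fun x => ReD _ _) _; exact: measurable_funD.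
by apply: measurable_ext (fun x => ImD _ _) _; exact: measurable_funD.
Qed.

Lemma cmeasM f g : cmeas f -> cmeas g -> cmeas (fun x => f x * g x).
Proof.
move=> [f1 f2] [g1 g2]; split.
  by apply: measurable_ext (fun x => ReM _ _) _; apply: measurable_funB; exact: measurable_funM.
by apply: measurable_ext (fun x => ImM _ _) _; apply: measurable_funD; exact: measurable_funM.
Qed.

Lemma cmeasN f : cmeas f -> cmeas (fun x => - f x).
Proof.
move=> mf; have := cmeasM (cmeas_cst (-1)) mf.
by rewrite (_ : (fun x => -1 * f x) = (fun x => - f x))//; apply/funext => x; rewrite mulN1r.
Qed.

Lemma cmeas_cexp f : cmeas f -> cmeas (fun x => cexp (f x)).
Proof.
move=> [f1 f2].
have me : measurable_fun setT (fun x => expR (Re (f x))).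
  by apply: measurableT_comp f1; exact: measurable_expR.
split; rewrite /cexp /=; apply: measurable_funM => //.
  apply: measurableT_comp f2; apply: continuous_measurable_fun; exact: continuous_cos.
apply: measurableT_comp f2; apply: continuous_measurable_fun; exact: continuous_sin.
Qed.

End complex_measurable.

(** * Remainder of the exponential series *)

Section exponential_series.
Context {R : realType}.
Implicit Types (g : R -> R[i]) (w d : R[i]) (x t : R) (N n : nat).

(** k + h and k - h vanish at 0 and have nonnegative derivatives. *)
Lemma derive_comparison (h k dh dk : R -> R) x : 0 <= x <= 1 ->
  (forall t : R, is_derive t 1 h (dh t)) -> (forall t : R, is_derive t 1 k (dk t)) ->
  (forall t : R, 0 <= t <= 1 -> `|dh t| <= dk t) -> h 0 = 0 -> k 0 = 0 -> `|h x| <= k x.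
Proof.
move=> /andP[x0 x1] hd kd hk h0 k0.
have pos (g dg : R -> R) : (forall t : R, is_derive t 1 g (dg t)) ->
    (forall t : R, 0 <= t <= 1 -> 0 <= dg t) -> g 0 = 0 -> 0 <= g x.
  move=> gd g0 g00; move: x0; rewrite le_eqVlt => /predU1P[<-|x0]; first by rewrite g00.
  have [c /set_itvoo /andP[c0 cx]] := MVT x0 (fun t _ => gd t)
    (continuous_at_within (fun t _ => is_derive_cont (gd t))).
  rewrite g00 !subr0 => ->; rewrite mulr_ge0 ?(ltW x0)// g0// (ltW c0)/=.
  exact: le_trans (ltW cx) x1.
rewrite ler_norml lerNl -subr_ge0 -[X in _ && X]subr_ge0; apply/andP; split.
  rewrite opprK; apply: (pos (fun t => k t + h t) (fun t => dk t + dh t)).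
  - by move=> t /hk; rewrite ler_norml => /andP[]; lra.
  - by rewrite h0 k0 addr0.
apply: (pos (fun t => k t - h t) (fun t => dk t - dh t)).
- by move=> t /hk; rewrite ler_norml => /andP[]; lra.
- by rewrite h0 k0 subr0.
Qed.

Definition cexp_sum N (w : R[i]) := \sum_(l < N) w ^+ l / (l`!%:R).

Lemma cexp_sumS N (w : R[i]) : cexp_sum N.+1 w = cexp_sum N w + w ^+ N / N`!%:R.
Proof. by rewrite /cexp_sum big_ord_recr. Qed.

Lemma cderivX g x d n : cderiv g x d -> cderiv (fun t => g t ^+ n.+1) x (n.+1%:R * d * g x ^+ n).
Proof.
move=> dg; elim: n => [|n IH]; first by apply: cderiv_eq dg _; rewrite mul1r mulr1.
have -> : (fun t => g t ^+ n.+2) = (fun t => g t * g t ^+ n.+1).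
  by apply/funext => t; rewrite exprS.
apply: cderiv_eq (cderivM dg IH) _.
by rewrite [in RHS]mulrSr exprS; ring.
Qed.

Lemma normc_natV n : normc (n%:R^-1 : R[i]) = n%:R^-1.
Proof. by rewrite normcV natC normcC ger0_norm. Qed.

Lemma cderiv_cexp_sum N (w : R[i]) x :
  cderiv (fun t => cexp_sum N.+1 (t%:C * w)) x (w * cexp_sum N (x%:C * w)).
Proof.
have dt : cderiv (fun t => t%:C * w) x w.
  by apply: cderiv_eq (cderivM (cderiv_id x) (cderiv_cst w x)) _; rewrite mul1r mulr0 addr0.
elim: N => [|N IH].
  have -> : (fun t => cexp_sum 1 (t%:C * w)) = (fun=> 1).
    by apply/funext => t; rewrite /cexp_sum big_ord1 expr0 divr1.
  by apply: cderiv_eq (cderiv_cst 1 x) _; rewrite /cexp_sum big_ord0 mulr0.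
have -> : (fun t => cexp_sum N.+2 (t%:C * w)) =
    (fun t => cexp_sum N.+1 (t%:C * w) + (t%:C * w) ^+ N.+1 * N.+1`!%:R^-1).
  by apply/funext => t; rewrite cexp_sumS.
apply: cderiv_eq (cderivD IH (cderivM (cderivX N dt) (cderiv_cst _ x))) _.
rewrite cexp_sumS mulr0 addr0 factS natrM.
have n1 : N.+1%:R != 0 :> R[i] by rewrite pnatr_eq0.
have n2 : N`!%:R != 0 :> R[i] by rewrite pnatr_eq0 -lt0n fact_gt0.
have -> (p q e y : R[i]) : p != 0 -> q != 0 -> w * e + p * w * y / (p * q) = w * (e + y / q) => //.
by move=> p0 q0; field; rewrite p0 q0.
Qed.

Lemma is_derive_pow (c t : R) n : is_derive t 1 (fun t => c * t ^+ n.+1) (c * (n.+1%:R * t ^+ n)).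
Proof.
have := (cderivM (cderiv_cst c%:C t) (cderivX n (cderiv_id t))).1.
have E y m : y%:C ^+ m = (y ^+ m)%:C :> R[i] by rewrite rmorphXn.
apply: is_derive_ext => [y|]; first by rewrite E ReM ImC mul0r subr0.
by rewrite mul0r add0r mulr1 natC !E !(ReM, ReC, ImC, ImM) !(mul0r, mulr0, addr0, subr0).
Qed.

(** Induction on N by comparing derivatives in x. Real and imaginary parts are compared separately,
    which doubles the bound at each step: hence (2 |w|)^N, still beaten by N!. *)
Lemma cexp_sum_rem N (w : R[i]) x : 0 <= x <= 1 ->
  normc (cexp (x%:C * w) - cexp_sum N (x%:C * w)) <=
    expR (normc w) * (2 * normc w) ^+ N * (x ^+ N / N`!%:R).
Proof.
have dt y : cderiv (fun t => t%:C * w) y w.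
  by apply: cderiv_eq (cderivM (cderiv_id y) (cderiv_cst w y)) _; rewrite mul1r mulr0 addr0.
have n0 := normc_ge0 w.
elim: N x => [|N IH] x x01.
  rewrite /cexp_sum big_ord0 subr0 !expr0 divr1 !mulr1 normc_cexp ler_expR.
  rewrite ReM ImC mul0r subr0 ReC; apply: le_trans (ler_norm _) _; rewrite normrM.
  case/andP: x01 => x0 x1; rewrite -[leRHS]mul1r ler_pM// ?normrRe// ger0_norm//.
pose f t := cexp (t%:C * w) - cexp_sum N.+1 (t%:C * w).
pose df t := w * (cexp (t%:C * w) - cexp_sum N (t%:C * w)).
pose A := normc w * (expR (normc w) * (2 * normc w) ^+ N).
pose k t := A * (t ^+ N.+1 / N.+1`!%:R).
pose dk t := A * (t ^+ N / N`!%:R).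
have dfE t : cderiv f t (df t).
  apply: cderiv_eq (cderivB (cderiv_cexp (dt t)) (cderiv_cexp_sum N w t)) _.
  by rewrite /df mulrBr.
have dkE (t : R) : is_derive t 1 k (dk t).
  rewrite (_ : dk t = A / N.+1`!%:R * (N.+1%:R * t ^+ N)).
    apply: is_derive_ext (is_derive_pow (A / N.+1`!%:R) t N) => // y.
    by rewrite /k mulrAC mulrA.
  have E (p q y : R) : p != 0 -> q != 0 -> A * (y / q) = A / (p * q) * (p * y).
    by move=> p0 q0; field; rewrite p0 q0.
  by rewrite /dk factS natrM; apply: E; rewrite pnatr_eq0// -lt0n fact_gt0.
have f0 : f 0 = 0.
  rewrite /f rmorph0 mul0r cexp0 /cexp_sum big_ord_recl big1 ?addr0 ?expr0 ?divr1 ?subrr//.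
  by move=> i _; rewrite expr0n mul0r.
have k0 : k 0 = 0 by rewrite /k expr0n mul0r mulr0.
have dfk t : 0 <= t <= 1 -> normc (df t) <= dk t.
  move=> t01; rewrite /df normcM /dk /A -mulrA ler_wpM2l//; exact: IH.
have r1 : `|Re (f x)| <= k x.
  apply: (derive_comparison (h := fun t => Re (f t)) (dh := fun t => Re (df t)) x01 _ dkE) => //.
  - by move=> t; exact: (dfE t).1.
  - by move=> t t01; apply: le_trans (normrRe _) (dfk _ t01).
  - by rewrite f0.
have r2 : `|Im (f x)| <= k x.
  apply: (derive_comparison (h := fun t => Im (f t)) (dh := fun t => Im (df t)) x01 _ dkE) => //.
  - by move=> t; exact: (dfE t).2.
  - by move=> t t01; apply: le_trans (normrIm _) (dfk _ t01).
  - by rewrite f0.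
apply: le_trans (normc_leRI _) _; apply: le_trans (lerD r1 r2) _.
by rewrite /k /A [(2 * normc w) ^+ N.+1]exprS le_eqVlt; apply/orP; left; apply/eqP; ring.
Qed.

Lemma cexp_sum_cvg (w : R[i]) : normc (cexp w - cexp_sum N w) @[N --> \oo] --> (0 : R).
Proof.
have lim : expR (normc w) * exp_coeff (2 * normc w) N @[N --> \oo] --> (0 : R).
  rewrite -(mulr0 (expR (normc w))); apply: cvgM; first exact: cvg_cst.
  by apply: cvg_series_cvg_0; exact: is_cvg_series_exp_coeff.
apply: (squeeze_cvgr _ (cvg_cst 0) lim); near=> N.
have := @cexp_sum_rem N w 1; rewrite ler01 lexx => /(_ isT).
by rewrite rmorph1 !mul1r normc_ge0 expr1n /exp_coeff /= mul1r mulrA.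
Unshelve. all: by end_near. Qed.

Lemma normc_cexp_sum N (w : R[i]) : normc (cexp_sum N w) <= expR (normc w).
Proof.
apply: (@le_trans _ _ (series (exp_coeff (normc w)) N)).
  rewrite /cexp_sum /series /= big_mkord; elim/big_rec2 : _ => [|l x y _ h].
    by rewrite normc0.
  apply: le_trans (normc_triangle _ _) _; rewrite lerD//.
  by rewrite normcM normcX normc_natV /exp_coeff.
apply: nondecreasing_cvgn_le; last exact: is_cvg_series_exp_coeff.
apply/nondecreasing_seqP => n; rewrite /series /= big_nat_recr//= lerDl.
by rewrite /exp_coeff /= divr_ge0// exprn_ge0// normc_ge0.
Qed.

End exponential_series.

(** * Hankel contours *)

Section contour_functions.
Context {R : realType}.
Variables (alpha theta : R).
Hypotheses (alpha_gt0 : 0 < alpha) (theta_gt : pi / 2 < theta) (theta_lt : theta < pi)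
  (alpha_theta : alpha * theta < pi / 2).
Implicit Types (f : R[i] -> R[i]) (a b s u z w t : R) (zeta : R[i]).

(** On the ray arg u = theta one has |e^u| = e^(- kappa |u|), and kappa > 0 for theta between pi / 2
    and pi. The constraint alpha * theta < pi / 2 keeps Re (u^alpha) >= 0 for 0 <= arg u <= theta,
    so that |e^(-w u^alpha)| <= 1 for w >= 0. *)
Definition kappa : R := - cos theta.

Lemma kappa_gt0 : 0 < kappa.
Proof.
rewrite /kappa; have -> : theta = (theta - pi / 2) + pi / 2 by rewrite subrK.
rewrite cosDpihalf opprK sin_gt0_pi// subr_gt0 theta_gt/=.
by rewrite ltrBlDr (lt_trans theta_lt)// ltrDl divr_gt0// pi_gt0.
Qed.

Lemma theta_gt0 : 0 < theta.
Proof. by apply: lt_trans theta_gt; rewrite divr_gt0// pi_gt0. Qed.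

Lemma cos_alpha_ge0 u : 0 <= u <= theta -> 0 <= cos (alpha * u).
Proof.
move=> /andP[u0 u1]; apply: cos_ge0_pihalf; apply/andP; split.
  by rewrite (@le_trans _ _ 0)// ?oppr_le0 ?divr_ge0 ?pi_ge0// mulr_ge0// ltW.
by apply: le_trans (ltW alpha_theta); rewrite ler_wpM2l// ltW.
Qed.

Lemma Re_cexp s u : Re (cexp (s +i* u)) = expR s * cos u. Proof. by []. Qed.

(** v^(-z) e^(-w v^alpha) dv in the variable zeta = ln v; the Jacobian e^zeta turns the exponent -z
    into 1 - z. *)
Definition wfun z w zeta := cexp ((1 - z)%:C * zeta - w%:C * cexp (alpha%:C * zeta)).

Lemma mulC_ri t s u : t%:C * (s +i* u) = (t * s) +i* (t * u).
Proof.
by apply: complexP; rewrite (ReM, ImM) ReC ImC mul0r ?subr0 ?addr0.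
Qed.

Lemma normc_wfun z w s u : normc (wfun z w (s +i* u)) =
  expR ((1 - z) * s - w * (expR (alpha * s) * cos (alpha * u))).
Proof.
by rewrite normc_cexp !mulC_ri; congr expR.
Qed.

Lemma normc_wfun_le z w s u : 0 <= w -> 0 <= u <= theta ->
  normc (wfun z w (s +i* u)) <= expR ((1 - z) * s).
Proof.
move=> w0 u0; rewrite normc_wfun ler_expR gerBl !mulr_ge0 ?expR_ge0//.
exact: cos_alpha_ge0.
Qed.

Lemma Im_wfun z w zeta : Im zeta = 0 -> Im (wfun z w zeta) = 0.
Proof.
move=> z0; apply: Im0cexp; apply: Im0D; first exact: Im0M.
by apply: Im0N; apply: Im0M => //; apply: Im0cexp; exact: Im0M.
Qed.

Lemma wfun0 z w : wfun z w 0 = (expR (- w))%:C.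
Proof. by rewrite /wfun !mulr0 cexp0 mulr1 sub0r -rmorphN cexpC. Qed.

Lemma holo_cexp_comp Q f f' : cbounded Q -> holo Q f f' ->
  holo Q (fun y => cexp (f y)) (fun y => cexp (f y) * f' y).
Proof.
move=> bQ hf; have [C C0 HC] := hf.
have bQ2 : cbounded [set z : R[i] | normc z <= C] by exists C.
apply: (holo_comp bQ _ (holo_cexp bQ2) hf) => z Qz.
by have [] := HC z Qz.
Qed.

Lemma holo_wfun Q z w : cbounded Q -> exists f', holo Q (wfun z w) f'.
Proof.
move=> bQ; eexists.
have h1 := holo_affine 0 (1 - z)%:C bQ.
have h2 := holoM bQ (holo_cst Q (- w%:C)) (holo_cexp_affine 0 alpha%:C bQ).
apply: eq_holo (holo_cexp_comp bQ (holoD h1 h2)) => // y _.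
by rewrite /wfun !add0r mulNr.
Qed.

Lemma ccont_wfun z w (g : R -> R[i]) x : ccont g x -> ccont (fun t => wfun z w (g t)) x.
Proof.
move=> cg; apply: ccont_cexp; apply: ccontD; first by apply: ccontM => //; exact: ccont_cst.
apply: ccontN; apply: ccontM; first exact: ccont_cst.
by apply: ccont_cexp; apply: ccontM => //; exact: ccont_cst.
Qed.

(* v^(-z) e^(-w v^alpha) / (1 - v) dv in the variable zeta = ln v *)
Definition qfun z w zeta := wfun z w zeta / (1 - cexp zeta).

Lemma Im_qfun z w zeta : Im zeta = 0 -> Im (qfun z w zeta) = 0.
Proof.
move=> z0; apply: Im0M; first exact: Im_wfun.
by apply: Im0V; apply: Im0D => //; apply: Im0N; exact: Im0cexp.
Qed.

Lemma normc_1Bcexp_ray s : 1 + kappa * expR s <= normc (1 - cexp (s +i* theta)).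
Proof.
apply: le_trans (normrRe _); rewrite ReB Re1 Re_cexp; apply: le_trans (ler_norm _).
by rewrite /kappa mulNr mulrC.
Qed.

Lemma normc_qfun_ray z w s : 0 <= w -> normc (qfun z w (s +i* theta)) <= kappa^-1 * expR (- (z * s)).
Proof.
move=> w0; rewrite normcM normcV.
have k0 := kappa_gt0; have e0 := expR_gt0 s.
have h0 : 0 < kappa * expR s by rewrite mulr_gt0.
have h1 : kappa * expR s <= normc (1 - cexp (s +i* theta)).
  by apply: le_trans (normc_1Bcexp_ray s); rewrite lerDr.
have -> : kappa^-1 * expR (- (z * s)) = expR ((1 - z) * s) * (kappa * expR s)^-1.
  have -> : expR (- (z * s)) = expR ((1 - z) * s) * (expR s)^-1.
    by rewrite -expRN -expRD; congr expR; ring.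
  by field; rewrite !gt_eqF.
apply: ler_pM; rewrite ?normc_ge0 ?invr_ge0 ?normc_ge0//.
  by apply: normc_wfun_le => //; rewrite lexx ltW// theta_gt0.
by rewrite lef_pV2// posrE (lt_le_trans h0).
Qed.

Lemma cont_1Bcexp (g : R -> R[i]) x : ccont g x -> ccont (fun t => 1 - cexp (g t)) x.
Proof. by move=> cg; apply: ccontD; [exact: ccont_cst|apply: ccontN; exact: ccont_cexp]. Qed.

Lemma ccont_qray z w s : ccont (fun s => qfun z w (s +i* theta)) s.
Proof.
apply: ccontM; first by apply: ccont_wfun; exact: ccont_hline.
apply: ccontV; first by apply: cont_1Bcexp; exact: ccont_hline.
apply: normc_neq0; apply: lt_le_trans (normc_1Bcexp_ray s).
by rewrite addr_gt0// mulr_gt0 ?expR_gt0// kappa_gt0.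
Qed.

Lemma cintable_qray z w a : 0 < z -> 0 <= w -> cintable `]a, +oo[ (fun s => qfun z w (s +i* theta)).
Proof.
move=> z0 w0.
apply: (@cintable_dominated _ _ _ (fun s => kappa^-1 * expR (- (z * s)))) => //.
- by apply: ccont_measurable => [|s _]; [exact: interval_open|exact: ccont_qray].
- by apply: rintZ => //; exact: (rint_expR_ray _ z0).1.
- by move=> s _; exact: normc_qfun_ray.
Qed.

Lemma holo_qfun Q z w m : cbounded Q -> 0 < m ->
  (forall y, Q y -> m <= normc (1 - cexp y)) -> exists f', holo Q (qfun z w) f'.
Proof.
move=> bQ m0 Qm; have [w' hw] := holo_wfun z w bQ; eexists.
have h1 : holo Q (fun y => 1 - cexp y) (fun y => - cexp y).
  have := holoD (holo_cst Q 1) (holoM bQ (holo_cst Q (-1)) (holo_cexp bQ)).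
  by apply: eq_holo => y _; rewrite ?mul0r ?add0r mulN1r.
exact: (holoM bQ hw (holoV bQ m0 Qm h1)).
Qed.

Lemma normc_1Bcexp_real zeta : `|1 - expR (Re zeta)| <= normc (1 - cexp zeta).
Proof.
rewrite -normc_cexp -[X in `|X - _|](@normc1 R).
rewrite ler_norml le_normcB andbT lerNl opprB.
by rewrite normc_distrC le_normcB.
Qed.

(** |1 - e^zeta| is at least |1 - e^(Re zeta)|, so the rectangle stays away from the pole zeta = 0
    when a and b lie on the same side of 0. *)
Lemma hankel_qfun_shift z w a b : 0 < z -> 0 <= w -> a < b -> (0 < a) || (b < 0) ->
  hankel theta a (qfun z w) = hankel theta b (qfun z w).
Proof.
move=> z0 w0 ab ab0.
have [m m0 Qm] : exists2 m, 0 < m & forall y, rect a b 0 theta y -> m <= normc (1 - cexp y).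
  case/orP : ab0 => [a0|b0].
    exists (expR a - 1) => [|y [/andP[ay _] _]]; first by rewrite subr_gt0 expR_gt1.
    apply: le_trans (normc_1Bcexp_real _); rewrite distrC.
    by apply: le_trans (ler_norm _); rewrite lerD2r ler_expR.
  exists (1 - expR b) => [|y [/andP[_ yb] _]]; first by rewrite subr_gt0 expR_lt1.
  apply: le_trans (normc_1Bcexp_real _).
  by apply: le_trans (ler_norm _); rewrite lerD2l lerN2 ler_expR.
have [f' hf] := holo_qfun z w (rect_bounded a b 0 theta) m0 Qm.
apply: hankel_shift ab hf _ _; first exact: theta_gt0.
  by move=> x _; exact: Im_qfun.
exact: (cintable_qray _ z0 w0).2.
Qed.

(** The value is the same at every b > a, and arc and ray are both O(e^(- z b)): on the arc |1 -
    e^zeta| >= e^b / 2 once b >= 1. *)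
Lemma hankel_qfun_pos z w a : 0 < z -> 0 <= w -> 0 < a -> hankel theta a (qfun z w) = 0.
Proof.
move=> z0 w0 a0.
have th0 := theta_gt0; have k0 := kappa_gt0.
pose C := 2 * theta + kappa^-1 / z.
have bnd b : 1 <= b -> `|hankel theta b (qfun z w)| <= C * expR (- (z * b)).
  move=> b1; rewrite mulrDl; apply: le_trans (ler_normD _ _) _; apply: lerD.
    have e2 : 2 <= expR b by apply: le_trans (expR_ge1Dx b); lra.
    have -> : 2 * theta * expR (- (z * b)) =
        \int[mu]_(u in `]0, theta[) (2 * expR (- (z * b))).
      by rewrite Rint_cst_oo ?subr0 ?ltW//; ring.
    have B u : 0 < u < theta -> normc (qfun z w (b +i* u)) <= 2 * expR (- (z * b)).
      move=> /andP[u0 u1]; rewrite normcM normcV.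
      have -> : 2 * expR (- (z * b)) = expR ((1 - z) * b) * (expR b / 2)^-1.
        have -> : expR (- (z * b)) = expR ((1 - z) * b) * (expR b)^-1.
          by rewrite -expRN -expRD; congr expR; ring.
        by field; rewrite gt_eqF// expR_gt0.
      have h1 : expR b / 2 <= normc (1 - cexp (b +i* u)).
        apply: le_trans (normc_1Bcexp_real _); rewrite distrC.
        by apply: le_trans (ler_norm _); rewrite ReI; lra.
      apply: ler_pM; rewrite ?normc_ge0 ?invr_ge0 ?normc_ge0//.
        by apply: normc_wfun_le => //; rewrite !ltW.
      have h2 : 0 < expR b / 2 by rewrite divr_gt0// expR_gt0.
      by rewrite lef_pV2// posrE (lt_le_trans h2).
    apply: le_normr_Rint => //; last 2 first.
    - exact: rint_cst_oo.
    - by move=> u /set_itvoo /B; apply: le_trans; exact: normrRe.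
    have : cintable `]0, theta[ (fun u => qfun z w (b +i* u)); last by case.
    apply: cintable_dominated (rint_cst_oo _ _ (2 * expR (- (z * b)))) _ => //.
      apply: ccont_measurable_oo => u u01.
      apply: ccontM; first by apply: ccont_wfun; exact: ccont_vline.
      apply: ccontV; first by apply: cont_1Bcexp; exact: ccont_vline.
      apply: normc_neq0; apply: lt_le_trans (normc_1Bcexp_real _).
      rewrite distrC ReI gtr0_norm subr_gt0; last by lra.
      lra.
  have [I E] := rint_expR_ray b z0.
  have -> : kappa^-1 / z * expR (- (z * b)) =
      \int[mu]_(s in `]b, +oo[) (kappa^-1 * expR (- (z * s))).
    by rewrite RintegralZl// E; ring.
  apply: le_normr_Rint => //; first exact: (cintable_qray _ z0 w0).2.
    exact: rintZ.
  by move=> s _; apply: le_trans (normrIm _) _; exact: normc_qfun_ray.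
have C0 : 0 < C by rewrite addr_gt0 ?mulr_gt0 ?invr_gt0.
apply/eqP; rewrite -normr_le0; apply/ler_addgt0Pr => e e0; rewrite add0r.
(* The first summand makes C e^(- z b) at most e; adding a + 1 gives b > a and b >= 1. *)
pose b := `|ln (C / e) / z| + a + 1.
have eC : 0 < C / e by rewrite divr_gt0.
have ab : a < b by rewrite /b; have := normr_ge0 (ln (C / e) / z); lra.
rewrite (hankel_qfun_shift z0 w0 ab) ?a0//.
apply: le_trans (bnd b _) _.
  by rewrite /b; have := normr_ge0 (ln (C / e) / z); lra.
rewrite expRN ler_pdivrMr ?expR_gt0// mulrC -ler_pdivrMr//.
rewrite -[leLHS]lnK ?posrE// ler_expR -ler_pdivrMl// mulrC /b.
by have := ler_norm (ln (C / e) / z); lra.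
Qed.

Lemma Rint_split a c (B : itv_bound R) (h : R -> R) :
  rint [set` Interval (BRight a) B] h -> a <= c -> (BRight c <= B)%O ->
  \int[mu]_(x in [set` Interval (BRight a) B]) h x =
  \int[mu]_(x in `]a, c[) h x + \int[mu]_(x in [set` Interval (BRight c) B]) h x.
Proof.
move=> ih ac cB.
have <- := @Rintegral_itvB R h (BRight a) B c ih; last 2 first.
- by rewrite bnd_simp.
- by [].
rewrite Rintegral_itv_bndo_bndc; last first.
  apply: (integrableS _ _ _ ih) => //; apply: subset_itvl.
  by apply: le_trans cB; rewrite bnd_simp.
by rewrite addrC subrK.
Qed.

Lemma Rint_split_oo a b c h : rint `]a, b[ h -> a <= c -> c < b ->
  \int[mu]_(x in `]a, b[) h x =
  \int[mu]_(x in `]a, c[) h x + \int[mu]_(x in `]c, b[) h x.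
Proof. by move=> ih ac cb; apply: Rint_split => //; rewrite bnd_simp. Qed.

Lemma Rint_split_oy a c h : rint `]a, +oo[ h -> a <= c ->
  \int[mu]_(x in `]a, +oo[) h x =
  \int[mu]_(x in `]a, c[) h x + \int[mu]_(x in `]c, +oo[) h x.
Proof. by move=> ih ac; apply: Rint_split => //; rewrite bnd_simp. Qed.

Lemma cintable_qvert z w a : 0 <= w -> a != 0 -> cintable `]0, theta[ (fun u => qfun z w (a +i* u)).
Proof.
move=> w0 a0.
have a1 : 0 < `|1 - expR a|.
  by rewrite normr_gt0 subr_eq0 eq_sym; apply: contra a0 => /eqP; rewrite -expR0 => /expR_inj ->.
have H u : `|1 - expR a| <= normc (1 - cexp (a +i* u)) by exact: (normc_1Bcexp_real (a +i* u)).
apply: cintable_dominated (rint_cst_oo _ _ (expR ((1 - z) * a) * `|1 - expR a|^-1)) _ => //.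
  apply: ccont_measurable_oo => u u01.
  apply: ccontM; first by apply: ccont_wfun; exact: ccont_vline.
  apply: ccontV; first by apply: cont_1Bcexp; exact: ccont_vline.
  by apply: normc_neq0; exact: lt_le_trans (H u).
move=> u /set_itvoo /andP[u0 u1]; rewrite normcM normcV.
apply: ler_pM; rewrite ?normc_ge0 ?invr_ge0 ?normc_ge0//.
  by apply: normc_wfun_le => //; rewrite (ltW u0) ltW.
by rewrite lef_pV2// posrE (lt_le_trans a1).
Qed.

Lemma Rint_poisson (b c d : R) : 0 < b -> c < d ->
  rint `]c, d[ (fun u => b / (b ^+ 2 + u ^+ 2)) /\
  \int[mu]_(u in `]c, d[) (b / (b ^+ 2 + u ^+ 2)) = atan (d / b) - atan (c / b).
Proof.
move=> b0 cd.
have p u : b ^+ 2 + u ^+ 2 != 0.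
  by rewrite gt_eqF// ltr_pwDl ?sqr_ge0// exprn_gt0.
have cf : continuous (fun u => b / (b ^+ 2 + u ^+ 2)).
  move=> u.
  apply: (@continuousM _ _ (fun=> b) (fun u => (b ^+ 2 + u ^+ 2)^-1)).
    exact: cst_continuous.
  apply: (@continuousV _ _ (fun u => b ^+ 2 + u ^+ 2)); first exact: p.
  apply: (@continuousD _ _ _ (fun=> b ^+ 2) (fun u => u ^+ 2)).
    exact: cst_continuous.
  by apply: cont_sqr; exact: cvg_id.
have dF u : is_derive u 1 (fun u => atan (u / b)) (b / (b ^+ 2 + u ^+ 2)).
  have d1 : is_derive u 1 (fun u : R => u / b) b^-1.
    apply: is_derive_ext (is_deriveZ b^-1 (is_derive_id u 1)) => [y|].
      by rewrite /GRing.scale /= mulrC.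
    by rewrite /GRing.scale /= mulr1.
  have := @is_derive1_comp _ atan (fun u : R => u / b) u _ _ (is_derive1_atan _) d1.
  apply: is_derive_ext => //.
  have -> : 1 + (u / b) ^+ 2 = (b ^+ 2 + u ^+ 2) / b ^+ 2 by field; rewrite gt_eqF.
  by rewrite invf_div mulrAC {1}expr2 mulfK// gt_eqF.
have I : rint `]c, d[ (fun u => b / (b ^+ 2 + u ^+ 2)).
  apply: (integrableS _ _ _ (rint_continuous_cc (continuous_subspaceT cf))) => //.
  exact: subset_itv_oo_cc.
split => //; apply: FTC_oo => //.
  by move=> x _; exact: cf.
  by apply: cvg_at_right_filter; exact: is_derive_cont (dF c).
by apply: cvg_at_left_filter; exact: is_derive_cont (dF d).
Qed.

(** * The simple pole at v = 1 *)

Section residue.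
Variables (z w : R).
Hypothesis w_ge0 : 0 <= w.

(** With this half-width the square stays in the region of [expquo_lower] and below the height theta
    > pi / 2. *)
Let b : R := 2^-1.
Let Sq := rect (- b) b 0 b.
(** y times [qfun] with its singularity removed, through 1 - e^y = - y * expquo y; the value at 0 is
    the residue, minus e^(-w). *)
Let K (y : R[i]) := - wfun z w y * (expquo y)^-1.
Let b0 : 0 < b. Proof. by rewrite invr_gt0. Qed.
Let Sq0 : Sq 0. Proof. by split; rewrite /= ?lexx ?oppr_le0 ltW. Qed.

Let holoK : exists K', holo Sq K K'.
Proof.
have bS := rect_bounded (- b) b 0 b; have cS := @rect_convex R (- b) b 0 b.
have [w' hw] := holo_wfun z w bS.
have [e' he] := holo_expquo bS cS Sq0.
have e0 : 0 < expR (-1) / 2 :> R by rewrite divr_gt0// expR_gt0.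
have he2 : holo Sq (fun y => (expquo y)^-1) (fun y => - (expquo y ^+ 2)^-1 * e' y).
  apply: holoV bS e0 _ he => y [/andP[y1 y2] /andP[y3 y4]].
  apply: expquo_lower; first by apply: le_trans y1; rewrite /b; lra.
  by apply/andP; split; rewrite /b in y3 y4; lra.
eexists; apply: eq_holo (holoM bS (holoM bS (holo_cst Sq (-1)) hw) he2) => // y _.
by rewrite mulN1r.
Qed.

Let D_spec : exists F D, holo Sq F D /\
  forall y, Sq y -> y * D y = K y - K 0.
Proof.
have [K' hK] := holoK.
have bS := rect_bounded (- b) b 0 b; have cS := @rect_convex R (- b) b 0 b.
exists (psi K 0), (dpsi K' 0); split; first exact: holo_psi.
by move=> y Sy; rewrite -(dpsiE bS cS Sq0 hK) ?subr0.
Qed.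

Let K0 : K 0 = - (expR (- w))%:C.
Proof. by rewrite /K expquo0 invr1 mulr1 wfun0. Qed.

Let KE y : y != 0 -> K y = y * qfun z w y.
Proof.
move=> y0; rewrite /K /qfun.
have -> : 1 - cexp y = - (y * expquo y) by rewrite expquoE opprB.
have [->|e0] := eqVneq (expquo y) 0; first by rewrite mulr0 oppr0 invr0 !mulr0.
by field; rewrite e0 y0.
Qed.

(* Near its simple pole 0, qfun = D - exp (- w) / zeta with D primitivable, so the three upper sides of the
   square contribute - exp (- w) times the variation of the argument. *)
Lemma residue_square : rint `]- b, b[ (fun s => Im (qfun z w (s +i* b))) ->
  \int[mu]_(u in `]0, b[) Re (qfun z w (- b +i* u)) +
  \int[mu]_(s in `]- b, b[) Im (qfun z w (s +i* b)) -
  \int[mu]_(u in `]0, b[) Re (qfun z w (b +i* u)) = pi * expR (- w).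
Proof.
move=> iq.
have [F [D [hF DE]]] := D_spec.
have bb : - b < b by rewrite gtrN.
have [[i1 i2 i3 i4] E] := rectangle_primitive bb b0 hF.
have DE2 y : Sq y -> y != 0 -> D y = qfun z w y + (expR (- w))%:C / y.
  move=> Sy y0; apply: (mulfI y0); rewrite DE// K0 KE// opprK mulrDr.
  by congr (_ + _); rewrite mulrCA mulfV// mulr1.
have D0 x : - b < x < b -> Im (D (x +i* 0)) = 0.
  have Sx y : - b <= y <= b -> Sq (y +i* 0) by move=> yb; split; rewrite //= lexx ltW.
  have Dne y : - b <= y <= b -> y != 0 -> Im (D (y +i* 0)) = 0.
    move=> yb y0; rewrite DE2; last 2 first.
    - exact: Sx.
    - by rewrite -[y +i* 0]/(y%:C); apply: normc_neq0; rewrite normcC normr_gt0.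
    apply: Im0D; first exact: Im_qfun.
    by apply: Im0M => //; exact: Im0V.
  move=> /andP[x1 x2]; have [->|x0] := eqVneq x 0; last by apply: Dne; rewrite ?(ltW x1) ?(ltW x2).
  (* At the pole the formula for D is void; reality passes to the limit along small y > 0 by the
     Lipschitz bound on D. *)
  have [C C0 HC] := holo_lip_deriv hF.
  apply/eqP; rewrite -normr_le0; apply/ler_addgt0Pr => e e0; rewrite add0r.
  pose y := Num.min b (e / (C + 1)).
  have C1 : 0 < C + 1 by rewrite ltr_wpDl.
  have y0 : 0 < y by rewrite lt_min b0 divr_gt0.
  have yb : - b <= y <= b by rewrite ge_min lexx andbT (le_trans _ (ltW y0))// oppr_le0 ltW.
  have h0 : Sq (0 +i* 0) by apply: Sx; rewrite oppr_le0 ltW.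
  have := HC _ _ (Sx _ yb) h0.
  have -> : 0 +i* 0 - (y +i* 0) = (- y)%:C :> R[i] by apply: complexP; rewrite /= ?sub0r ?oppr0 ?addr0.
  rewrite normcC normrN gtr0_norm// => h.
  have -> : Im (D (0 +i* 0)) = Im (D (0 +i* 0) - D (y +i* 0)).
    by rewrite ImB (Dne y) ?subr0 ?gt_eqF.
  apply: le_trans (normrIm _) _; apply: le_trans h _.
  have : y <= e / (C + 1) by rewrite ge_min lexx orbT.
  by rewrite ler_pdivlMr// mulrDr mulr1; lra.
have := congr1 (@Im R) E; rewrite !ImD !ImM !Re_i !Im_i !mul0r !mul1r !add0r.
rewrite (_ : Im (cintegral _ (fun x => D (x +i* 0))) = 0); last first.
  by apply: Im0cintegral => x /set_itvoo; exact: D0.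
rewrite add0r /cintegral ?(ReI, ImI).
have bE : b / b = 1 by rewrite divff// gt_eqF.
(* The height equals the half-width, so the increments of the argument along the three sides are pi
   / 4, pi / 2 and pi / 4; their sum pi is half a turn, as befits a half-contour. *)
have [p1 e1] := Rint_poisson b0 b0.
have [p2 e2] := Rint_poisson b0 bb.
rewrite mul0r atan0 subr0 bE atan1 in e1.
rewrite mulNr bE atanN atan1 in e2.
have q0 s u : 0 < u -> s +i* u != 0 :> R[i].
  by move=> u0; apply: contraTneq u0 => /(congr1 (@Im R)) /= ->; rewrite ltxx.
have ri s u : Re ((expR (- w))%:C / (s +i* u)) = expR (- w) * (s / (s ^+ 2 + u ^+ 2)).
  by rewrite ReM ReC ImC mul0r subr0.
have ii s u : Im ((expR (- w))%:C / (s +i* u)) = expR (- w) * - (u / (s ^+ 2 + u ^+ 2)).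
  by rewrite ImM ReC ImC mul0r addr0.
have E4 : \int[mu]_(u in `]0, b[) Re (qfun z w (b +i* u)) =
    \int[mu]_(u in `]0, b[) Re (D (b +i* u)) - expR (- w) * (pi / 4).
  rewrite -e1 -RintegralZl// -RintegralB//; [|exact: i4.1|exact: rintZ].
  apply: eq_Rintegral => u /set_mem /set_itvoo /andP[u0 ub].
  rewrite DE2 ?q0//; first by rewrite ReD ri addrK.
  by split; rewrite /= ?lexx ?(ltW u0) ?(ltW ub) ?(ltW bb).
have E3 : \int[mu]_(u in `]0, b[) Re (qfun z w (- b +i* u)) =
    \int[mu]_(u in `]0, b[) Re (D (- b +i* u)) + expR (- w) * (pi / 4).
  rewrite -e1 -RintegralZl// -RintegralD//; [|exact: i3.1|exact: rintZ].
  apply: eq_Rintegral => u /set_mem /set_itvoo /andP[u0 ub].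
  rewrite DE2 ?q0//; first by rewrite ReD ri sqrrN mulNr mulrN subrK.
  by split; rewrite /= ?lexx ?(ltW u0) ?(ltW ub) ?(ltW bb).
have E2 : \int[mu]_(s in `]- b, b[) Im (qfun z w (s +i* b)) =
    \int[mu]_(s in `]- b, b[) Im (D (s +i* b)) + expR (- w) * (pi / 4 + pi / 4).
  rewrite opprK in e2; rewrite -e2 -RintegralZl// -RintegralD//; [|exact: i2.2|exact: rintZ].
  apply: eq_Rintegral => s /set_mem /set_itvoo /andP[s0 sb].
  rewrite DE2 ?q0//; first by rewrite ImD ii mulrN [s ^+ 2 + _]addrC subrK.
  by split; rewrite /= ?lexx ?(ltW s0) ?(ltW sb) ?(ltW b0).
by rewrite E2 E3 E4 => ->; field.
Qed.

End residue.

Lemma Im_addiM (x1 y1 x2 y2 : R[i]) : x1 + 'i * y1 = x2 + 'i * y2 ->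
  Im x1 + Re y1 = Im x2 + Re y2.
Proof.
by move=> /(congr1 (@Im R)); rewrite !ImD !ImM !Re_i !Im_i !mul0r !mul1r !add0r.
Qed.

Lemma sin_lower (b c : R) : 0 < b -> b < c -> c < pi ->
  exists2 m, 0 < m & forall u, b <= u <= c -> m <= sin u.
Proof.
move=> b0 bc cpi.
have [|t tI H] := @EVT_min R sin b c (ltW bc).
  by apply: continuous_subspaceT => x; exact: continuous_sin.
exists (sin t); last by move=> u ub; apply: H; rewrite in_itv.
move: tI; rewrite in_itv /= => /andP[bt tc].
by apply: sin_gt0_pi; rewrite (lt_le_trans b0)//= (le_lt_trans tc).
Qed.

Lemma half_lt_theta : 2^-1 < theta.
Proof. by apply: lt_trans theta_gt; have := pi_ge2 R; lra. Qed.

(** q1 and q2 stand for the vertical lines Re = - b and Re = b, q3 and q4 for the horizontal lines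
    Im = theta and Im = b. The region between the contours is cut at height b into a rectangle
    without pole, the first equation, and the half square at the pole, the second. *)
Lemma contour_difference (q1 q2 q3 q4 : R -> R) (b r : R) : 0 < b -> b < theta ->
  rint `]0, theta[ q1 -> rint `]0, theta[ q2 -> rint `]- b, +oo[ q3 ->
  \int[mu]_(s in `]- b, b[) q4 s + \int[mu]_(u in `]b, theta[) q2 u =
  \int[mu]_(s in `]- b, b[) q3 s + \int[mu]_(u in `]b, theta[) q1 u ->
  \int[mu]_(u in `]0, b[) q1 u + \int[mu]_(s in `]- b, b[) q4 s -
    \int[mu]_(u in `]0, b[) q2 u = r ->
  \int[mu]_(u in `]0, theta[) q1 u + \int[mu]_(s in `]- b, +oo[) q3 s -
  (\int[mu]_(u in `]0, theta[) q2 u + \int[mu]_(s in `]b, +oo[) q3 s) = r.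
Proof.
move=> b0 bth i1 i2 i3 E1 S.
have bb : - b <= b by rewrite ltW// gtrN.
rewrite (Rint_split_oo i1 (ltW b0) bth) (Rint_split_oo i2 (ltW b0) bth).
by rewrite (Rint_split_oy i3 bb); lra.
Qed.

Lemma hankel_qfun_residue z w : 0 < z -> 0 <= w ->
  hankel theta (- 2^-1) (qfun z w) - hankel theta 2^-1 (qfun z w) = pi * expR (- w).
Proof.
move=> z0 w0; set b : R := 2^-1.
have b0 : 0 < b by rewrite invr_gt0.
have bth : b < theta := half_lt_theta.
have bb : - b < b by rewrite gtrN.
(* Above height b the denominator is bounded below through its imaginary part, of modulus e^(Re y)
   sin (Im y), since theta < pi. *)
have [m m0 Hm] := sin_lower b0 bth theta_lt.
have [|y [/andP[y1 _] y3]|f' hq] := @holo_qfun (rect (- b) b b theta) z w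
    (expR (- b) * m) (rect_bounded _ _ _ _).
- by rewrite mulr_gt0// expR_gt0.
- apply: le_trans (normrIm _); rewrite ImB Im1 sub0r normrN; apply: le_trans (ler_norm _).
  by rewrite /cexp ImI ler_pM ?expR_ge0 ?ler_expR ?Hm// ltW.
have [[i1 i2 i3 i4] E] := cauchy_rectangle bb bth hq.
have E1 : \int[mu]_(s in `]- b, b[) Im (qfun z w (s +i* b)) +
    \int[mu]_(u in `]b, theta[) Re (qfun z w (b +i* u)) =
    \int[mu]_(s in `]- b, b[) Im (qfun z w (s +i* theta)) +
    \int[mu]_(u in `]b, theta[) Re (qfun z w (- b +i* u)) := Im_addiM E.
have S := residue_square i1.2.
have nb0 : - b != 0 by rewrite oppr_eq0 gt_eqF.
have b0' : b != 0 by rewrite gt_eqF.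
exact: (contour_difference b0 bth (cintable_qvert z w0 nb0).1
  (cintable_qvert z w0 b0').1 (cintable_qray (- b) z0 w0).2 E1 S).
Qed.

Lemma hankel_qfun z w a : 0 < z -> 0 <= w -> a < 0 ->
  hankel theta a (qfun z w) = pi * expR (- w).
Proof.
move=> z0 w0 a0; have h0 : 0 < 2^-1 :> R by rewrite invr_gt0.
rewrite -(hankel_qfun_residue z0 w0) (hankel_qfun_pos z0 w0 h0) subr0.
have b0 : - 2^-1 < 0 :> R by rewrite oppr_lt0 invr_gt0.
have [ab|ba|->//] := ltgtP a (- 2^-1).
  by apply: hankel_qfun_shift; rewrite ?b0 ?orbT.
by apply/esym; apply: hankel_qfun_shift; rewrite ?a0 ?orbT.
Qed.

(* e^u u^(-z) e^(-t u^alpha) du in the variable zeta = ln u *)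
Definition efun z t zeta := cexp (cexp zeta) * wfun z t zeta.

Lemma Im_efun z t zeta : Im zeta = 0 -> Im (efun z t zeta) = 0.
Proof.
by move=> z0; apply: Im0M; [do 2 apply: Im0cexp|exact: Im_wfun].
Qed.

Lemma holo_efun Q z t : cbounded Q -> exists f', holo Q (efun z t) f'.
Proof.
move=> bQ; have [w' hw] := holo_wfun z t bQ; eexists.
exact: (holoM bQ (holo_cexp_comp bQ (holo_cexp bQ)) hw).
Qed.

Lemma ccont_efun z t (g : R -> R[i]) x : ccont g x -> ccont (fun y => efun z t (g y)) x.
Proof.
by move=> cg; apply: ccontM; [do 2 apply: ccont_cexp|exact: ccont_wfun].
Qed.

Lemma theta_itv : 0 <= theta <= theta. Proof. by rewrite lexx ltW// theta_gt0. Qed.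

Lemma normc_efun_ray z t s : 0 <= t ->
  normc (efun z t (s +i* theta)) <= expR (- (kappa * expR s) + (1 - z) * s).
Proof.
move=> t0; rewrite normcM normc_cexp Re_cexp expRD ler_pM ?expR_ge0 ?normc_ge0//.
  by rewrite /kappa mulNr opprK mulrC.
by apply: normc_wfun_le => //; exact: theta_itv.
Qed.

Lemma cintable_ray_dominated (f : R[i] -> R[i]) c m a : 0 < c ->
  (forall s, ccont (fun s => f (s +i* theta)) s) ->
  (forall s, normc (f (s +i* theta)) <= expR (- (c * expR s) + m * s)) ->
  cintable `]a, +oo[ (fun s => f (s +i* theta)).
Proof.
move=> c0 cf fb; have [C C0 HC] := expR_expR_dominated m a c0.
apply: (@cintable_dominated _ _ _ (fun s => C * expR (- (1 * s)))) => //.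
- by apply: ccont_measurable => [|s _]; [exact: interval_open|exact: cf].
- by apply: rintZ => //; exact: (rint_expR_ray _ ltr01).1.
- move=> s; rewrite /= in_itv/= andbT => /ltW as_.
  by apply: le_trans (fb s) _; exact: HC.
Qed.

Lemma cintable_eray z t a : 0 <= t -> cintable `]a, +oo[ (fun s => efun z t (s +i* theta)).
Proof.
move=> t0; apply: (@cintable_ray_dominated (efun z t) kappa (1 - z)).
- exact: kappa_gt0.
- by move=> s; apply: ccont_efun; exact: ccont_hline.
- by move=> s; exact: normc_efun_ray.
Qed.

Lemma hankel_efun_shift z t a b : 0 <= t -> hankel theta a (efun z t) = hankel theta b (efun z t).
Proof.
move=> t0; wlog ab : a b / a < b.
  move=> H; have [ab|ba|->//] := ltgtP a b; first exact: H.
  by apply/esym; exact: H.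
have [f' hf] := holo_efun z t (rect_bounded a b 0 theta).
apply: (hankel_shift theta_gt0 ab hf); first by move=> x _; exact: Im_efun.
exact: (cintable_eray z a t0).2.
Qed.

(** What the weighted integrand becomes under u = x v: the powers of x cancel and x is left only in
    e^(-x (1 - v)), whose integral over x is 1 / (1 - v). *)
Definition mfun z w x zeta := cexp (- (x%:C * (1 - cexp zeta))) * wfun z w zeta.

Lemma efun_shift z w x s u : 0 < x ->
  (x `^ (z - 1) * expR (- x))%:C * efun z (w * x `^ (- alpha)) ((s + ln x) +i* u) =
  mfun z w x (s +i* u).
Proof.
move=> x0; have -> : (s + ln x) +i* u = (s +i* u) + (ln x)%:C :> R[i].
  by apply: complexP; rewrite ?(ReD, ImD) ?ReC ?ImC ?addr0.
have e1 : x`^(z - 1) * expR (- x) = expR ((z - 1) * ln x - x) by rewrite /powR gt_eqF// -expRD.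
have lnxK : cexp (ln x)%:C = x%:C :> R[i] by rewrite cexpC lnK.
rewrite e1 -cexpC /efun /mfun /wfun -!cexpD; set y := s +i* u.
have -> : cexp (y + (ln x)%:C) = x%:C * cexp y by rewrite cexpD lnxK mulrC.
have e2 : (w * x `^ (- alpha))%:C * cexp (alpha%:C * (y + (ln x)%:C)) = w%:C * cexp (alpha%:C * y).
  rewrite mulrDr cexpD -rmorphM cexpC /powR gt_eqF// rmorphM -mulrA; congr (_ * _).
  by rewrite mulrCA -rmorphM -expRD mulNr addNr expR0 mulr1.
congr cexp; rewrite e2 !rmorphD !rmorphN !rmorphM /= rmorph1; ring.
Qed.

Lemma hankel_efun_scale z w a x : 0 <= w -> 0 < x ->
  x `^ (z - 1) * expR (- x) * hankel theta a (efun z (w * x `^ (- alpha))) =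
  hankel theta (- 1) (mfun z w x).
Proof.
move=> w0 x0.
have t0 : 0 <= w * x `^ (- alpha) by rewrite mulr_ge0// powR_ge0.
set t := w * _ in t0 *; set c := x `^ _ * _.
(* The abscissa is adapted to x: translation by ln x then ends at -1 for every x. *)
rewrite (hankel_efun_shift z a (- 1 + ln x) t0) /hankel mulrDr.
have cE s u : c%:C * efun z t ((s + ln x) +i* u) = mfun z w x (s +i* u).
  exact: efun_shift.
have Re_cE s u : c * Re (efun z t ((s + ln x) +i* u)) = Re (mfun z w x (s +i* u)).
  by rewrite -cE ReM ReC ImC mul0r subr0.
have Im_cE s u : c * Im (efun z t ((s + ln x) +i* u)) = Im (mfun z w x (s +i* u)).
  by rewrite -cE ImM ReC ImC mul0r addr0.
have c0 : 0 < c by rewrite mulr_gt0 ?expR_gt0// powR_gt0.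
have ie : rint `]- 1, +oo[ (fun s => Im (efun z t ((s + ln x) +i* theta))).
  have : cintable `]- 1, +oo[ (fun s => efun z t ((s + ln x) +i* theta)); last by case.
  apply: (eq_cintable _ _ (cintableZ (c%:C^-1) _ (@cintable_ray_dominated (mfun z w x)
    (x * kappa) (1 - z) (- 1) _ _ _))) => //.
  - move=> s _; rewrite -cE mulrA mulVf ?mul1r//.
    by apply: normc_neq0; rewrite normcC gtr0_norm.
  - by rewrite mulr_gt0// kappa_gt0.
  - move=> s; apply: ccontM; last by apply: ccont_wfun; exact: ccont_hline.
    apply: ccont_cexp; apply: ccontN; apply: ccontM; first exact: ccont_cst.
    by apply: cont_1Bcexp; exact: ccont_hline.
  - move=> s; rewrite normcM normc_cexp expRD ler_pM ?expR_ge0 ?normc_ge0//; last first.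
      by apply: normc_wfun_le => //; exact: theta_itv.
    rewrite ler_expR ReN ReM ReC ImC mul0r subr0 ReB Re1 Re_cexp /kappa lerN2.
    by rewrite mulrN mulNr mulrBr mulr1 -mulrA [cos _ * _]mulrC lerDr ltW.
congr (_ + _).
  rewrite -RintegralZl//; first by apply: eq_Rintegral => u _; exact: Re_cE.
  have : cintable `]0, theta[ (fun u => efun z t ((- 1 + ln x) +i* u)); last by case.
  have [f' hf] := holo_efun z t (rect_bounded (- 1 + ln x) (- 1 + ln x + 1) 0 theta).
  have h1 : - 1 + ln x < - 1 + ln x + 1 by rewrite ltrDl.
  by have [[]] := cauchy_rectangle h1 theta_gt0 hf.
rewrite Rint_translate//.
  by rewrite -RintegralZl//; apply: eq_Rintegral => s _; exact: Im_cE.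
have ce s : ccont (fun s => efun z t (s +i* theta)) s.
  by apply: ccont_efun; exact: ccont_hline.
by apply: continuous_measurable_fun => s; exact: (ce s).2.
Qed.

Lemma cintegral_cexp (c : R[i]) : 0 < Re c ->
  cintable `]0, +oo[ (fun x => cexp (- (x%:C * c))) /\
  cintegral `]0, +oo[ (fun x => cexp (- (x%:C * c))) = c^-1.
Proof.
move=> c0.
have cn0 : c != 0 by apply: contraTneq c0 => ->; rewrite ltxx.
have dg x : cderiv (fun x => - (x%:C * c)) x (- c).
  apply: cderiv_eq (cderivN (cderivM (cderiv_id x) (cderiv_cst c x))) _.
  by rewrite mul1r mulr0 addr0.
have cf x : ccont (fun x => cexp (- (x%:C * c))) x.
  by apply: ccont_cexp; exact: cderiv_ccont (dg x).
have nf x : normc (cexp (- (x%:C * c))) = expR (- (Re c * x)).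
  by rewrite normc_cexp ReN ReM ReC ImC mul0r subr0 mulrC.
have I : cintable `]0, +oo[ (fun x => cexp (- (x%:C * c))).
  apply: (@cintable_dominated _ _ _ (fun x => expR (- (Re c * x)))) => //.
  - by apply: ccont_measurable => [|x _]; [exact: interval_open|exact: cf].
  - exact: (rint_expR_ray _ c0).1.
  - by move=> x _; rewrite nf.
split => //; pose F x := - c^-1 * cexp (- (x%:C * c)).
have dF x : cderiv F x (cexp (- (x%:C * c))).
  apply: cderiv_eq (cderivZ _ (cderiv_cexp (dg x))) _.
  by rewrite mulrA mulrNN mulVf// mul1r.
have F0 : F 0 = - c^-1 by rewrite /F rmorph0 mul0r oppr0 cexp0 mulr1.
have lim (p : R[i] -> R) : (forall y, `|p y| <= normc y) -> p (F x) @[x --> +oo] --> (0 : R).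
  move=> pn; apply/cvgr0Pnorm_le => e e0.
  have k0 : 0 < e * normc c by rewrite mulr_gt0// normc_gt0.
  near=> x; apply: le_trans (pn _) _.
  rewrite normcM normc_opp normcV nf mulrC ler_pdivrMr ?normc_gt0//.
  rewrite -[leRHS]lnK ?posrE// ler_expR lerNl -ler_pdivrMl//.
apply: complexP; rewrite /cintegral ?(ReI, ImI).
  have -> : Re c^-1 = 0 - Re (F 0) by rewrite F0 ReN opprK add0r.
  apply: (FTC_oy I.1 (F := fun x => Re (F x))).
  - by move=> x _; exact: (cf x).1.
  - by move=> x _; exact: (dF x).1.
  - by apply: cvg_at_right_filter; exact: (cderiv_ccont (dF 0)).1.
  - by apply: lim; exact: normrRe.
have -> : Im c^-1 = 0 - Im (F 0) by rewrite F0 ImN opprK add0r.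
apply: (FTC_oy I.2 (F := fun x => Im (F x))).
- by move=> x _; exact: (cf x).2.
- by move=> x _; exact: (dF x).2.
- by apply: cvg_at_right_filter; exact: (cderiv_ccont (dF 0)).2.
- by apply: lim; exact: normrIm.
Unshelve. all: by end_near. Qed.

Lemma mfun_int z w zeta : Re (cexp zeta) < 1 ->
  cintable `]0, +oo[ (fun x => mfun z w x zeta) /\
  cintegral `]0, +oo[ (fun x => mfun z w x zeta) = qfun z w zeta.
Proof.
move=> z1; have c0 : 0 < Re (1 - cexp zeta) by rewrite ReB Re1 subr_gt0.
have [I E] := cintegral_cexp c0.
have mE x : mfun z w x zeta = wfun z w zeta * cexp (- (x%:C * (1 - cexp zeta))).
  by rewrite /mfun mulrC.
split.
  by apply: eq_cintable (cintableZ (wfun z w zeta) _ I) => // x _; rewrite mE.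
rewrite /qfun -E -cintegralZ//; apply: eq_cintegral => x _; exact: mE.
Qed.

Lemma normc_mfun z w x s u : 0 <= w -> 0 <= u <= theta ->
  normc (mfun z w x (s +i* u)) <= expR ((1 - z) * s) * expR (- ((1 - expR s * cos u) * x)).
Proof.
move=> w0 u0; rewrite normcM normc_cexp mulrC ler_pM ?expR_ge0 ?normc_ge0 ?normc_wfun_le//.
by rewrite ler_expR ReN ReM ReC ImC mul0r subr0 ReB Re1 Re_cexp mulrC.
Qed.

Lemma Rint_norm_mfun_le z w s u (p : R[i] -> R) : 0 <= w -> 0 <= u <= theta ->
  expR s * cos u < 1 -> (forall y, `|p y| <= normc y) ->
  rint `]0, +oo[ (fun x => p (mfun z w x (s +i* u))) ->
  \int[mu]_(x in `]0, +oo[) `|p (mfun z w x (s +i* u))| <=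
    expR ((1 - z) * s) / (1 - expR s * cos u).
Proof.
move=> w0 u0 su pn ip.
have c0 : 0 < 1 - expR s * cos u by rewrite subr_gt0.
have [I E] := rint_expR_ray 0 c0.
have -> : expR ((1 - z) * s) / (1 - expR s * cos u) =
  \int[mu]_(x in `]0, +oo[) (expR ((1 - z) * s) * expR (- ((1 - expR s * cos u) * x))).
  by rewrite RintegralZl// E mulr0 oppr0 expR0 div1r.
apply: le_Rintegral => //; first exact: integrable_norm.
  exact: rintZ.
by move=> x _; apply: le_trans (pn _) _; exact: normc_mfun.
Qed.

Lemma cmeas_mfun z w (g : R * R -> R[i]) : cmeas g ->
  cmeas (fun p : R * R => mfun z w p.1 (g p)).
Proof.
move=> mg; apply: cmeasM; apply: cmeas_cexp.
  apply: cmeasN; apply: cmeasM; first by apply: cmeas_real; exact: measurable_fst.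
  by apply: cmeasD; [exact: cmeas_cst|apply: cmeasN; exact: cmeas_cexp].
apply: cmeasD; first by apply: cmeasM => //; exact: cmeas_cst.
apply: cmeasN; apply: cmeasM; first exact: cmeas_cst.
by apply: cmeas_cexp; apply: cmeasM => //; exact: cmeas_cst.
Qed.

Lemma ccont_mfun z w x (g : R -> R[i]) y : ccont g y -> ccont (fun t => mfun z w x (g t)) y.
Proof.
move=> cg; apply: ccontM; last exact: ccont_wfun.
apply: ccont_cexp; apply: ccontN; apply: ccontM; first exact: ccont_cst.
exact: cont_1Bcexp.
Qed.

Lemma cintable_mray z w x a : 0 <= w -> 0 < x ->
  cintable `]a, +oo[ (fun s => mfun z w x (s +i* theta)).
Proof.
move=> w0 x0; apply: (@cintable_ray_dominated (mfun z w x) (x * kappa) (1 - z)).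
- by rewrite mulr_gt0// kappa_gt0.
- by move=> s; apply: ccont_mfun; exact: ccont_hline.
- move=> s; apply: le_trans (normc_mfun z x s w0 theta_itv) _.
  rewrite -expRD ler_expR addrC lerD2r lerN2 /kappa mulrBl mul1r.
  have -> : x * - cos theta * expR s = - (expR s * cos theta * x) by ring.
  by rewrite lerDr ltW.
Qed.

Lemma cintable_mvert z w x a : 0 <= w -> 0 < x ->
  cintable `]0, theta[ (fun u => mfun z w x (a +i* u)).
Proof.
move=> w0 x0.
apply: (@cintable_dominated _ _ _ (fun=> expR ((1 - z) * a) * expR (expR a * x))) => //.
- by apply: ccont_measurable_oo => u _; apply: ccont_mfun; exact: ccont_vline.
- exact: rint_cst_oo.
- move=> u /set_itvoo /andP[/ltW u0 /ltW u1].
  apply: le_trans (normc_mfun z x a w0 _) _; first by rewrite u0.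
  rewrite ler_wpM2l ?expR_ge0// ler_expR -mulNr ler_wpM2r ?ltW//.
  have := cos_le1 u; have := expR_gt0 a; nra.
Qed.

(** At abscissa -1 the whole contour satisfies Re v < 1: on the arc |v| = 1 / e, on the ray cos
    theta < 0. So the x-integral of the modulus converges; it is bounded on the arc and O(e^(- z s))
    on the ray, where z > 0 makes it integrable, and Fubini applies to each piece. *)
Lemma hankel_gamma z w a : 0 < z -> 0 <= w ->
  \int[mu]_(x in `]0, +oo[)
    (x `^ (z - 1) * expR (- x) * hankel theta a (efun z (w * x `^ (- alpha)))) =
  pi * expR (- w).
Proof.
move=> z0 w0.
have k0 := kappa_gt0.
have pos (x : R) : `]0, +oo[%classic x -> 0 < x by rewrite /= in_itv /= andbT.
transitivity (\int[mu]_(x in `]0, +oo[) hankel theta (- 1) (mfun z w x)).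
  by apply: eq_Rintegral => x /set_mem /pos x0; exact: hankel_efun_scale.
have N1 : - 1 < 0 :> R by rewrite oppr_lt0.
rewrite -(hankel_qfun z0 w0 N1) /hankel.
have e1 : expR (- 1) < 1 :> R by rewrite expR_lt1.
have sm1 u : expR (- 1) * cos u < 1.
  by apply: le_lt_trans e1; rewrite ler_piMr ?expR_ge0 ?cos_le1.
have sm2 s : expR s * cos theta < 1.
  apply: lt_trans ltr01; rewrite -oppr_gt0 -mulrN mulr_gt0 ?expR_gt0//.
have i3 : rint `]- 1, +oo[ (fun s => kappa^-1 * expR (- (z * s))).
  by apply: rintZ; [exact: measurable_itv|exact: (rint_expR_ray _ z0).1].
have q1 (y : R) : Re (cexp (- 1 +i* y)) < 1 by rewrite Re_cexp.
have q2 (y : R) : Re (cexp (y +i* theta)) < 1 by rewrite Re_cexp.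
have [i1 E1] : rint `]0, +oo[ (fun x => \int[mu]_(u in `]0, theta[) Re (mfun z w x (- 1 +i* u))) /\
  \int[mu]_(x in `]0, +oo[) \int[mu]_(u in `]0, theta[) Re (mfun z w x (- 1 +i* u)) =
  \int[mu]_(u in `]0, theta[) \int[mu]_(x in `]0, +oo[) Re (mfun z w x (- 1 +i* u)).
  apply: (Fubini_dominated (f := fun x u => Re (mfun z w x (- 1 +i* u)))
    (g := fun=> expR ((1 - z) * - 1) / (1 - expR (- 1)))) => //.
  - have mg : cmeas (fun p : R * R => (- 1) +i* p.2).
      by split; [exact: measurable_cst|exact: measurable_snd].
    exact: (cmeas_mfun z w mg).1.
  - by move=> x /pos x0; exact: (cintable_mvert _ _ w0 x0).1.
  - by move=> u _; apply: (mfun_int _ _ _).1.1; rewrite Re_cexp.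
  - move=> u /set_itvoo /andP[/ltW u0 /ltW u1].
    have u01 : 0 <= u <= theta by rewrite u0.
    apply: le_trans (Rint_norm_mfun_le w0 u01 (sm1 u) (@normrRe R) _) _.
      exact: (mfun_int _ _ (q1 _)).1.1.
    rewrite ler_wpM2l ?expR_ge0// lef_pV2 ?posrE ?subr_gt0//.
    by rewrite lerD2l lerN2 ler_piMr ?expR_ge0// cos_le1.
  - exact: rint_cst_oo.
have [i2 E2] : rint `]0, +oo[ (fun x => \int[mu]_(s in `]- 1, +oo[) Im (mfun z w x (s +i* theta))) /\
  \int[mu]_(x in `]0, +oo[) \int[mu]_(s in `]- 1, +oo[) Im (mfun z w x (s +i* theta)) =
  \int[mu]_(s in `]- 1, +oo[) \int[mu]_(x in `]0, +oo[) Im (mfun z w x (s +i* theta)).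
  apply: (Fubini_dominated (f := fun x s => Im (mfun z w x (s +i* theta)))
    (g := fun s => kappa^-1 * expR (- (z * s)))).
  - exact: measurable_itv.
  - exact: measurable_itv.
  - have mg : cmeas (fun p : R * R => p.2 +i* theta).
      by split; [exact: measurable_snd|exact: measurable_cst].
    exact: (cmeas_mfun z w mg).2.
  - by move=> x /pos x0; exact: (cintable_mray _ _ w0 x0).2.
  - by move=> s _; apply: (mfun_int _ _ _).1.2; rewrite Re_cexp.
  - move=> s _.
    apply: le_trans (Rint_norm_mfun_le w0 theta_itv (sm2 s) (@normrIm R) _) _.
      exact: (mfun_int _ _ (q2 _)).1.2.
    have e0 := expR_gt0 s.
    have h0 : 0 < kappa * expR s by rewrite mulr_gt0.
    have -> : kappa^-1 * expR (- (z * s)) = expR ((1 - z) * s) * (kappa * expR s)^-1.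
      have -> : expR (- (z * s)) = expR ((1 - z) * s) * (expR s)^-1.
        by rewrite -expRN -expRD; congr expR; ring.
      by field; rewrite !gt_eqF.
    apply: ler_wpM2l; first exact: expR_ge0.
    have lee : kappa * expR s <= 1 - expR s * cos theta.
      have -> : expR s * cos theta = - (kappa * expR s) by rewrite /kappa mulNr opprK mulrC.
      by rewrite opprK lerDr ler01.
    exact: lerV2_pos h0 lee.
  - exact: i3.
rewrite (RintD (measurable_itv _) i1 i2) E1 E2; congr (_ + _); apply: eq_Rintegral => y _.
  by have [_ <-] := mfun_int z w (q1 y).
by have [_ <-] := mfun_int z w (q2 y).
Qed.

(** * Functional equation and power series of the Hankel integral *)

Definition hintable a f := rint `]0, theta[ (fun u => Re (f (a +i* u))) /\
  rint `]a, +oo[ (fun s => Im (f (s +i* theta))).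

Lemma hankelD a f g : hintable a f -> hintable a g ->
  hintable a (fun y => f y + g y) /\
  hankel theta a (fun y => f y + g y) = hankel theta a f + hankel theta a g.
Proof.
move=> [f1 f2] [g1 g2]; split.
  split; [apply: (eq_rint _ _ (rintD _ f1 g1))|apply: (eq_rint _ _ (rintD _ f2 g2))] => //;
    by move=> x _; rewrite ?ReD ?ImD.
rewrite /hankel [in RHS]addrACA -!RintD//.
by congr (_ + _); apply: eq_Rintegral => x _; rewrite ?ReD ?ImD.
Qed.

Lemma hankelZ a c f : hintable a f -> hintable a (fun y => c%:C * f y) /\
  hankel theta a (fun y => c%:C * f y) = c * hankel theta a f.
Proof.
move=> [f1 f2].
have e1 y : Re (c%:C * f y) = c * Re (f y) by rewrite ReM ImC mul0r subr0.
have e2 y : Im (c%:C * f y) = c * Im (f y) by rewrite ImM ImC mul0r addr0.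
split.
  by split; [apply: (eq_rint _ _ (rintZ c _ f1))|apply: (eq_rint _ _ (rintZ c _ f2))] => //;
    move=> x _; rewrite ?e1 ?e2.
rewrite /hankel mulrDr -!RintZ//.
by congr (_ + _); apply: eq_Rintegral => x _; rewrite ?e1 ?e2.
Qed.

Lemma hintable_dominated a f (C : R) (h : R -> R) :
  (forall u, ccont (fun u => f (a +i* u)) u) -> (forall s, ccont (fun s => f (s +i* theta)) s) ->
  (forall u, 0 < u < theta -> normc (f (a +i* u)) <= C) ->
  rint `]a, +oo[ h -> (forall s, a < s -> normc (f (s +i* theta)) <= h s) -> hintable a f.
Proof.
move=> c1 c2 b1 ih b2.
have [r1 _] : cintable `]0, theta[ (fun u => f (a +i* u)).
  apply: (@cintable_dominated _ _ _ (fun=> C)) => //.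
  - by apply: ccont_measurable_oo => u _.
  - exact: rint_cst_oo.
have [_ r2] : cintable `]a, +oo[ (fun s => f (s +i* theta)).
  apply: (@cintable_dominated _ _ _ h) => //.
  - by apply: ccont_measurable => [|s _]; [exact: interval_open|exact: c2].
  - by move=> s; rewrite /= in_itv/= andbT; exact: b2.
by split.
Qed.

Lemma normc_efun_vert z s u : normc (efun z 0 (s +i* u)) <= expR (expR s + (1 - z) * s).
Proof.
rewrite /efun normcM normc_cexp normc_wfun mul0r subr0 -expRD ler_expR lerD2r Re_cexp.
by rewrite ler_piMr ?expR_ge0// cos_le1.
Qed.

Lemma hintable_efun z a : hintable a (efun z 0).
Proof.
have k0 := kappa_gt0.
have [C C0 CE] := expR_expR_dominated (1 - z) a k0.
apply: (hintable_dominated (C := expR (expR a + (1 - z) * a)) (h := fun s => C * expR (- (1 * s)))).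
- by move=> u; apply: ccont_efun; exact: ccont_vline.
- by move=> s; apply: ccont_efun; exact: ccont_hline.
- by move=> u _; exact: normc_efun_vert.
- by apply: rintZ => //; exact: (rint_expR_ray _ ltr01).1.
- move=> s /ltW as0; apply: le_trans (normc_efun_ray _ _ (lexx 0)) _; exact: CE.
Qed.

Lemma efun0E z zeta : efun z 0 zeta = cexp (cexp zeta + (1 - z)%:C * zeta).
Proof. by rewrite /efun /wfun rmorph0 mul0r subr0 cexpD. Qed.

Lemma cderiv_efun0 z g x d : cderiv g x d ->
  cderiv (fun y => efun z 0 (g y)) x (d * (efun (z - 1) 0 (g x) + (1 - z)%:C * efun z 0 (g x))).
Proof.
move=> dg.
have -> : (fun y => efun z 0 (g y)) = (fun y => cexp (cexp (g y) + (1 - z)%:C * g y)).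
  by apply/funext => y; rewrite efun0E.
apply: cderiv_eq (cderiv_cexp (cderivD (cderiv_cexp dg) (cderivZ (1 - z)%:C dg))) _.
rewrite !efun0E.
have -> : (1 - (z - 1))%:C * g x = g x + (1 - z)%:C * g x.
  by rewrite -{2}[g x]mul1r -mulrDl -(rmorphD (real_complex R)) /=; congr (_%:C * _); ring.
by rewrite addrCA [cexp (g x + _)]cexpD; ring.
Qed.

Lemma cderiv_hline u s : cderiv (fun s => s +i* u) s 1.
Proof. by split; [exact: is_derive_id|exact: is_derive_cst]. Qed.

Lemma cderiv_vline s u : cderiv (fun u => s +i* u) u 'i.
Proof. by split; [exact: is_derive_cst|exact: is_derive_id]. Qed.

(** Integration by parts: efun (z - 1) 0 + (1 - z) * efun z 0 is the derivative of efun z 0. The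
    boundary term is real at the starting point, cancels at the corner and decays at infinity. For
    the Hankel integral this plays the part of 1 / Gamma (z - 1) = (z - 1) / Gamma z. *)
Lemma hankel_efun_rec z a :
  hankel theta a (efun (z - 1) 0) = (z - 1) * hankel theta a (efun z 0).
Proof.
pose f y := efun (z - 1) 0 y + (1 - z)%:C * efun z 0 y.
have cf (g : R -> R[i]) x : ccont g x -> ccont (fun y => f (g y)) x.
  move=> cg; apply: ccontD; first exact: ccont_efun.
  by apply: ccontM; [exact: ccont_cst|exact: ccont_efun].
have [h2 e2] := hankelZ (1 - z) (hintable_efun z a).
have [[h3 h4] e3] := hankelD (hintable_efun (z - 1) a) h2.
suff: hankel theta a f = 0 by rewrite e3 e2; lra.
have dv u := cderiv_efun0 z (cderiv_vline a u).
have dh s := cderiv_efun0 z (cderiv_hline theta s).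
rewrite /hankel.
have -> : \int[mu]_(u in `]0, theta[) Re (f (a +i* u)) =
    Im (efun z 0 (a +i* theta)) - Im (efun z 0 (a +i* 0)).
  apply: (FTC_oo theta_gt0 h3 (F := fun u => Im (efun z 0 (a +i* u)))).
  - by move=> u _; apply: (cf _ _ (ccont_vline _ _)).1.
  - move=> u _; apply: is_derive_ext (dv u).2 => //.
    by rewrite ImM Re_i Im_i mul0r add0r mul1r.
  - by apply: cvg_at_right_filter; exact: (cderiv_ccont (dv 0)).2.
  - by apply: cvg_at_left_filter; exact: (cderiv_ccont (dv theta)).2.
rewrite [Im (efun z 0 (a +i* 0))]Im_efun// subr0.
have -> : \int[mu]_(s in `]a, +oo[) Im (f (s +i* theta)) = 0 - Im (efun z 0 (a +i* theta)).
  apply: (FTC_oy h4 (F := fun s => Im (efun z 0 (s +i* theta)))).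
  - by move=> s _; apply: (cf _ _ (ccont_hline _ _)).2.
  - by move=> s _; apply: is_derive_ext (dh s).2 => //; rewrite mul1r.
  - by apply: cvg_at_right_filter; exact: (cderiv_ccont (dh a)).2.
  - have k0 := kappa_gt0; have [C C0 CE] := expR_expR_dominated (1 - z) a k0.
    apply/cvgr0Pnorm_le => e e0; near=> s.
    apply: le_trans (normrIm _) _; apply: le_trans (normc_efun_ray _ _ (lexx 0)) _.
    apply: le_trans (CE _ _) _ => //.
    have C1 : 0 < C + 1 by rewrite ltr_wpDl.
    apply: (@le_trans _ _ ((C + 1) * expR (- (1 * s)))).
      by rewrite ler_wpM2r ?expR_ge0// lerDl.
    rewrite mulrC -ler_pdivlMr// mul1r -[leRHS]lnK ?posrE ?divr_gt0// ler_expR lerNl//.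
by rewrite sub0r subrr.
Unshelve. all: by end_near. Qed.

Lemma alpha_lt1 : alpha < 1.
Proof.
have := lt_trans alpha_theta theta_gt; rewrite -[X in _ < X]mul1r.
by rewrite ltr_pM2r// theta_gt0.
Qed.

(** Since alpha < 1, e^(alpha s) is small against e^s: beyond S the first term suffices, up to S the
    constant does. *)
Lemma expR_sublinear t c : 0 <= t -> 0 < c ->
  exists2 C : R, 0 <= C & forall s, t * expR (alpha * s) <= c * expR s + C.
Proof.
move=> t0 c0; have a1 : 0 < 1 - alpha by rewrite subr_gt0 alpha_lt1.
have t1 : 0 < t + 1 by rewrite ltr_wpDl.
pose S := ln ((t + 1) / c) / (1 - alpha).
exists (t * expR (alpha * S)); first by rewrite mulr_ge0 ?expR_ge0.
move=> s; have [sS|Ss] := leP s S.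
  rewrite ler_wpDl ?mulr_ge0 ?expR_ge0 ?(ltW c0)// ler_wpM2l// ler_expR ler_wpM2l ?(ltW alpha_gt0)//.
rewrite ler_wpDr ?mulr_ge0 ?expR_ge0//.
have E : expR s = expR (alpha * s) * expR ((1 - alpha) * s) by rewrite -expRD; congr expR; ring.
rewrite E mulrCA mulrC ler_wpM2l ?expR_ge0//.
have h : (t + 1) / c <= expR ((1 - alpha) * s).
  rewrite -[leLHS]lnK ?posrE ?divr_gt0// ler_expR [(1 - alpha) * s]mulrC -ler_pdivrMr//; exact: ltW.
apply: (@le_trans _ _ (c * ((t + 1) / c))); last by rewrite ler_pM2l.
by rewrite mulrCA divff ?gt_eqF// mulr1 lerDl.
Qed.

Lemma efun_cexp z t zeta : efun z t zeta = efun z 0 zeta * cexp (- t%:C * cexp (alpha%:C * zeta)).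
Proof. by rewrite /efun /wfun -mulrA -[in RHS]cexpD rmorph0 mul0r subr0 mulNr. Qed.

(** Each factor u^alpha lowers z by alpha, so the expansion of e^(-t u^alpha) leads to reciprocal
    Gammas at z - alpha l. *)
Lemma efun_shift_param z l zeta :
  efun z 0 zeta * cexp (alpha%:C * zeta) ^+ l = efun (z - alpha * l%:R) 0 zeta.
Proof.
elim: l => [|l IH]; first by rewrite expr0 mulr1 mulr0 subr0.
rewrite exprSr mulrA IH !efun0E -cexpD -addrA; congr (cexp (_ + _)).
by rewrite -mulrDl -rmorphD/=; congr (_%:C * _); rewrite -natr1; ring.
Qed.

Definition epart z t N zeta := efun z 0 zeta * cexp_sum N (- t%:C * cexp (alpha%:C * zeta)).

Lemma hankel_epart z t N a : hintable a (epart z t N) /\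
  hankel theta a (epart z t N) =
  \sum_(l < N) (- t) ^+ l / l`!%:R * hankel theta a (efun (z - alpha * l%:R) 0).
Proof.
elim: N => [|N [IH1 IH2]].
  have E : epart z t 0 = fun y => 0%:C * efun z 0 y.
    by apply/funext => y; rewrite /epart /cexp_sum big_ord0 mulr0 mul0r.
  by have [H1 H2] := hankelZ 0 (hintable_efun z a); rewrite E H2 mul0r big_ord0.
have [H1 H2] := hankelZ ((- t) ^+ N / N`!%:R) (hintable_efun (z - alpha * N%:R) a).
have E : epart z t N.+1 = fun y => epart z t N y +
    ((- t) ^+ N / N`!%:R)%:C * efun (z - alpha * N%:R) 0 y.
  apply/funext => y; rewrite /epart cexp_sumS mulrDr; congr (_ + _).
  have -> : ((- t) ^+ N / N`!%:R)%:C = (- t%:C) ^+ N / N`!%:R :> R[i].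
    by rewrite rmorphM fmorphV rmorphXn rmorphN rmorph_nat.
  have E4 (x1 x2 x3 x4 : R[i]) : x1 * (x2 * x3 * x4) = x2 * x4 * (x1 * x3) by ring.
  by rewrite -efun_shift_param exprMn E4.
have [H3 H4] := hankelD IH1 H1.
by rewrite E; split => //; rewrite H4 IH2 H2 big_ord_recr.
Qed.

Lemma normc_epart_B z t N zeta : normc (epart z t N zeta - efun z t zeta) =
  normc (efun z 0 zeta) *
  normc (cexp (- t%:C * cexp (alpha%:C * zeta)) - cexp_sum N (- t%:C * cexp (alpha%:C * zeta))).
Proof. by rewrite efun_cexp /epart -mulrBr normcM normc_distrC. Qed.

Lemma epart_cvg z t zeta (p : R[i] -> R) : (forall x y, p (x - y) = p x - p y) ->
  (forall y, `|p y| <= normc y) ->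
  p (epart z t N zeta) @[N --> \oo] --> p (efun z t zeta).
Proof.
move=> pB pn; apply/subr_cvg0.
have lim : normc (efun z 0 zeta) * normc (cexp (- t%:C * cexp (alpha%:C * zeta)) -
    cexp_sum N (- t%:C * cexp (alpha%:C * zeta))) @[N --> \oo] --> (0 : R).
  by rewrite -[X in _ --> X](mulr0 (normc (efun z 0 zeta))); apply: cvgM; [exact: cvg_cst|exact: cexp_sum_cvg].
apply/norm_cvg0P; apply: (squeeze_cvgr _ (cvg_cst 0) lim).
near=> N; rewrite normr_ge0/= -pB; apply: le_trans (pn _) _.
by rewrite normc_epart_B.
Unshelve. all: by end_near. Qed.

Lemma normc_epart z t N s u : 0 <= t -> normc (epart z t N (s +i* u)) <=
  normc (efun z 0 (s +i* u)) * expR (t * expR (alpha * s)).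
Proof.
move=> t0; rewrite normcM ler_wpM2l ?normc_ge0//.
apply: le_trans (normc_cexp_sum _ _) _.
by rewrite ler_expR normcM normc_opp normcC ger0_norm// normc_cexp mulC_ri ReI.
Qed.

Lemma hankel_series z t : 0 <= t ->
  \sum_(l < N) (- t) ^+ l / l`!%:R * hankel theta 0 (efun (z - alpha * l%:R) 0)
    @[N --> \oo] --> hankel theta 0 (efun z t).
Proof.
move=> t0.
have -> : (fun N => \sum_(l < N) (- t) ^+ l / l`!%:R * hankel theta 0 (efun (z - alpha * l%:R) 0)) =
   fun N => hankel theta 0 (epart z t N) by apply/funext => N; rewrite (hankel_epart _ _ _ _).2.
(* Half of the decay rate absorbs the growth e^(t |u|^alpha) of the partial sums; the other half
   remains for integrability. *)
have k0 : 0 < kappa / 2 by rewrite divr_gt0// kappa_gt0.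
have [C C0 CE] := expR_sublinear t0 k0.
have [K K0 KE] := expR_expR_dominated (1 - z) 0 k0.
have me N := (hankel_epart z t N 0).1.
apply: cvgD.
  apply: (Rint_dominated_cvg (g := fun=> expR (expR 0 + (1 - z) * 0) * expR (t * expR (alpha * 0)))).
  - by [].
  - by move=> N; exact: rint_measurable (me N).1.
  - by apply: (ccont_measurable_oo _).1 => u _; apply: ccont_efun; exact: ccont_vline.
  - exact: rint_cst_oo.
  - move=> N u _; apply: le_trans (normrRe _) _.
    apply: le_trans (normc_epart _ _ _ _ t0) _.
    by rewrite ler_wpM2r ?expR_ge0//; exact: normc_efun_vert.
  - by move=> u _; apply: epart_cvg; [exact: ReB|exact: normrRe].
apply: (Rint_dominated_cvg (g := fun s => expR C * (K * expR (- (1 * s))))).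
- by [].
- by move=> N; exact: rint_measurable (me N).2.
- apply: (ccont_measurable _ _).2; first exact: interval_open.
  by move=> s _; apply: ccont_efun; exact: ccont_hline.
- by apply: rintZ => //; apply: rintZ => //; exact: (rint_expR_ray _ ltr01).1.
- move=> N s s0; apply: le_trans (normrIm _) _.
  apply: le_trans (normc_epart _ _ _ _ t0) _.
  apply: (@le_trans _ _ (expR (- (kappa * expR s) + (1 - z) * s) * expR (kappa / 2 * expR s + C))).
    by apply: ler_pM; rewrite ?normc_ge0 ?expR_ge0 ?ler_expR ?CE// normc_efun_ray.
  have -> : expR (- (kappa * expR s) + (1 - z) * s) * expR (kappa / 2 * expR s + C) =
    expR C * expR (- (kappa / 2 * expR s) + (1 - z) * s).
    by rewrite -!expRD; congr expR; field.
  rewrite ler_wpM2l ?expR_ge0//; apply: KE; apply: ltW.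
  by move: s0; rewrite /= in_itv/= andbT.
- by move=> s _; apply: epart_cvg; [exact: ImB|exact: normrIm].
Qed.

End contour_functions.

(** * Euler's integral *)

Section gamma_weight.
Context {R : realType}.
Implicit Types (a x y : R).

(** x^(a - 1) e^(-x) for x > 0, as a single exponential so that changing a is adding exponents. *)
Definition gam a x : R := expR ((a - 1) * ln x - x).

Lemma is_derive_expR_comp (h : R -> R) x l : is_derive x 1 h l ->
  is_derive x 1 (fun t => expR (h t)) (l * expR (h x)).
Proof.
move=> dh; apply: is_derive_ext (@is_derive1_comp _ expR h x _ _ (is_derive_expR _) dh) => //.
by rewrite mulrC.
Qed.

Lemma is_derive_ln x : 0 < x -> is_derive x 1 (@ln R) x^-1.
Proof. exact: is_derive1_ln. Qed.

Lemma is_derive_lnZ a x : 0 < x -> is_derive x 1 (fun t => a * ln t) (a * x^-1).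
Proof. by move=> x0; apply: is_derive_ext (is_deriveZ a (is_derive_ln x0)). Qed.

Lemma is_derive_inv (h : R -> R) x l : h x != 0 -> is_derive x 1 h l ->
  is_derive x 1 (fun t => (h t)^-1) (- l / h x ^+ 2).
Proof.
move=> hx dh; apply: is_derive_ext (is_deriveV hx dh) => //.
by rewrite /GRing.scale /= !mulNr mulrC.
Qed.

Lemma is_derive_gam a x : 0 < x -> is_derive x 1 (fun t => (a - 1) * ln t - t) ((a - 1) * x^-1 - 1).
Proof. by move=> x0; apply: is_deriveB; exact: is_derive_lnZ. Qed.

Lemma cont_gam a x : 0 < x -> {for x, continuous (gam a)}.
Proof. by move=> x0; exact: is_derive_cont (is_derive_expR_comp (is_derive_gam a x0)). Qed.

Lemma gam_gt0 a x : 0 < gam a x. Proof. exact: expR_gt0. Qed.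

Lemma measurable_gam a : measurable_fun (`]0, +oo[ : set R) (gam a).
Proof.
apply: open_continuous_measurable_fun; first exact: interval_open.
by move=> x /set_mem; rewrite /= in_itv/= andbT => x0; exact: cont_gam.
Qed.

(** The integral over [1 / (n + 1), n + 2] is an increment of F, hence at most M, and f >= 0 allows
    passing to the limit. *)
Lemma rint_derive_bounded (f F : R -> R) (M : R) :
  (forall x, 0 < x -> 0 <= f x /\ {for x, continuous f}) ->
  (forall x, 0 < x -> is_derive x 1 F (f x)) -> (forall x, 0 < x -> 0 <= F x <= M) ->
  rint `]0, +oo[ f.
Proof.
move=> f0 dF FM.
have mf : measurable_fun (`]0, +oo[ : set R) f.
  apply: open_continuous_measurable_fun; first exact: interval_open.
  by move=> x /set_mem; rewrite /= in_itv/= andbT => /f0[].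
pose D n : set R := `[n.+1%:R^-1, n.+2%:R]%classic.
have a0 n : 0 < n.+1%:R^-1 :> R by rewrite invr_gt0.
have DP n x : D n x -> 0 < x by rewrite /D/= in_itv/= => /andP[/(lt_le_trans (a0 n))].
have UD : \bigcup_n D n = `]0, +oo[%classic.
  apply/seteqP; split => x; first by move=> [n _ /DP x0]; rewrite /= in_itv/= andbT.
  rewrite /= in_itv/= andbT => x0.
  have [n xn] : exists n, Num.max x x^-1 <= n%:R.
    by exists (Num.truncn (Num.max x x^-1)).+1; apply: ltW; exact: truncnS_gt.
  move: xn; rewrite ge_max => /andP[n1 n2].
  exists n => //; rewrite /D/= in_itv/=; apply/andP; split.
    rewrite invf_ple ?posrE//; apply: le_trans n2 _; by rewrite ler_nat.
  by apply: le_trans n1 _; rewrite ler_nat -addn2 leq_addr.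
have ab n : n.+1%:R^-1 < n.+2%:R :> R.
  by apply: (@le_lt_trans _ _ 1); [rewrite invf_le1// ler1n|rewrite ltr1n].
have cD n : {within `[n.+1%:R^-1, n.+2%:R], continuous f}.
  by apply: continuous_at_within => x /(DP n) /f0[].
apply: (@rint_exhaust_bounded _ _ D _ M) => //.
- by move=> x; rewrite /= in_itv/= andbT => /f0[].
- apply/nondecreasing_seqP => n; rewrite subsetEset => x; rewrite /D/= !in_itv/=.
  move=> /andP[h1 h2]; apply/andP; split.
    by apply: le_trans h1; rewrite lef_pV2 ?posrE// ler_nat.
  by apply: le_trans h2 _; rewrite ler_nat.
- by move=> n; exact: measurable_itv.
move=> n; split; first exact: rint_continuous_cc.
have -> : \int[mu]_(x in D n) f x = F n.+2%:R - F n.+1%:R^-1.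
  apply: (FTC_cc (ab n) (cD n)).
    by apply: continuous_at_within => x /(DP n) /dF; exact: is_derive_cont.
  by move=> x /andP[/(lt_trans (a0 n)) x0 _]; exact: dF.
have /andP[_] := FM _ (ltr0Sn R n.+1); have /andP[+ _] := FM _ (a0 n); lra.
Qed.

(** The integrand is the derivative of 1 - 1 / (1 + x^a). It behaves like x^(a - 1) at 0 and decays
    like a power at infinity, so one comparison covers both ends of Euler's integral. *)
Lemma rint_rational_weight a : 0 < a ->
  rint `]0, +oo[ (fun x => a * expR ((a - 1) * ln x) / (1 + expR (a * ln x)) ^+ 2).
Proof.
move=> a0; apply: (rint_derive_bounded (F := fun x => - (1 + expR (a * ln x))^-1 + 1) (M := 1)).
- move=> x x0; have e0 := expR_gt0 (a * ln x); split.
    by rewrite divr_ge0 ?sqr_ge0// mulr_ge0 ?expR_ge0// ltW.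
  have d1 := is_derive_cont (is_derive_expR_comp (is_derive_lnZ (a - 1) x0)).
  have d2 := is_derive_cont (is_derive_expR_comp (is_derive_lnZ a x0)).
  apply: (@continuousM _ _ (fun x => a * expR ((a - 1) * ln x)) (fun x => ((1 + expR (a * ln x)) ^+ 2)^-1)).
    by apply: (@continuousM _ _ (fun=> a)) => //; exact: cst_continuous.
  apply: continuousV; first by rewrite sqrf_eq0 gt_eqF// ltr_wpDl.
  by apply: cont_sqr; apply: cvgD; [exact: cvg_cst|exact: d2].
- move=> x x0; have e0 := expR_gt0 (a * ln x).
  have n0 : 1 + expR (a * ln x) != 0 by rewrite gt_eqF// ltr_wpDl.
  have d2 := is_deriveD (is_derive_cst (1 : R) x 1) (is_derive_expR_comp (is_derive_lnZ a x0)).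
  have d3 := @is_derive_inv (fun t => 1 + expR (a * ln t)) x _ n0 d2.
  apply: is_derive_ext (is_deriveD (is_deriveN d3) (is_derive_cst (1 : R) x 1)) => //.
  rewrite addr0 add0r mulNr opprK; congr (_ / _); rewrite -mulrA; congr (_ * _).
  have -> : (a - 1) * ln x = a * ln x - ln x by ring.
  by rewrite expRD expRN lnK ?posrE// mulrC.
- move=> x x0; have e0 := expR_gt0 (a * ln x).
  have i0 : 0 < (1 + expR (a * ln x))^-1 by rewrite invr_gt0 ltr_wpDl.
  have i1 : (1 + expR (a * ln x))^-1 <= 1 by rewrite invf_le1 ?lerDl ?ltW// ltr_wpDl.
  by apply/andP; split; lra.
Qed.

Lemma ln_le_affine c x : 0 < c -> 0 < x -> ln x <= c * x - 1 - ln c.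
Proof.
move=> c0 x0; have cx : 0 < c * x by rewrite mulr_gt0.
have := @le_ln1Dx R (c * x - 1); rewrite addrCA subrr addr0 lnM ?posrE//.
by rewrite ltrBrDl subrr => /(_ cx); lra.
Qed.

(** The tangent bound ln x <= c x - 1 - ln c with slope c = 1 / (2 a) lets a ln x consume exactly
    half of the decay. *)
Lemma ln_decay a : 0 < a -> exists2 C : R, 0 < C & forall x, 0 < x ->
  expR (a * ln x - x) <= C * expR (- (2^-1 * x)).
Proof.
move=> a0; pose c := (2 * a)^-1; have c0 : 0 < c by rewrite invr_gt0 mulr_gt0.
exists (expR (a * (- 1 - ln c))); first exact: expR_gt0.
move=> x x0; rewrite -expRD ler_expR.
have := ln_le_affine c0 x0; rewrite -(ler_pM2l a0).
have -> : a * (c * x - 1 - ln c) = 2^-1 * x + a * (- 1 - ln c) by rewrite /c; field; rewrite gt_eqF.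
lra.
Qed.

Lemma rint_gam a : 0 < a -> rint `]0, +oo[ (gam a).
Proof.
move=> a0; have [C C0 CE] := ln_decay a0.
have [D D0 DE] := ln_decay (mulr_gt0 (ltr0n R 2) a0 : 0 < 2 * a).
(* 1, C and D bound e^(-x), x^a e^(-x) and x^(2 a) e^(-x), the terms of e^(-x) (1 + x^a)^2. *)
pose K := a^-1 * (1 + 2 * C + D).
apply: (rint_dominated (g := fun x => K * (a * expR ((a - 1) * ln x) / (1 + expR (a * ln x)) ^+ 2))) => //.
- exact: measurable_gam.
- by apply: rintZ => //; exact: rint_rational_weight.
move=> x; rewrite /= in_itv/= andbT => x0; rewrite ger0_norm ?expR_ge0//.
rewrite /gam expRD.
set e := expR (a * ln x); have e0 : 0 < e by exact: expR_gt0.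
set m := expR ((a - 1) * ln x); have m0 : 0 < m by exact: expR_gt0.
have s0 : 0 < (1 + e) ^+ 2 by rewrite exprn_gt0// ltr_wpDl.
have -> : K * (a * m / (1 + e) ^+ 2) = m * ((1 + 2 * C + D) / (1 + e) ^+ 2).
  by rewrite /K; field; rewrite !gt_eqF// ltr_wpDl.
rewrite ler_pM2l// ler_pdivlMr//.
have h1 : expR (- (2^-1 * x)) <= 1 by rewrite expR_le1 oppr_le0 mulr_ge0// ltW.
have h2 : expR (- x) <= 1 by rewrite expR_le1 oppr_le0 ltW.
have h3 : expR (- x) * e <= C.
  rewrite mulrC -expRD; apply: le_trans (CE x x0) _; by rewrite ler_piMr// ltW.
have h4 : expR (- x) * e ^+ 2 <= D.
  have -> : e ^+ 2 = expR (2 * a * ln x) by rewrite /e -expRM_natl; congr expR; ring.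
  rewrite mulrC -expRD; apply: le_trans (DE x x0) _; by rewrite ler_piMr// ltW.
by rewrite (_ : expR (- x) * (1 + e) ^+ 2 = expR (- x) + 2 * (expR (- x) * e) + expR (- x) * e ^+ 2); [lra|ring].
Qed.

End gamma_weight.

(** * Functional equation, bounds and holomorphy of Euler's integral *)

Section euler_gamma.
Context {R : realType}.
Implicit Types (a x y : R) (z w s : R[i]).

Definition gfun z x : R[i] := cexp ((z - 1) * (ln x)%:C - x%:C).

Lemma gfunE z x : cpow x (z - 1) * (expR (- x))%:C = gfun z x.
Proof. by rewrite /cpow /gfun cexpD -cexpC rmorphN. Qed.

Lemma euler_GammaE z : euler_Gamma z = cintegral `]0, +oo[ (gfun z).
Proof. by apply: eq_cintegral => x _; rewrite gfunE. Qed.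

Lemma normc_gfun z x : normc (gfun z x) = gam (Re z) x.
Proof.
by rewrite normc_cexp ReB ReC ReM ImC mulr0 subr0 ReC ReB Re1.
Qed.

Lemma cderiv_ln x : 0 < x -> cderiv (fun t => (ln t)%:C) x (x^-1)%:C.
Proof. by move=> x0; split; [exact: is_derive_ln|exact: is_derive_cst]. Qed.

Lemma cderiv_gexp z x : 0 < x ->
  cderiv (fun t => z * (ln t)%:C - t%:C) x (z * (x^-1)%:C - 1).
Proof. by move=> x0; exact: cderivB (cderivZ z (cderiv_ln x0)) (cderiv_id x). Qed.

Lemma ccont_gfun z x : 0 < x -> ccont (gfun z) x.
Proof. by move=> x0; exact: cderiv_ccont (cderiv_cexp (cderiv_gexp (z - 1) x0)). Qed.

Lemma itv0y x : `]0, +oo[%classic x -> 0 < x.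
Proof. by rewrite /= in_itv/= andbT. Qed.

Lemma cmeasurable_gfun z : cmeasurable `]0, +oo[ (gfun z).
Proof.
by apply: ccont_measurable => [|x /itv0y]; [exact: interval_open|exact: ccont_gfun].
Qed.

Lemma cintable_gfun z : 0 < Re z -> cintable `]0, +oo[ (gfun z).
Proof.
move=> z0; apply: (@cintable_dominated _ _ _ (gam (Re z))) => //.
- exact: cmeasurable_gfun.
- exact: rint_gam.
- by move=> x _; rewrite normc_gfun.
Qed.

Lemma gfun_pred z x : 0 < x -> gfun z x = (x^-1)%:C * gfun (z + 1) x.
Proof.
move=> x0; rewrite /gfun; have -> : (x^-1)%:C = cexp (- (ln x)%:C) :> R[i].
  by rewrite -rmorphN cexpC expRN lnK// posrE.
by rewrite -cexpD; congr cexp; rewrite addrK mulrBl mul1r; ring.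
Qed.

Lemma gfun_lim0 z (p : R[i] -> R) : 0 < Re z -> (forall w, `|p w| <= normc w) ->
  p (gfun (z + 1) x) @[x --> 0^'+] --> (0 : R).
Proof.
move=> z0 pn; apply/cvgr0Pnorm_le => e e0.
have d0 : 0 < expR (ln e / Re z) by exact: expR_gt0.
near=> x; have x0 : 0 < x by near: x; exact: nbhs_right_gt.
apply: le_trans (pn _) _; rewrite normc_gfun ReD Re1.
rewrite -[leRHS]lnK ?posrE// ler_expR addrK.
have xd : ln x <= ln e / Re z.
  rewrite -[leRHS]expRK ler_ln ?posrE//; near: x; exact: nbhs_right_le.
by move: xd; rewrite ler_pdivlMr// mulrC; lra.
Unshelve. all: by end_near. Qed.

Lemma gfun_limy z (p : R[i] -> R) : 0 < Re z -> (forall w, `|p w| <= normc w) ->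
  p (gfun (z + 1) x) @[x --> +oo] --> (0 : R).
Proof.
move=> z0 pn; have [C C0 CE] := ln_decay z0.
apply/cvgr0Pnorm_le => e e0; near=> x.
have x0 : 0 < x by near: x; exact: nbhs_pinfty_gt.
apply: le_trans (pn _) _; rewrite normc_gfun ReD Re1 /gam addrK.
apply: le_trans (CE _ x0) _; rewrite mulrC -ler_pdivlMr//.
rewrite -[leRHS]lnK ?posrE ?divr_gt0// ler_expR lerNl -ler_pdivrMl ?invr_gt0//.
Unshelve. all: by end_near. Qed.

Lemma euler_GammaS z : 0 < Re z -> euler_Gamma (z + 1) = z * euler_Gamma z.
Proof.
move=> z0; have z1 : 0 < Re (z + 1) by rewrite ReD Re1 addr_gt0.
have i0 := cintable_gfun z0; have i1 := cintable_gfun z1.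
have iz := cintableZ z (measurable_itv _) i0.
have id := cintableB (measurable_itv _) iz i1.
suff E : cintegral `]0, +oo[ (fun x => z * gfun z x - gfun (z + 1) x) = 0.
  apply/eqP; rewrite eq_sym -subr_eq0 !euler_GammaE -cintegralZ// -cintegralB//.
  exact/eqP.
have dF x : 0 < x -> cderiv (gfun (z + 1)) x (z * gfun z x - gfun (z + 1) x).
  move=> x0; apply: cderiv_eq (cderiv_cexp (cderiv_gexp (z + 1 - 1) x0)) _.
  by rewrite -/(gfun (z + 1) x) addrK mulrBl mul1r -mulrA -gfun_pred.
have cf x : 0 < x -> ccont (fun x => z * gfun z x - gfun (z + 1) x) x.
  move=> x0; apply: ccontD; first by apply: ccontM; [exact: ccont_cst|exact: ccont_gfun].
  by apply: ccontN; exact: ccont_gfun.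
apply: complexP; rewrite /cintegral ?(ReI, ImI) -[RHS](subrr 0).
  apply: (FTC_oy id.1 (F := fun x => Re (gfun (z + 1) x))).
  - by move=> x x0; exact: (cf x x0).1.
  - by move=> x x0; exact: (dF x x0).1.
  - by apply: gfun_lim0 => //; exact: normrRe.
  - by apply: gfun_limy => //; exact: normrRe.
apply: (FTC_oy id.2 (F := fun x => Im (gfun (z + 1) x))).
- by move=> x x0; exact: (cf x x0).2.
- by move=> x x0; exact: (dF x x0).2.
- by apply: gfun_lim0 => //; exact: normrIm.
- by apply: gfun_limy => //; exact: normrIm.
Qed.

Definition rising z n := \prod_(k < n) (z + k%:R).

Lemma risingS z n : rising z n.+1 = rising z n * (z + n%:R).
Proof. by rewrite /rising big_ord_recr. Qed.

Lemma rising_add z m n : rising z (m + n)%N = rising z m * rising (z + m%:R) n.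
Proof.
elim: n => [|n IH]; first by rewrite addn0 /rising [X in _ = _ * X]big_ord0 mulr1.
by rewrite addnS !risingS IH natrD mulrA addrA.
Qed.

Lemma euler_Gamma_add z n : 0 < Re z -> euler_Gamma (z + n%:R) = rising z n * euler_Gamma z.
Proof.
move=> z0; elim: n => [|n IH]; first by rewrite addr0 /rising big_ord0 mul1r.
rewrite -natr1 addrA euler_GammaS; last by rewrite ReD Renat ltr_wpDr.
by rewrite IH risingS mulrA [(z + _) * _]mulrC.
Qed.

Lemma rising_neq0 z n : 0 < Re z -> rising z n != 0.
Proof.
move=> z0; elim: n => [|n IH]; first by rewrite /rising big_ord0 oner_neq0.
rewrite risingS mulf_neq0//; apply/eqP => /(congr1 (@complex.Re R)).
by rewrite ReD Renat Re0 => /eqP; rewrite gt_eqF// ltr_wpDr.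
Qed.

(** Two admissible numbers of shifts differ by the factor rising (z + m) k, which has no zero and is
    cancelled by the functional equation. The factor rising z m is never cancelled, so the identity
    also holds, as 0 = 0, at the poles. *)
Lemma Gamma_shift z n : 0 < Re z + n%:R -> Gamma z = euler_Gamma (z + n%:R) / rising z n.
Proof.
have aux m k : 0 < Re z + m%:R ->
    euler_Gamma (z + (m + k)%N%:R) / rising z (m + k)%N = euler_Gamma (z + m%:R) / rising z m.
  move=> zm; have zm' : 0 < Re (z + m%:R) by rewrite ReD Renat.
  rewrite rising_add natrD addrA (euler_Gamma_add k zm') invfM [rising _ _ * _]mulrC -mulrA.
  by rewrite [rising (z + m%:R) k * _]mulrCA mulfV ?rising_neq0// mulr1.
move=> zn; rewrite /Gamma -/(rising _ _); set m := `|_|%N.+1.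
have zm : 0 < Re z + m%:R.
  have := floor_le (Re z); have : - (m%:R : R) < (Num.floor (Re z))%:~R.
    rewrite /m ltrNl -mulrNz; apply: le_lt_trans (_ : (`|Num.floor (Re z)|%N)%:R < _).
      by rewrite natr_absz ler_int -normrN ler_norm.
    by rewrite ltr_nat.
  by lra.
have [mn|nm] := leqP m n; first by rewrite -(subnKC mn) aux.
by rewrite -(subnKC (ltnW nm)) aux.
Qed.

Lemma Gamma_euler z : 0 < Re z -> Gamma z = euler_Gamma z.
Proof. by move=> z0; rewrite (@Gamma_shift z 0) ?addr0// /rising big_ord0 divr1. Qed.

Definition rgamma a : R := \int[mu]_(x in `]0, +oo[) gam a x.

Lemma gfun_real a x : gfun a%:C x = (gam a x)%:C.
Proof.
rewrite /gfun /gam -cexpC; congr cexp.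
by rewrite rmorphB rmorphM rmorphB rmorph1.
Qed.

Lemma euler_Gamma_real a : euler_Gamma a%:C = (rgamma a)%:C.
Proof.
rewrite euler_GammaE; apply: complexP; rewrite /cintegral ?(ReI, ImI).
  by apply: eq_Rintegral => x _; rewrite gfun_real.
rewrite -[RHS](Im0cintegral (D := `]0, +oo[) (f := gfun a%:C))//.
by move=> x _; rewrite gfun_real.
Qed.

Lemma rgammaS a : 0 < a -> rgamma (a + 1) = a * rgamma a.
Proof.
move=> a0; have := @euler_GammaS a%:C a0.
by rewrite -(rmorph1 (real_complex R)) -rmorphD !euler_Gamma_real -rmorphM => /complexI.
Qed.

Lemma rgamma1 : rgamma 1 = 1.
Proof.
have [_ E] := @rint_expR_ray R 0 1 ltr01.
rewrite mulr0 oppr0 expR0 divr1 in E; rewrite -[RHS]E.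
by apply: eq_Rintegral => x _; rewrite /gam subrr mul0r sub0r mul1r.
Qed.

Lemma rgamma_nat n : rgamma n.+1%:R = n`!%:R.
Proof.
elim: n => [|n IH]; first by rewrite rgamma1.
by rewrite -natr1 rgammaS// IH factS natrM.
Qed.

(** On ]1, 2[ the integrand is at least e^(-2), whatever a >= 1. *)
Lemma rgamma_lower a : 1 <= a -> expR (- 2) <= rgamma a.
Proof.
move=> a1; have a0 : 0 < a by apply: lt_le_trans a1.
have i1 := rint_gam a0.
have i2 : rint `]1, +oo[ (gam a).
  by apply: integrableS i1 => //; apply: subset_itvr; rewrite bnd_simp.
have g0 (D : set R) : 0 <= \int[mu]_(x in D) gam a x by apply: Rintegral_ge0 => x _; exact: expR_ge0.
rewrite /rgamma (Rint_split_oy i1 ler01) (Rint_split_oy i2 (_ : 1 <= 2)) ?ler1n//.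
have i3 : rint `]1, 2[ (gam a).
  by apply: integrableS i2 => //; apply: subset_itvl; rewrite bnd_simp.
have E : expR (- 2) = \int[mu]_(x in `]1, 2[) expR (- 2) :> R.
  by rewrite Rint_cst_oo ?ler1n//; ring.
have h : expR (- 2) <= \int[mu]_(x in `]1, 2[) gam a x.
  rewrite {1}E; apply: le_Rintegral => //; first exact: rint_cst_oo.
  move=> x /set_itvoo /andP[x1 x2]; rewrite /gam ler_expR.
  have : 0 <= (a - 1) * ln x by rewrite mulr_ge0 ?subr_ge0// ln_ge0// ltW.
  by lra.
by apply: le_trans h _; apply: ler_wpDl; [exact: g0|apply: ler_wpDr; [exact: g0|]].
Qed.

Lemma rgamma_gt0 a : 0 < a -> 0 < rgamma a.
Proof.
move=> a0; have a1 : 1 <= a + 1 by rewrite lerDr ltW.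
have := lt_le_trans (expR_gt0 (- 2)) (rgamma_lower a1).
by rewrite rgammaS// pmulr_rgt0.
Qed.

Lemma normc_euler_Gamma_le z : 1 <= Re z <= 2 ->
  normc (euler_Gamma z) <= 2 * (rgamma 1 + rgamma 2).
Proof.
move=> /andP[z1 z2]; have z0 : 0 < Re z by apply: lt_le_trans z1.
have i1 := rint_gam (ltr01 : 0 < 1 :> R); have i2 := rint_gam (ltr0n R 2).
rewrite euler_GammaE /rgamma -RintD//.
apply: le_normc_cintegral => //; [exact: cintable_gfun|exact: rintD|].
move=> x /itv0y x0; rewrite normc_gfun.
have [l0|l0] := leP 0 (ln x).
  apply: ler_wpDl; first exact: expR_ge0.
  by rewrite /gam ler_expR lerD2r ler_wpM2r// lerD2r.
apply: ler_wpDr; first exact: expR_ge0.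
by rewrite /gam ler_expR lerD2r ler_wnM2r ?lerD2r// ltW.
Qed.

Lemma gamS a x : 0 < x -> gam (a + 1) x = x * gam a x.
Proof.
move=> x0; have -> : x * gam a x = expR (ln x) * gam a x by rewrite lnK ?posrE.
by rewrite /gam -expRD; congr expR; ring.
Qed.

Lemma sinh_ge x : 0 <= x -> 2 * x <= expR x - expR (- x).
Proof.
rewrite le_eqVlt => /predU1P[<-|x0]; first by rewrite mulr0 oppr0 subrr.
pose h (t : R) := expR t - expR (- t) - 2 * t.
pose dh (t : R) := 1 * expR t - - 1 * expR (- t) - 2 * 1.
have hd (t : R) : is_derive t 1 h (dh t).
  apply: is_deriveB.
    apply: is_deriveB; first exact: (is_derive_expR_comp (is_derive_id t 1)).
    exact: (is_derive_expR_comp (is_deriveN (is_derive_id t 1))).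
have [c _] := MVT x0 (fun t _ => hd t)
    (continuous_at_within (fun t _ => is_derive_cont (hd t))).
rewrite /h !(oppr0, mulr0, subrr, subr0) => E.
rewrite -subr_ge0 E ?addr0 mulr_ge0 ?(ltW x0)// /dh.
have -> : 1 * expR c - - 1 * expR (- c) - 2 * 1 = (expR (c / 2) - expR (- (c / 2))) ^+ 2.
  have -> : expR c = expR (c / 2) ^+ 2 by rewrite -expRM_natl; congr expR; field.
  have -> : expR (- c) = expR (- (c / 2)) ^+ 2 by rewrite -expRM_natl; congr expR; field.
  have : expR (c / 2) * expR (- (c / 2)) = 1 by rewrite -expRD subrr expR0.
  by move: (expR _) (expR _) => p q pq; rewrite sqrrB pq; ring.
exact: sqr_ge0.
Qed.

(** The right-hand side is the square of 2 sinh (x / 2), which is at least x for x >= 0. *)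
Lemma sqr_le_cosh x : x ^+ 2 <= expR x - 2 + expR (- x).
Proof.
wlog x0 : x / 0 <= x => [h|].
  have [|xn] := leP 0 x; first exact: h.
  by have := h (- x); rewrite oppr_ge0 sqrrN opprK => /(_ (ltW xn)); lra.
have y0 : 0 <= x / 2 by rewrite divr_ge0.
have := sinh_ge y0; rewrite (_ : 2 * (x / 2) = x); last by field.
have -> : expR x = expR (x / 2) ^+ 2 by rewrite -expRM_natl; congr expR; field.
have -> : expR (- x) = expR (- (x / 2)) ^+ 2 by rewrite -expRM_natl; congr expR; field.
have : expR (x / 2) * expR (- (x / 2)) = 1 by rewrite -expRD subrr expR0.
move: (expR _) (expR _) => q p pq h.
have -> : p ^+ 2 - 2 + q ^+ 2 = (p - q) ^+ 2 by rewrite sqrrB pq; ring.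
by rewrite lerXn2r// nnegrE//; lra.
Qed.

(* rotating by x^(-i y), the integrand becomes v^(x-1) e^(-v) cos (y ln (v / x)) and concentrates near v = x *)
Lemma normc_euler_Gamma_ge x y : 1 < x -> 1 + y ^+ 2 <= x ->
  rgamma x / 2 <= normc (euler_Gamma (x +i* y)).
Proof.
move=> x2 y1; have x0 : 0 < x by apply: lt_trans x2.
have x1 : 0 < x - 1 by rewrite subr_gt0.
set q := y ^+ 2 in y1; have q0 : 0 <= q by exact: sqr_ge0.
have iz := @cintable_gfun (x +i* y) x0.
pose c : R[i] := cexp (0 +i* (- (y * ln x))).
have nc : normc c = 1 by rewrite normc_cexp expR0.
have -> : normc (euler_Gamma (x +i* y)) = normc (c * euler_Gamma (x +i* y)).
  by rewrite normcM nc mul1r.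
rewrite euler_GammaE -cintegralZ//.
apply: le_trans (normrRe _); apply: le_trans (ler_norm _).
have i0 := rint_gam x0; have i1 := rint_gam x1; have i2 := rint_gam (addr_gt0 x0 ltr01).
(* cos b >= 1 - b^2 / 2 and [sqr_le_cosh] leave a combination of the weights at x, x + 1 and x - 1.
   With q = y^2 its integral is (x - 1 - q / 2) Gamma (x - 1), at least Gamma x / 2 because q <= x -
   1. *)
pose k v := (1 + q) * gam x v - q / (2 * x) * gam (x + 1) v - q * x / 2 * gam (x - 1) v.
have ik : rint `]0, +oo[ k by apply: rintB => //; [apply: rintB => //; exact: rintZ|exact: rintZ].
have E : rgamma x / 2 <= \int[mu]_(v in `]0, +oo[) k v.
  have j0 := rintZ (1 + q) (measurable_itv _) i0; have j1 := rintZ (q * x / 2) (measurable_itv _) i1.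
  have j2 := rintZ (q / (2 * x)) (measurable_itv _) i2.
  rewrite (RintB _ (rintB _ j0 j2) j1)// (RintB _ j0 j2)// !RintZ// -!/(rgamma _).
  have e1 : rgamma x = (x - 1) * rgamma (x - 1) by rewrite -rgammaS// subrK.
  rewrite rgammaS// e1.
  have := rgamma_gt0 x1; move: (rgamma _) => g g0.
  rewrite (_ : _ - q * x / 2 * g = ((1 + q) * (x - 1) - q / 2 * (x - 1) - q * x / 2) * g);
    last by field; rewrite gt_eqF.
  by rewrite mulrAC ler_pM2r//; lra.
suff kE (v : R) : 0 < v -> k v <= Re (c * gfun (x +i* y) v).
  apply: le_trans E _; rewrite /cintegral ReI; apply: le_Rintegral => //.
    exact: (cintableZ c (measurable_itv _) iz).1.
  by move=> v /itv0y; exact: kE.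
move=> v0.
have -> : c * gfun (x +i* y) v = cexp (((x - 1) * ln v - v) +i* (y * (ln v - ln x))).
  rewrite /c /gfun -cexpD; congr cexp; apply: complexP.
    by rewrite [RHS]ReI !cRI; ring.
  by rewrite [RHS]ImI !cRI; ring.
rewrite Re_cexp -/(gam x v).
set b := y * _.
have vx : ln v - ln x = ln (v / x) by rewrite lnM ?posrE ?invr_gt0// lnV ?posrE.
have b2 : b ^+ 2 <= q * (v / x - 2 + x / v).
  have := sqr_le_cosh (ln v - ln x); rewrite opprB !expRB !lnK ?posrE//.
  by rewrite /b exprMn -/q; exact: ler_wpM2l.
have g1 := gamS x v0.
have g2 : gam x v = v * gam (x - 1) v by rewrite -gamS// subrK.
have := cos_ge1B b; rewrite /k g1 g2.
have := gam_gt0 (x - 1) v; move: (gam _ _) => g g0 cb.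
have -> : (1 + q) * (v * g) - q / (2 * x) * (v * (v * g)) - q * x / 2 * g =
    v * g * (1 - q * (v / x - 2 + x / v) / 2).
  by field; rewrite !gt_eqF.
by rewrite ler_pM2l ?mulr_gt0//; lra.
Qed.

Lemma gam_between p q a x : p <= a <= q -> gam a x <= gam p x + gam q x.
Proof.
move=> /andP[pa aq]; have [l0|/ltW l0] := leP 0 (ln x).
  apply: ler_wpDl; first exact: expR_ge0.
  by rewrite /gam ler_expR lerD2r ler_wpM2r// lerD2r.
apply: ler_wpDr; first exact: expR_ge0.
by rewrite /gam ler_expR lerD2r ler_wnM2r ?lerD2r.
Qed.

(** [sqr_le_cosh] at h ln x bounds the squared logarithm by powers x^h and x^(-h), so logarithms
    cost only a change of exponent. The choice h = p / 2 keeps the exponents at least p / 2, hence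
    the weights integrable. *)
Lemma ln_gam_bound p q : 0 < p -> exists2 K : R, 0 <= K & forall a x, p <= a <= q ->
  (1 + ln x ^+ 2) * gam a x <= K * (gam (p / 2) x + gam (q + p) x).
Proof.
move=> p0; pose h := p / 2; have h0 : 0 < h by rewrite divr_gt0.
have hi : 0 < (h ^+ 2)^-1 by rewrite invr_gt0 exprn_gt0.
exists (1 + 2 * (h ^+ 2)^-1); first by rewrite addr_ge0// mulr_ge0// ltW.
move=> a x /andP[pa aq]; set W := gam h x + _.
have hp : p = h + h by rewrite /h; field.
have b (c : R) : a - h <= c <= a + h -> gam c x <= W.
  by move=> /andP[c1 c2]; apply: gam_between; apply/andP; split; lra.
have b0 : gam a x <= W by apply: b; apply/andP; split; lra.
have b1 : gam (a + h) x <= W by apply: b; apply/andP; split; lra.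
have b2 : gam (a - h) x <= W by apply: b; apply/andP; split; lra.
have g1 : gam (a + h) x = gam a x * expR (h * ln x).
  by rewrite /gam -expRD; congr expR; ring.
have g2 : gam (a - h) x = gam a x * expR (- (h * ln x)).
  by rewrite /gam -expRD; congr expR; ring.
have c := sqr_le_cosh (h * ln x).
have g0 := gam_gt0 a x.
have : ln x ^+ 2 * gam a x <= (h ^+ 2)^-1 * (2 * W).
  have -> : ln x ^+ 2 * gam a x = (h ^+ 2)^-1 * (gam a x * (h * ln x) ^+ 2).
    by field; rewrite gt_eqF.
  rewrite ler_pM2l//; apply: (@le_trans _ _ (gam a x * (expR (h * ln x) + expR (- (h * ln x))))).
    by rewrite ler_pM2l//; lra.
  by rewrite mulrDr -g1 -g2; lra.
move: (h ^+ 2)^-1 => k; rewrite !mulrDl !mul1r => ?.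
have : k * (2 * W) = k * W + k * W by ring.
by lra.
Qed.

Lemma le_1Dsqr x : `|x| <= 1 + x ^+ 2.
Proof. by have := sqr_ge0 (`|x| - 1); rewrite -[x ^+ 2]real_normK ?num_real//; nra. Qed.

(** Differentiation under the integral sign in quadratic form: [cexp_second_order] at (w - z) ln x,
    times the weight at z, is bounded by the weights at z and w, and [ln_gam_bound] dominates both
    by one integrable W. *)
Lemma holo_euler_Gamma (Q : set R[i]) (p : R) : cbounded Q -> 0 < p ->
  (forall z, Q z -> p <= Re z) -> exists F', holo Q euler_Gamma F'.
Proof.
move=> [B B0 QB] p0 Qp; have [K K0 KE] := ln_gam_bound B p0.
pose W x := gam (p / 2) x + gam (B + p) x.
have p2 : 0 < p / 2 by rewrite divr_gt0.
have iW : rint `]0, +oo[ W.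
  by apply: rintD => //; apply: rint_gam => //; rewrite ltr_wpDl.
have W0 x : 0 <= W x by rewrite addr_ge0 ?expR_ge0.
have IW0 : 0 <= \int[mu]_(x in `]0, +oo[) W x by apply: Rintegral_ge0 => x _.
have Qr z : Q z -> p <= Re z <= B.
  move=> Qz; rewrite Qp//=; apply: le_trans (QB _ Qz).
  by apply: le_trans (normrRe _); exact: ler_norm.
pose f' z x := (ln x)%:C * gfun z x.
have b0 z x : Q z -> normc (gfun z x) <= K * W x.
  move=> Qz; rewrite normc_gfun; apply: le_trans (KE _ _ (Qr _ Qz)).
  by rewrite ler_peMl ?expR_ge0// lerDl sqr_ge0.
have b1 z x : Q z -> normc (f' z x) <= K * W x.
  move=> Qz; rewrite normcM normcC normc_gfun; apply: le_trans (KE _ _ (Qr _ Qz)).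
  by rewrite ler_wpM2r ?expR_ge0// le_1Dsqr.
have iKW : rint `]0, +oo[ (fun x => K * W x) by exact: rintZ.
have mf' z : cmeasurable `]0, +oo[ (f' z).
  apply: ccont_measurable => [|x /itv0y x0]; first exact: interval_open.
  by apply: ccontM; [exact: cderiv_ccont (cderiv_ln x0)|exact: ccont_gfun].
have i0 z : Q z -> cintable `]0, +oo[ (gfun z).
  by move=> Qz; apply: (cintable_dominated _ (cmeasurable_gfun z) iKW) => // x _; exact: b0.
have i1 z : Q z -> cintable `]0, +oo[ (f' z).
  by move=> Qz; apply: (cintable_dominated _ (mf' z) iKW) => // x _; exact: b1.
pose J := \int[mu]_(x in `]0, +oo[) (K * W x).
have J0 : 0 <= J by apply: Rintegral_ge0 => x _; rewrite mulr_ge0.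
exists (fun z => cintegral `]0, +oo[ (f' z)), (8 * J); first by rewrite mulr_ge0.
move=> z Qz; split.
- rewrite euler_GammaE; apply: (@le_trans _ _ (2 * J)).
    by apply: (le_normc_cintegral (measurable_itv _) (i0 _ Qz) iKW) => x _; exact: b0.
  by rewrite ler_wpM2r// ler_nat.
- apply: (@le_trans _ _ (2 * J)).
    by apply: (le_normc_cintegral (measurable_itv _) (i1 _ Qz) iKW) => x _; exact: b1.
  by rewrite ler_wpM2r// ler_nat.
move=> w Qw; set n2 := normc (w - z) ^+ 2.
have n20 : 0 <= n2 by exact: sqr_ge0.
have iB := cintableB (measurable_itv _) (i0 _ Qw) (i0 _ Qz).
have iZ := cintableZ (w - z) (measurable_itv _) (i1 _ Qz).
rewrite !euler_GammaE [_ * (w - z)]mulrC -cintegralZ//; last exact: i1.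
rewrite -cintegralB//; [|exact: i0|exact: i0].
rewrite -cintegralB//.
have -> : 8 * J * n2 = 2 * \int[mu]_(x in `]0, +oo[) (4 * n2 * (K * W x)).
  by rewrite RintZ// -/J; ring.
apply: le_normc_cintegral => //; [exact: cintableB|exact: rintZ|].
move=> x _.
have -> : gfun w x - gfun z x - (w - z) * f' z x =
    gfun z x * (cexp ((w - z) * (ln x)%:C) - 1 - (w - z) * (ln x)%:C).
  have -> : gfun w x = gfun z x * cexp ((w - z) * (ln x)%:C).
    by rewrite /gfun -cexpD; congr cexp; ring.
  by rewrite /f'; ring.
rewrite normcM; apply: le_trans (ler_wpM2l (normc_ge0 _) (cexp_second_order _)) _.
rewrite normcM normcC exprMn -/n2 real_normK ?num_real// normc_gfun.
have -> : Re ((w - z) * (ln x)%:C) = (Re w - Re z) * ln x.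
  by rewrite ReM ImC mulr0 subr0 ReC ReB.
have e1 : gam (Re z) x * expR ((Re w - Re z) * ln x) = gam (Re w) x.
  by rewrite /gam -expRD; congr expR; ring.
have k1 := KE _ x (Qr _ Qz); have k2 := KE _ x (Qr _ Qw).
have -> : gam (Re z) x * (2 * (1 + expR ((Re w - Re z) * ln x)) * (n2 * ln x ^+ 2)) =
  2 * n2 * (ln x ^+ 2 * gam (Re z) x + ln x ^+ 2 * gam (Re w) x).
  by rewrite -e1; ring.
have -> : 4 * n2 * (K * W x) = 2 * n2 * (K * W x + K * W x) by ring.
apply: ler_wpM2l; first by rewrite mulr_ge0.
apply: lerD.
  by apply: le_trans k1; rewrite ler_wpM2r ?expR_ge0// lerDr.
by apply: le_trans k2; rewrite ler_wpM2r ?expR_ge0// lerDr.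
Qed.

End euler_gamma.

(** * Hankel's formula for 1 / Gamma on the real line *)

Section reciprocal_gamma.
Context {R : realType}.
Variables (alpha theta : R).
Hypotheses (alpha_gt0 : 0 < alpha) (theta_gt : pi / 2 < theta) (theta_lt : theta < pi)
  (alpha_theta : alpha * theta < pi / 2).
Implicit Types (z t w : R).
Let H z t := hankel theta 0 (efun alpha z t).

Lemma gam_powR z x : 0 < x -> gam z x = x `^ (z - 1) * expR (- x).
Proof. by move=> x0; rewrite /gam expRD /powR gt_eqF. Qed.

Lemma hankel_gam z w : 0 < z -> 0 <= w ->
  \int[mu]_(x in `]0, +oo[) (gam z x * H z (w * x `^ (- alpha))) = pi * expR (- w).
Proof.
move=> z0 w0; rewrite -(hankel_gamma alpha_gt0 theta_gt theta_lt alpha_theta 0 z0 w0).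
by apply: eq_Rintegral => x /set_mem /itv0y x0; rewrite gam_powR.
Qed.

Lemma hankel_rgamma z : 0 < z -> rgamma z * H z 0 = pi.
Proof.
move=> z0; have := hankel_gam z0 (lexx 0); rewrite oppr0 expR0 mulr1 => <-.
rewrite mulrC -RintZ//; last exact: rint_gam.
by apply: eq_Rintegral => x _; rewrite mul0r mulrC.
Qed.

(** One real c continues both sides to the left: the product in the definition of Gamma and the
    recurrence of the Hankel integral. Hence Hankel's formula passes from z > 0 to every real z,
    including the poles of Gamma. *)
Lemma rising_real z n : exists c : R, rising (z%:C : R[i]) n = c%:C /\ H z 0 = c * H (z + n%:R) 0.
Proof.
elim: n => [|n [c [cE HE]]].
  by exists 1; rewrite /rising big_ord0 addr0 mul1r.
exists (c * (z + n%:R)); split; first by rewrite risingS cE rmorphM rmorphD natC.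
rewrite HE -mulrA; congr (_ * _).
have := hankel_efun_rec alpha_gt0 theta_gt theta_lt alpha_theta (z + n.+1%:R) 0.
by rewrite -/(H _ _) -[n.+1%:R]natr1 addrA addrK.
Qed.

Lemma hankel_Gamma z : ((H z 0) / pi)%:C = (Gamma z%:C)^-1 :> R[i].
Proof.
have p0 := pi_gt0 R.
pose n := (Num.truncn `|z|).+1.
have zn : 0 < z + n%:R.
  have : `|z| < n%:R by exact: truncnS_gt.
  by have := ler_norm (- z); rewrite normrN; lra.
have [c [cE HE]] := rising_real z n.
rewrite (@Gamma_shift _ z%:C n)// cE natC -rmorphD euler_Gamma_real invf_div -fmorphV -rmorphM.
congr _%:C; rewrite HE -mulrA; congr (_ * _).
apply: (mulfI (lt0r_neq0 (rgamma_gt0 zn))); rewrite mulrA hankel_rgamma//.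
by rewrite !divff// gt_eqF// rgamma_gt0.
Qed.

Lemma reciprocal_Gamma_series z t : 0 <= t ->
  \sum_(l < N) (- t) ^+ l / l`!%:R * Re (Gamma (z - alpha * l%:R)%:C)^-1
    @[N --> \oo] --> H z t / pi.
Proof.
move=> t0.
have -> : (fun N => \sum_(l < N) (- t) ^+ l / l`!%:R * Re (Gamma (z - alpha * l%:R)%:C)^-1) =
    fun N => (\sum_(l < N) (- t) ^+ l / l`!%:R * H (z - alpha * l%:R) 0) * pi^-1.
  apply/funext => N; rewrite mulr_suml; apply: eq_bigr => l _.
  by rewrite -hankel_Gamma ReC mulrA.
apply: cvgM; last exact: cvg_cst.
exact: (hankel_series alpha_gt0 theta_gt theta_lt alpha_theta).
Qed.

End reciprocal_gamma.

(** Retains of the Hankel integral only its power series and its integral against the gamma weight,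
    so that theta can be fixed here. g z t / pi is the Wright function with parameters - alpha and z
    at - t. *)
Lemma wright_function (R : realType) (alpha : R) : 0 < alpha < 1 ->
  exists g : R -> R -> R,
    (forall z t, 0 <= t -> \sum_(l < N) (- t) ^+ l / l`!%:R * Re (Gamma (z - alpha * l%:R)%:C)^-1
      @[N --> \oo] --> g z t / pi) /\
    (forall z w, 0 < z -> 0 <= w ->
      \int[mu]_(x in `]0, +oo[) (gam z x * g z (w * x `^ (- alpha))) = pi * expR (- w)).
Proof.
move=> /andP[a0 a1]; have p0 := pi_gt0 R.
(* theta will be the midpoint of pi / 2 and this upper limit, which exceeds pi / 2 because alpha <
   1. *)
pose m := Num.min (pi : R) (pi / 2 / alpha).
have pm : pi / 2 < m.
  rewrite lt_min; apply/andP; split; first by lra.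
  by rewrite ltr_pdivlMr// gtr_pMr// divr_gt0.
pose theta := (pi / 2 + m) / 2.
have tm : theta < m by rewrite /theta; lra.
have t1 : pi / 2 < theta by rewrite /theta; lra.
have t2 : theta < pi by apply: lt_le_trans tm _; rewrite ge_min lexx.
have t3 : alpha * theta < pi / 2.
  by rewrite mulrC -ltr_pdivlMr//; apply: lt_le_trans tm _; rewrite ge_min lexx orbT.
exists (fun z t => hankel theta 0 (efun alpha z t)); split => [z t|z w].
  exact: (reciprocal_Gamma_series a0 t1 t2 t3).
exact: (hankel_gam a0 t1 t2 t3).
Qed.

Lemma Im_Gamma_real (R : realType) (z : R) : Im (Gamma z%:C : R[i])^-1 = 0.
Proof.
have p0 := pi_gt0 R.
pose n := (Num.truncn `|z|).+1.
have zn : 0 < z + n%:R.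
  have : `|z| < n%:R by exact: truncnS_gt.
  by have := ler_norm (- z); rewrite normrN; lra.
rewrite (@Gamma_shift _ z%:C n)// natC -rmorphD euler_Gamma_real invf_div.
apply: Im0M; last exact: Im0V.
rewrite /rising; elim/big_rec: _ => // i y _ y0; apply: Im0M => //.
by rewrite natC -rmorphD.
Qed.

(** * The Mellin kernel and its residues *)

Section gamma_quotient.
Context {R : realType}.
Implicit Types (z w s : R[i]) (Q : set R[i]).

Lemma recip_Gamma_shift w n : 0 < Re w + n%:R ->
  (Gamma w)^-1 = rising w n / euler_Gamma (w + n%:R).
Proof. by move=> wn; rewrite (Gamma_shift wn) invf_div. Qed.

Lemma holo_rising Q n : cbounded Q -> exists F', holo Q (fun z => rising z n) F'.
Proof.
move=> bQ; elim: n => [|n [F' IH]].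
  exists (fun=> 0); apply: eq_holo (holo_cst Q 1) => // z _.
  by rewrite /rising big_ord0.
have h := holoM bQ IH (holoD (holo_id bQ) (holo_cst Q n%:R)).
by eexists; apply: eq_holo h => // z _; rewrite risingS.
Qed.

Lemma normc_euler_Gamma_lower w : 1 < Re w -> 1 + Im w ^+ 2 <= Re w ->
  expR (- 2) / 2 <= normc (euler_Gamma w).
Proof.
move=> w1 w2; apply: (@le_trans _ _ (rgamma (Re w) / 2)).
  by rewrite ler_pM2r// rgamma_lower// ltW.
have := normc_euler_Gamma_ge w1 w2.
by have -> : Re w +i* Im w = w by apply: complexP.
Qed.

(** After n shifts, 1 / Gamma is a polynomial over Euler's integral, and for large n the translate
    of Q lies inside the parabola where that integral is bounded below. *)
Lemma holo_recip_Gamma Q : cbounded Q -> exists F', holo Q (fun w => (Gamma w)^-1) F'.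
Proof.
move=> bQ; have [B B0 QB] := bQ.
(* Re w >= - B and |Im w| <= B on Q, so this n gives Re (w + n) > 1 + Im^2. *)
pose n := (Num.truncn (B + B ^+ 2 + 2)).+1.
have Bn : B + B ^+ 2 + 2 < n%:R by exact: truncnS_gt.
have QR w : Q w -> - B <= Re w.
  by move=> /QB h; have := le_trans (normrRe w) h; rewrite ler_norml => /andP[].
have QI w : Q w -> Im w ^+ 2 <= B ^+ 2.
  move=> /QB h; have := le_trans (normrIm w) h.
  by rewrite -[Im w ^+ 2]real_normK ?num_real// => h2; rewrite lerXn2r// nnegrE.
have B20 : 0 <= B ^+ 2 by exact: sqr_ge0.
pose Q2 : set R[i] := [set z | normc z <= B + n%:R /\ 1 <= Re z].
have bQ2 : cbounded Q2 by exists (B + n%:R); [rewrite addr_ge0|move=> z []].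
have [E' hE] := @holo_euler_Gamma R Q2 1 bQ2 ltr01 (fun z h => h.2).
have QQ2 w : Q w -> Q2 (w + n%:R).
  move=> Qw; split.
    apply: le_trans (normc_triangle _ _) _; rewrite lerD ?QB//.
    by rewrite natC normcC ger0_norm.
  by rewrite ReD Renat; have := QR w Qw; lra.
have h1 := holo_comp bQ QQ2 hE (holoD (holo_id bQ) (holo_cst Q n%:R)).
have [F' h2] := holo_rising n bQ.
have e0 : 0 < expR (- 2) / 2 :> R by rewrite divr_gt0 ?expR_gt0.
have low w : Q w -> expR (- 2) / 2 <= normc (euler_Gamma (w + n%:R)).
  move=> Qw; apply: normc_euler_Gamma_lower.
    by rewrite ReD Renat; have := QR w Qw; lra.
  by rewrite ReD ImD Renat Imnat addr0; have := QR w Qw; have := QI w Qw; lra.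
have h3 := holoM bQ h2 (holoV bQ e0 low h1).
eexists; apply: eq_holo h3 => // w Qw; rewrite -recip_Gamma_shift//.
by have := QR w Qw; lra.
Qed.

(** |z + k| >= n - 2 - k for k < n - 2, whence the factorial; the last two factors may come near 0
    and are each bounded only by 1 / 2. Truncated subtraction covers n < 2. *)
Lemma rising_lower n z : 1 < Re z + n%:R <= 2 -> (forall k : nat, 2^-1 <= normc (z + k%:R)) ->
  (n - 2)`!%:R / 4 <= normc (rising z n).
Proof.
have risingSl (y : R[i]) m : rising y m.+1 = y * rising (y + 1) m.
  by rewrite -add1n rising_add risingS /rising big_ord0 mul1r addr0.
elim: n z => [|n IH] z zn zk.
  by rewrite /rising big_ord0 normc1 fact0 mul1r invf_le1 ?ler1n.
have zn' : 1 < Re (z + 1) + n%:R <= 2 by rewrite ReD Re1 -addrA nat1r.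
have zk' k : 2^-1 <= normc (z + 1 + k%:R) by rewrite -addrA nat1r.
have := IH _ zn' zk'; rewrite risingSl normcM.
have z2 : 2^-1 <= normc z by have := zk 0; rewrite addr0.
case: n IH zn zn' => [|[|n]] IH zn zn' h.
- have : normc (rising (z + 1) 0) = 1 by rewrite /rising big_ord0 normc1.
  by move=> ->; rewrite fact0; lra.
- have -> : rising (z + 1) 1 = z + 1 by rewrite risingS /rising big_ord0 mul1r addr0.
  have := zk 1; rewrite fact0 => h1; apply: (@le_trans _ _ (2^-1 * 2^-1)); first lra.
  by apply: ler_pM.
rewrite !subSS subn0 factS natrM -mulrA; move: h; rewrite !subSS subn0 => h.
apply: ler_pM => //.
apply: le_trans (normrRe _); rewrite -normrN; apply: le_trans (ler_norm _).
by case/andP: zn => _; rewrite -!natr1; lra.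
Qed.

Lemma rising_upper n w : 2 < Re w + n%:R <= 3 -> `|Im w| <= 1 ->
  normc (rising w n) <= (n + 2)`!%:R.
Proof.
have risingSl (y : R[i]) m : rising y m.+1 = y * rising (y + 1) m.
  by rewrite -add1n rising_add risingS /rising big_ord0 mul1r addr0.
elim: n w => [|n IH] w wn w1; first by rewrite /rising big_ord0 normc1 ler1n fact_gt0.
rewrite risingSl normcM addSn factS natrM; apply: ler_pM; rewrite ?normc_ge0//.
  apply: le_trans (normc_leRI _) _; move: wn; rewrite -!natr1 natrD => /andP[h1 h2]; have n0 := ler0n R n.
  by have : `|Re w| <= n%:R + 2 :> R; [rewrite ler_norml; apply/andP; split|]; lra.
by apply: IH; [rewrite ReD Re1 -addrA nat1r|rewrite ImD Im1 addr0].
Qed.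

Lemma fact_quotient a b : (a <= b)%N -> (a.+1%:R : R) ^+ (b - a) * a`!%:R <= b`!%:R.
Proof.
move=> /subnKC <-; rewrite addKn; elim: (b - a)%N => [|k IH]; first by rewrite expr0 mul1r addn0.
rewrite addnS factS natrM exprS -mulrA; apply: ler_pM => //.
by rewrite ler_nat ltnS leq_addr.
Qed.

(* The integrand of foxH divided by t^(r-1), as a function of s + r - 1, for
   z0 = r (1 - alpha): its poles are the integers -l. *)
Definition mellin_kernel (z0 alpha t : R) s : R[i] :=
  Gamma s / Gamma (z0%:C + alpha%:C * s) * cpow t (- s).

(** With n close to - Re s and m close to - alpha * Re s, the functional equation leaves a quotient
    of the size of m! / n!. As alpha < 1, n! has a number of extra factors proportional to - Re s,
    all exceeding any given constant, which beats t^(-s) and still leaves e^(Re s). *)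
Lemma mellin_kernel_bound (z0 alpha t : R) : 0 < alpha < 1 ->
  exists C Y : R, [/\ 0 <= C, 0 <= Y & forall s, Re s <= - Y -> `|Im s| <= 1 ->
    (forall k : nat, 2^-1 <= normc (s + k%:R)) ->
    normc (mellin_kernel z0 alpha t s) <= C * expR (Re s)].
Proof.
move=> /andP[a0 a1]; have b0 : 0 < 1 - alpha by rewrite subr_gt0.
(* l is the rate to be won from the factorials: |ln t| pays for t^(-s) and 1 for e^(Re s). At least
   (1 - alpha) |Re s| / 2 extra factors will be available, so each must reach e^c. *)
pose l := 1 + `|ln t|; have l0 : 0 < l by rewrite ltr_pwDl.
pose c := 2 * l / (1 - alpha); have c0 : 0 < c by rewrite divr_gt0// mulr_gt0.
pose C1 : R := 2 * (rgamma 1 + rgamma 2).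
have C10 : 0 <= C1 by rewrite mulr_ge0// addr_ge0// ltW// rgamma_gt0.
(* Y1 makes 3 - Re w nonnegative, so that its integer part counts shifts; Y2 guarantees the number
   of extra factors, and Y3 that the smallest of them reaches e^c. *)
pose Y1 := `|z0 - 3| / alpha; pose Y2 := 2 * `|6 - z0| / (1 - alpha).
pose Y3 := (expR c + `|5 - z0|) / alpha.
have Y10 : 0 <= Y1 by rewrite divr_ge0// ltW.
have Y20 : 0 <= Y2 by rewrite divr_ge0 ?mulr_ge0// ltW.
have Y30 : 0 <= Y3 by rewrite divr_ge0 ?addr_ge0 ?expR_ge0// ltW.
have e2 : 0 < expR (- 2) :> R by exact: expR_gt0.
exists (C1 * 4 * 2 / expR (- 2)), (1 + Y1 + Y2 + Y3); split.
- by rewrite divr_ge0 ?expR_ge0// mulr_ge0// mulr_ge0.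
- by rewrite !addr_ge0.
move=> s sY s1 sk; pose X := Re s; pose Yv := - X.
have Y1' : 1 <= Yv by rewrite /Yv /X; lra.
have hY1 : `|z0 - 3| <= alpha * Yv by rewrite mulrC -ler_pdivrMr//; rewrite -/Y1 /Yv /X; lra.
have hY2 : 2 * `|6 - z0| <= (1 - alpha) * Yv.
  by rewrite [leRHS]mulrC -ler_pdivrMr//; rewrite -/Y2 /Yv /X; lra.
have hY3 : expR c + `|5 - z0| <= alpha * Yv.
  by rewrite [leRHS]mulrC -ler_pdivrMr//; rewrite -/Y3 /Yv /X; lra.
have [w wE] : exists w, w = z0%:C + alpha%:C * s by eexists.
have Rw : Re w = z0 - alpha * Yv.
  by rewrite wE ReD ReM !ReC ImC mul0r subr0 /Yv mulrN opprK.
have Iw : `|Im w| <= 1.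
  by rewrite wE ImD ImM !ImC ReC mul0r addr0 add0r normrM gtr0_norm// mulr_ile1// ltW.
have := ler_norm (z0 - 3); have := ler_norm (6 - z0); have := ler_norm (z0 - 5).
rewrite [`|z0 - 5|]distrC => n1 n2 n3.
(* s is moved to 1 < Re <= 2, where Euler's integral is bounded above, and w to 2 < Re <= 3, where
   |Im w| <= 1 gives the parabola condition of the lower bound. *)
pose n := Num.truncn (2 + Yv).
have /andP[nl nu] : n%:R <= 2 + Yv < n.+1%:R by apply: truncn_itv; lra.
pose m := Num.truncn (3 - Re w).
have /andP[ml mu'] : m%:R <= 3 - Re w < m.+1%:R by apply: truncn_itv; rewrite Rw; lra.
rewrite -natr1 in nu; rewrite -natr1 in mu'.
have sn : 1 < Re s + n%:R <= 2 by apply/andP; split; rewrite -/X; rewrite /Yv in nl nu; lra.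
have wm : 2 < Re w + m%:R <= 3 by apply/andP; split; lra.
have n2' : (2 <= n)%N by rewrite -ltnS -(ltr_nat R) -natr1; lra.
have E1 : normc (euler_Gamma (s + n%:R)) <= C1.
  by apply: normc_euler_Gamma_le; rewrite ReD Renat; lra.
have E2 : expR (- 2) / 2 <= normc (euler_Gamma (w + m%:R)).
  apply: normc_euler_Gamma_lower; rewrite ReD Renat ?ImD ?Imnat ?addr0; first by lra.
  have : Im w ^+ 2 <= 1 by rewrite -[Im w ^+ 2]real_normK ?num_real// expr_le1.
  by lra.
have n2E : (n - 2)%N%:R = n%:R - 2 :> R by rewrite natrB.
have m2E : (m + 2)%N%:R = m%:R + 2 :> R by rewrite natrD.
have bd : (1 - alpha) * Yv / 2 <= (n - 2)%N%:R - (m + 2)%N%:R by rewrite n2E m2E; lra.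
have mn : (m + 2 <= n - 2)%N.
  by rewrite -(ler_nat R) -subr_ge0; apply: le_trans bd; rewrite divr_ge0// mulr_ge0 ?ltW//; lra.
have E3 : expR (l * Yv) * (m + 2)`!%:R <= (n - 2)`!%:R.
  apply: le_trans (fact_quotient mn); rewrite ler_wpM2r//.
  apply: (@le_trans _ _ (expR c ^+ (n - 2 - (m + 2)))).
    rewrite -expRM_natl ler_expR natrB// -[l * Yv](_ : (1 - alpha) * Yv / 2 * c = _).
      by rewrite ler_pM2r.
    by rewrite /c; field; rewrite gt_eqF.
  apply: lerXn2r; rewrite ?nnegrE ?expR_ge0// -natr1 m2E; lra.
have E4 := rising_lower sn sk; have E5 := rising_upper wm Iw.
rewrite /mellin_kernel -wE (Gamma_shift (n := n)); last by case/andP: sn; lra.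
rewrite (recip_Gamma_shift (n := m)); last by case/andP: wm; lra.
rewrite !normcM !normcV /cpow normc_cexp.
have -> : Re (- s * (ln t)%:C) = Yv * ln t by rewrite ReM ReN ReC ImC mulr0 subr0.
move: (normc (euler_Gamma (s + _))) (normc_ge0 (euler_Gamma (s + n%:R))) E1 => A A0 E1.
move: (normc (euler_Gamma (w + _))) E2 => D E2.
move: (normc (rising s n)) E4 => B E4.
move: (normc (rising w m)) (normc_ge0 (rising w m)) E5 => F F0 E5.
have f0 : 0 < (n - 2)`!%:R :> R by rewrite ltr0n fact_gt0.
have B0 : 0 < B by apply: lt_le_trans E4; rewrite divr_gt0.
have D0 : 0 < D by apply: lt_le_trans E2; rewrite divr_gt0.
apply: (@le_trans _ _ ((C1 * (4 / (n - 2)`!%:R)) * ((m + 2)`!%:R * (2 / expR (- 2))) * expR (Yv * ln t))).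
  rewrite ler_wpM2r ?expR_ge0//; apply: ler_pM; rewrite ?divr_ge0 ?(ltW B0) ?(ltW D0)//.
    apply: ler_pM; rewrite ?invr_ge0 ?(ltW B0)//.
    by rewrite -[4 / _]invf_div lerV2_pos// divr_gt0.
  apply: ler_pM; rewrite ?invr_ge0 ?(ltW D0)//.
  by rewrite -[2 / _]invf_div lerV2_pos// divr_gt0.
have -> : C1 * (4 / (n - 2)`!%:R) * ((m + 2)`!%:R * (2 / expR (- 2))) * expR (Yv * ln t) =
   C1 * 4 * 2 / expR (- 2) * ((m + 2)`!%:R / (n - 2)`!%:R * expR (Yv * ln t)).
  by field; rewrite !gt_eqF.
apply: ler_wpM2l; first by rewrite divr_ge0 ?expR_ge0// mulr_ge0// mulr_ge0.
rewrite mulrAC ler_pdivrMr//; apply: le_trans (ler_wpM2l (expR_ge0 _) E3).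
rewrite mulrA -expRD mulrC ler_wpM2r// ler_expR.
have := ler_norm (ln t); rewrite /l /Yv -/X; move: (ln t) (`|ln t|) => u v uv.
have : Yv * u <= Yv * v by rewrite ler_wpM2l//; lra.
by rewrite /Yv mulrDl mul1r [v * _]mulrC; lra.
Qed.

End gamma_quotient.

(** * Partial fractions and principal parts of the kernel *)

Section residues.
Context {R : realType}.
Implicit Types (s : R[i]) (Q : set R[i]).

Lemma rising_partial_fractions N s : (forall k, (k <= N)%N -> s + k%:R != 0) ->
  (rising s N.+1)^-1 = \sum_(l < N.+1) (-1) ^+ l / (l`!%:R * (N - l)`!%:R) / (s + l%:R).
Proof.
have n0 k : k`!%:R != 0 :> R[i] by rewrite pnatr_eq0 -lt0n fact_gt0.
elim: N s => [|N IH] s sk.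
  by rewrite big_ord1 risingS /rising big_ord0 mul1r expr0 fact0 mulr1 invr1 mul1r mul1r.
have sN : s + N.+1%:R != 0 by exact: sk.
rewrite risingS invfM IH; last by move=> k kN; apply: sk; exact: leqW.
rewrite [RHS]big_ord_recr /= subnn fact0 mulr1.
have e (l : 'I_N.+1) : (-1) ^+ l / (l`!%:R * (N - l)`!%:R) / (s + l%:R) / (s + N.+1%:R) =
    (-1) ^+ l / (l`!%:R * (N.+1 - l)`!%:R) / (s + l%:R) -
    (-1) ^+ l / (l`!%:R * (N.+1 - l)`!%:R) / (s + N.+1%:R).
  have lN : (l <= N)%N by rewrite -ltnS.
  have sl : s + l%:R != 0 by apply: sk; exact: leqW.
  have E : N.+1%:R - l%:R = (N - l).+1%:R :> R[i] by rewrite -subSn// natrB// leqW.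
  have d0 : (N - l).+1%:R != 0 :> R[i] by rewrite pnatr_eq0.
  rewrite subSn// factS natrM.
  have E2 : s + N.+1%:R = s + l%:R + (N - l).+1%:R by rewrite -E; ring.
  rewrite E2 in sN *; move: (s + l%:R) ((N - l).+1%:R) sl d0 sN => x d x0 d0 xd.
  by field; rewrite !n0 x0 d0 xd.
rewrite big_distrl /= (eq_bigr _ (fun l _ => e l)) sumrB; congr (_ + _).
rewrite -mulr_suml -mulNr; congr (_ / _).
(* The coefficient of the new fraction is a sum over the old ones, recognised by evaluating the
   induction hypothesis at s = - N.+1. *)
have h : (rising (- N.+1%:R) N.+1)^-1 = \sum_(l < N.+1) (-1) ^+ l / (l`!%:R * (N - l)`!%:R) / (- N.+1%:R + l%:R) :> R[i].
  apply: IH => k kN; rewrite addrC subr_eq0 eqr_nat.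
  by rewrite neq_ltn ltnS kN.
have -> : \sum_(i < N.+1) (-1) ^+ i / (i`!%:R * (N.+1 - i)`!%:R) = - (rising (- N.+1%:R) N.+1)^-1 :> R[i].
  rewrite h -sumrN; apply: eq_bigr => l _.
  have lN : (l <= N)%N by rewrite -ltnS.
  have E : N.+1%:R - l%:R = (N - l).+1%:R :> R[i] by rewrite -subSn// natrB// leqW.
  have d0 : (N - l).+1%:R != 0 :> R[i] by rewrite pnatr_eq0.
  rewrite subSn// factS natrM -E in d0 *.
  have -> : - N.+1%:R + l%:R = - (N.+1%:R - l%:R) :> R[i] by ring.
  by move: (_ - _) d0 => d d0; field; rewrite !n0 d0.
rewrite opprK; have -> : rising (- N.+1%:R : R[i]) N.+1 = (-1) ^+ N.+1 * N.+1`!%:R.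
  elim: N.+1 => [|n IHn]; first by rewrite /rising big_ord0 mulr1.
  rewrite -add1n rising_add /rising big_ord1 -/(rising _ _) addr0 add1n.
  have -> : - n.+1%:R + 1%:R = - n%:R :> R[i] by rewrite -natr1; ring.
  by rewrite IHn factS natrM exprS; ring.
by rewrite invfM -exprVn invrN1.
Qed.

Section kernel.
Variables (z0 alpha t : R).
Hypothesis t_gt0 : 0 < t.
Let phi := mellin_kernel z0 alpha t.

(** Numerator of the kernel over rising s N.+1, holomorphic where Re s > - (N + 1). *)
Definition knum N s : R[i] :=
  euler_Gamma (s + N.+1%:R) * ((Gamma (z0%:C + alpha%:C * s))^-1 * cpow t (- s)).

Lemma holo_knum Q N (p : R) : cbounded Q -> 0 < p ->
  (forall s, Q s -> p <= Re s + N.+1%:R) -> exists K', holo Q (knum N) K'.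
Proof.
move=> bQ p0 Qp; have [B B0 QB] := bQ.
pose Q2 : set R[i] := [set z | normc z <= B + N.+1%:R /\ p <= Re z].
have bQ2 : cbounded Q2 by exists (B + N.+1%:R); [rewrite addr_ge0|move=> z []].
have [E' hE] := @holo_euler_Gamma R Q2 p bQ2 p0 (fun z h => h.2).
have QQ2 s : Q s -> Q2 (s + N.+1%:R).
  move=> Qs; split; last by rewrite ReD Renat; exact: Qp.
  apply: le_trans (normc_triangle _ _) _; rewrite lerD ?QB//.
  by rewrite natC normcC ger0_norm.
pose Q3 : set R[i] := [set z | normc z <= `|z0| + `|alpha| * B].
have bQ3 : cbounded Q3.
  by exists (`|z0| + `|alpha| * B) => //; rewrite addr_ge0// mulr_ge0.
have [G' hG] := holo_recip_Gamma bQ3.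
have QQ3 s : Q s -> Q3 (z0%:C + alpha%:C * s).
  move=> Qs; apply: le_trans (normc_triangle _ _) _.
  by rewrite normcM !normcC lerD2l ler_wpM2l// QB.
have h1 := holo_comp bQ QQ2 hE (holoD (holo_id bQ) (holo_cst Q N.+1%:R)).
have h2 := holo_comp bQ QQ3 hG (holo_affine z0%:C alpha%:C bQ).
have h3 := holoM bQ h1 (holoM bQ h2 (holo_cexp_affine 0 (- (ln t)%:C) bQ)).
eexists; apply: eq_holo h3 => // s Qs; rewrite /knum /cpow add0r.
by congr (_ * (_ * cexp _)); rewrite !mulNr mulrC.
Qed.

Lemma mellin_kernel_knum N s : 0 < Re s + N.+1%:R ->
  phi s = knum N s / rising s N.+1.
Proof.
move=> sN; rewrite /phi /mellin_kernel (Gamma_shift sN) /knum.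
by rewrite -!mulrA; congr (_ * _); rewrite mulrC -!mulrA.
Qed.

(** The residue of the kernel at - l, since Gamma has residue (-1)^l / l! there. *)
Definition kres (l : nat) : R[i] :=
  ((- t) ^+ l / l`!%:R)%:C * (Gamma (z0 - alpha * l%:R)%:C)^-1.

Lemma knum_pole N l : (l <= N)%N ->
  (-1) ^+ l / (l`!%:R * (N - l)`!%:R) * knum N (- l%:R) = kres l.
Proof.
move=> lN; have n0 k : k`!%:R != 0 :> R[i] by rewrite pnatr_eq0 -lt0n fact_gt0.
have -> : knum N (- l%:R) =
    (N - l)`!%:R * ((Gamma (z0 - alpha * l%:R)%:C)^-1 * (t ^+ l)%:C).
  rewrite /knum; congr (_ * (_^-1 * _)).
  - have -> : - l%:R + N.+1%:R = ((N - l).+1%:R)%:C :> R[i].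
      by rewrite addrC -natrB ?(leqW lN)// subSn// natC.
    by rewrite euler_Gamma_real rgamma_nat natC.
  - by congr Gamma; rewrite natC -rmorphN -rmorphM -rmorphD mulrN.
  - rewrite opprK /cpow natC -rmorphM cexpC; congr (_%:C).
    by rewrite expRM_natl lnK// posrE.
have -> : kres l = ((-1) ^+ l * (t ^+ l)%:C / l`!%:R) * (Gamma (z0 - alpha * l%:R)%:C)^-1.
  rewrite /kres; congr (_ * _); rewrite [(- t) ^+ l]exprNn (rmorphM (real_complex R)) (fmorphV (real_complex R)).
  by rewrite rmorph_nat (rmorphM (real_complex R)) (rmorphXn (real_complex R)) rmorphN1.
have F (x y z a b : R[i]) : a != 0 -> b != 0 -> z / (a * b) * (b * (x * y)) = z * y / a * x.
  by move=> a0 b0; field; rewrite a0 b0.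
exact: F.
Qed.

(** The regular part T' is a combination of the difference quotients [dpsi] of [knum] at the poles,
    weighted by the coefficients of the partial fractions. Each is the derivative of a [psi], so T'
    comes with a primitive. *)
Lemma mellin_kernel_split Q N (p : R) : cbounded Q -> cconvex Q -> 0 < p ->
  (forall s, Q s -> p <= Re s + N.+1%:R) -> (forall l, (l <= N)%N -> Q (- l%:R)) ->
  exists T T', holo Q T T' /\ forall s, Q s -> (forall k, (k <= N)%N -> s + k%:R != 0) ->
    phi s = T' s + \sum_(l < N.+1) kres l / (s + l%:R).
Proof.
move=> bQ cQ p0 Qp Ql; have [K' hK] := holo_knum bQ p0 Qp.
pose c (l : nat) : R[i] := (-1) ^+ l / (l`!%:R * (N - l)`!%:R).
have [T [T' [hT TE]]] : exists T T', holo Q T T' /\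
    forall s, T' s = \sum_(l < N.+1) c l * dpsi K' (- l%:R) s.
  suff H m : (m <= N.+1)%N -> exists T T', holo Q T T' /\
      forall s, T' s = \sum_(l < m) c l * dpsi K' (- l%:R) s by exact: H.
  elim: m => [_|m IH mN].
    exists (fun=> 0), (fun=> 0); split; first exact: holo_cst.
    by move=> s; rewrite big_ord0.
  have [T [T' [hT TE]]] := IH (ltnW mN).
  have h := holoD hT (holoM bQ (holo_cst Q (c m)) (holo_psi bQ cQ (Ql m mN) hK)).
  eexists; eexists; split; first exact: h.
  by move=> s /=; rewrite mul0r add0r TE big_ord_recr.
exists T, T'; split => // s Qs sk.
rewrite TE (@mellin_kernel_knum N); last exact: lt_le_trans (Qp s Qs).
rewrite rising_partial_fractions// mulr_sumr -big_split; apply: eq_bigr => l _ /=.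
have lN : (l <= N)%N by rewrite -ltnS.
have := dpsiE bQ cQ (Ql _ lN) hK Qs; rewrite opprK -(knum_pole lN) -/(c l) => E.
have sl := sk _ lN.
have -> : dpsi K' (- l%:R) s = (knum N s - knum N (- l%:R)) / (s + l%:R).
  by rewrite -E mulrC mulKf.
by field.
Qed.

End kernel.
End residues.

(** * Integration along the loop *)

Section piecewise_paths.
Context {R : realType}.
Implicit Types (f h : R -> R) (a b u A B : R) (s : seq R).

Lemma one_sided_limM (h k : R -> R) u : {for u, continuous h} -> one_sided_lim k u ->
  one_sided_lim (fun x => h x * k x) u.
Proof.
move=> ch [k1 k2]; split; apply: is_cvgM => //; apply/cvg_ex; exists (h u).
  exact: cvg_at_left_filter.
exact: cvg_at_right_filter.
Qed.

Lemma one_sided_limB (h k : R -> R) u : one_sided_lim h u -> one_sided_lim k u ->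
  one_sided_lim (fun x => h x - k x) u.
Proof. by move=> [h1 h2] [k1 k2]; split; exact: is_cvgB. Qed.

Lemma one_sided_limD (h k : R -> R) u : one_sided_lim h u -> one_sided_lim k u ->
  one_sided_lim (fun x => h x + k x) u.
Proof. by move=> [h1 h2] [k1 k2]; split; exact: is_cvgD. Qed.

Lemma one_sided_lim_ext (h k : R -> R) u : (forall x, h x = k x) -> one_sided_lim h u ->
  one_sided_lim k u.
Proof. by move=> /funext ->. Qed.

Lemma one_sided_lim_cont (h : R -> R) u : {for u, continuous h} -> one_sided_lim h u.
Proof.
by move=> ch; split; apply/cvg_ex; exists (h u); [exact: cvg_at_left_filter|exact: cvg_at_right_filter].
Qed.

Lemma ccont_lip_comp (F : R[i] -> R[i]) (g : R -> R[i]) u (C : R) :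
  (\forall y \near u, normc (F (g y) - F (g u)) <= C * normc (g y - g u)) -> ccont g u ->
  ccont (fun y => F (g y)) u.
Proof.
move=> FC cg.
have lim : C * normc (g y - g u) @[y --> u] --> (0 : R).
  have := cont_normc (ccontD cg (ccont_cst (- g u) u)).
  rewrite /prop_for /continuous_at subrr normc0 => h.
  by rewrite -(mulr0 C); apply: cvgM; [exact: cvg_cst|exact: h].
have aux (p : R[i] -> R) : (forall x y, p (x - y) = p x - p y) -> (forall w, `|p w| <= normc w) ->
    {for u, continuous (fun y => p (F (g y)))}.
  move=> pB pn; apply/subr_cvg0; apply/norm_cvg0P.
  apply: (squeeze_cvgr _ (cvg_cst 0) lim).
  near=> y; rewrite normr_ge0/= -pB; apply: le_trans (pn _) _.
  by near: y.
by split; apply: aux; [exact: ReB|exact: normrRe|exact: ImB|exact: normrIm].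
Unshelve. all: by end_near. Qed.

Section path.
Variables (g dg : R -> R[i]) (sg : seq R).
Hypotheses (g_deriv : forall u, u \notin sg -> cderiv g u (dg u) /\ ccont dg u)
  (g_cont : forall u, ccont g u)
  (dg_lim : forall u, one_sided_lim (fun x => Re (dg x)) u /\ one_sided_lim (fun x => Im (dg x)) u).

Lemma path_cintable (h : R -> R[i]) A B a b : a < b -> A < a -> b < B ->
  (forall u, A < u < B -> ccont h u) -> cintable `[a, b] (fun u => h u * dg u).
Proof.
move=> ab Aa bB ch; split; apply: (rint_piecewise (s := sg) ab Aa bB).
- by move=> u uAB us; apply: (ccontM (ch u uAB) (g_deriv us).2).1.
- move=> u uAB; have [l1 l2] := dg_lim u; have [c1 c2] := ch u uAB.
  apply: one_sided_lim_ext (one_sided_limB (one_sided_limM c1 l1) (one_sided_limM c2 l2)) => x.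
  by rewrite ReM.
- by move=> u uAB us; apply: (ccontM (ch u uAB) (g_deriv us).2).2.
- move=> u uAB; have [l1 l2] := dg_lim u; have [c1 c2] := ch u uAB.
  apply: one_sided_lim_ext (one_sided_limD (one_sided_limM c1 l2) (one_sided_limM c2 l1)) => x.
  by rewrite ImM.
Qed.

Lemma near_itvoo A B u : A < u < B -> \forall y \near u, A < y < B.
Proof. by move=> uAB; near=> y; near: y; apply: near_in_itvoo; rewrite in_itv. Unshelve. all: by end_near. Qed.

(** Only the imaginary part is evaluated, because the real part of (2 i pi)^-1 J is Im J / (2 pi).
    [FTC_piecewise] crosses the corners of g, where continuity of F along g is enough. *)
Lemma path_FTC Q F F' A B a b : a < b -> A < a -> b < B -> cbounded Q -> holo Q F F' ->
  (forall u, A < u < B -> Q (g u)) ->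
  cintable `[a, b] (fun u => F' (g u) * dg u) /\
  \int[mu]_(u in `[a, b]) Im (F' (g u) * dg u) = Im (F (g b)) - Im (F (g a)).
Proof.
move=> ab Aa bB bQ hF gQ.
have nQ u : A < u < B -> \forall y \near u, Q (g y).
  by move=> uAB; near=> y; apply: gQ; near: y; exact: near_itvoo.
have [C C0 LC] := holo_lip bQ hF; have [C' C'0 LC'] := holo_lip_deriv hF.
have cF u : A < u < B -> ccont (fun y => F (g y)) u.
  move=> uAB; apply: (ccont_lip_comp (C := C)) => //.
  by near=> y; apply: LC; [exact: gQ|near: y; exact: nQ].
have cF' u : A < u < B -> ccont (fun y => F' (g y)) u.
  move=> uAB; apply: (ccont_lip_comp (C := C')) => //.
  by near=> y; apply: LC'; [exact: gQ|near: y; exact: nQ].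
have I := path_cintable ab Aa bB cF'; split => //.
suff [] : rint `[a, b] (fun u => Im (F' (g u) * dg u)) /\
  \int[mu]_(u in `[a, b]) Im (F' (g u) * dg u) = Im (F (g b)) - Im (F (g a)) by [].
apply: (FTC_piecewise (s := sg) (F := fun u => Im (F (g u))) ab Aa bB).
- move=> u uAB us; have [d1 c1] := g_deriv us; split.
    exact: (ccontM (cF' u uAB) c1).2.
  exact: (holo_path hF (nQ u uAB) d1).2.
- move=> u uAB; have [l1 l2] := dg_lim u; have [c1 c2] := cF' u uAB.
  apply: one_sided_lim_ext (one_sided_limD (one_sided_limM c1 l2) (one_sided_limM c2 l1)) => x.
  by rewrite ImM.
- by move=> u uAB; exact: (cF u uAB).2.
Unshelve. all: by end_near. Qed.

End path.
End piecewise_paths.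

(** * Winding numbers and the truncated loop *)

Section contour_integral.
Context {R : realType}.

Lemma rint_cauchy_kernel : rint setT (fun x : R => (1 + x ^+ 2)^-1).
Proof.
have cf (x : R) : {for x, continuous (fun x : R => (1 + x ^+ 2)^-1)}.
  exact: continuous_oneDsqrV.
apply: (@rint_exhaust_bounded _ _ (fun n => `]- n.+1%:R, n.+1%:R[%classic) _ pi).
- by apply: continuous_measurable_fun => x; exact: cf.
- by move=> x _; rewrite invr_ge0 addr_ge0// sqr_ge0.
- apply/nondecreasing_seqP => n; rewrite subsetEset; apply: subset_itv; rewrite bnd_simp.
    by rewrite lerN2 ler_nat.
  by rewrite ler_nat.
- by move=> n; exact: measurable_itv.
- apply/seteqP; split => // x _; exists (Num.truncn `|x|) => //=.
  by rewrite in_itv/= -ltr_norml; exact: truncnS_gt.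
move=> n; have := @Rint_poisson R 1 (- n.+1%:R) n.+1%:R ltr01.
have -> : (fun u : R => 1 / (1 ^+ 2 + u ^+ 2)) = (fun x : R => (1 + x ^+ 2)^-1).
  by apply/funext => u; rewrite div1r expr1n.
move=> /(_ _)[|i E]; first by rewrite gtrN.
split => //; rewrite E !divr1 atanN opprK.
have := atan_ltpi2 (n.+1%:R : R); lra.
Qed.

(** Lets one function integrable on the whole line dominate the exponential tails at both ends of
    the loop. *)
Lemma expRN_cauchy (x : R) : 0 <= x -> expR (- x) <= 4 * (1 + x ^+ 2)^-1.
Proof.
move=> x0; rewrite ler_pdivlMr ?ltr_wpDr ?sqr_ge0// expRN mulrC ler_pdivrMr ?expR_gt0//.
have := expR_ge1Dx (x / 2); have -> : expR x = expR (x / 2) ^+ 2.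
  by rewrite -expRM_natl; congr expR; field.
move: (expR _) => e he; apply: (@le_trans _ _ (4 * (1 + x / 2) ^+ 2)); first by nra.
by rewrite ler_pM2l// lerXn2r// nnegrE; lra.
Qed.

(** A branch of the argument of b + i y, up to a constant, for fixed nonzero b of either sign. *)
Definition argq (b y : R) := atan (y / b).

Lemma is_derive_argq (b y : R) : b != 0 -> is_derive y 1 (argq b) (Re (b +i* y)^-1).
Proof.
move=> b0; have d1 : is_derive y 1 (fun y => y / b) (b^-1).
  apply: is_derive_ext (is_deriveZ b^-1 (is_derive_id y 1)) => //.
    by move=> z; rewrite mulrC.
  by rewrite /GRing.scale/= mulr1.
apply: is_derive_ext (@is_derive1_comp _ atan (fun y => y / b) y _ _ (is_derive1_atan _) d1) => //.
have n0 : b ^+ 2 + y ^+ 2 != 0.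
  by rewrite gt_eqF// ltr_pwDl ?sqr_ge0// exprn_even_gt0.
rewrite Re_invc normc_sqr ReI ImI; field.
by rewrite b0 n0.
Qed.

Lemma is_derive_atan_affine (e k u : R) : is_derive u 1 (fun u => atan (e * u + k)) (e * (1 + (e * u + k) ^+ 2)^-1).
Proof.
have d1 : is_derive u 1 (fun u => e * u + k) e.
  apply: is_derive_ext (is_deriveD (is_deriveZ e (is_derive_id u 1)) (is_derive_cst k u 1)) => //.
  by rewrite /GRing.scale/= mulr1 addr0.
apply: is_derive_ext (@is_derive1_comp _ atan _ u _ _ (is_derive1_atan _) d1) => //.
by rewrite mulrC.
Qed.

Lemma Rint_atan_affine (e k c d : R) : c < d -> e ^+ 2 = 1 ->
  \int[mu]_(u in `[c, d]) (1 + (e * u + k) ^+ 2)^-1 = e * (atan (e * d + k) - atan (e * c + k)).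
Proof.
move=> cd e2; have dF (u : R) : is_derive u 1 (fun u => e * atan (e * u + k)) ((1 + (e * u + k) ^+ 2)^-1).
  apply: is_derive_ext (is_deriveZ e (is_derive_atan_affine e k u)) => //.
  by rewrite /GRing.scale/= mulrA -expr2 e2 mul1r.
rewrite (FTC_cc (F := fun u => e * atan (e * u + k)) cd) ?mulrBr//.
- apply: continuous_at_within => u _.
  have d1 : is_derive u 1 (fun u => e * u + k) e.
    apply: is_derive_ext (is_deriveD (is_deriveZ e (is_derive_id u 1)) (is_derive_cst k u 1)) => //.
    by rewrite /GRing.scale/= mulr1 addr0.
  exact: (continuous_comp (is_derive_cont d1) (@continuous_oneDsqrV R (e * u + k))).
- by apply: continuous_at_within => u _; exact: is_derive_cont (dF u).
Qed.

Lemma atan_inv_neg (b : R) : b < 0 -> atan b^-1 = - (pi / 2) - atan b.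
Proof.
move=> b0; have := atan_gtNpi2 b; have := atan_ltpi2 b => h1 h2.
have a0 : atan b < 0 by rewrite -[X in _ < X](@atan0 R) lt_atan.
rewrite -[RHS]tanK; last by rewrite in_itv/=; apply/andP; split; lra.
congr atan; rewrite -[b in LHS]atanK /tan invf_div.
rewrite -opprD sinN cosN addrC sinDpihalf cosDpihalf.
by rewrite invrN mulrN mulNr opprK.
Qed.

Lemma atan_limy (k : R) : atan (T + k) @[T --> +oo] --> (pi / 2 : R).
Proof.
apply: (@cvg_comp _ _ _ (fun T : R => T + k) atan _ _ _ _ (@cvgy_atan R)).
apply/cvgryPge => M; near=> T; rewrite -lerBlDr//.
Unshelve. all: by end_near. Qed.

Section loop.
Variables (g dg : R -> R[i]) (sg : seq R) (x0 x1 a0 b0 : R).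
Hypotheses (g_deriv : forall u, u \notin sg -> cderiv g u (dg u) /\ ccont dg u)
  (g_cont : forall u, ccont g u)
  (dg_lim : forall u, one_sided_lim (fun x => Re (dg x)) u /\ one_sided_lim (fun x => Im (dg x)) u)
  (g_left : forall u, u <= a0 -> g u = (x0 + u) +i* (-1)) (dg_left : forall u, u < a0 -> dg u = 1)
  (g_right : forall u, b0 <= u -> g u = (x1 - u) +i* 1) (dg_right : forall u, b0 < u -> dg u = -1)
  (g_avoid : forall (l : nat) u, g u + l%:R != 0)
  (g_winding : forall l : nat,
    \int[mu]_(u in `[- T, T]) Im ((g u + l%:R)^-1 * dg u) @[T --> +oo] --> (2 * pi : R)).
Implicit Types (l N : nat) (u m : R).

(** Otherwise one parameter would belong to both ends, with imaginary parts -1 and 1. *)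
Lemma loop_ends : a0 < b0.
Proof.
rewrite ltNge; apply/negP => ba.
have := g_left ba; rewrite (g_right (lexx b0)) => -[_] h; lra.
Qed.

Lemma loop_compact : exists2 B : R, 0 <= B & forall u, a0 <= u <= b0 -> normc (g u) <= B.
Proof.
have [c _ cM] := EVT_max (ltW loop_ends) (continuous_at_within (fun u _ => cont_normc (g_cont u))).
by exists (normc (g c)); [exact: normc_ge0|move=> u uab; apply: cM; rewrite in_itv].
Qed.

Let ccont_pole l u : ccont (fun u => (g u + l%:R)^-1) u.
Proof. by apply: ccontV; [apply: ccontD => //; exact: ccont_cst|exact: g_avoid]. Qed.

Let jf l u := Im ((g u + l%:R)^-1 * dg u).

Lemma rint_pole l (a b : R) : a < b -> rint `[a, b] (jf l).
Proof.
move=> ab; apply: (path_cintable (A := a - 1) (B := b + 1) g_deriv dg_lim ab _ _ _).2.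
- by rewrite ltrBlDr ltrDl.
- by rewrite ltrDl.
- by move=> u _; exact: ccont_pole.
Qed.

(** The discarded pieces lie on Im = -1 and Im = 1; each contributes atan (m + l) + pi / 2 in the
    limit, out of a total of 2 pi. *)
Lemma winding_truncated l m : m - x0 < a0 -> b0 < x1 - m ->
  \int[mu]_(u in `[m - x0, x1 - m]) jf l u = pi - 2 * atan (m + l%:R).
Proof.
move=> ma mb; have ab := loop_ends.
have uu : m - x0 < x1 - m by apply: lt_trans ma (lt_trans ab mb).
set J := LHS.
have E : \forall T \near +oo, \int[mu]_(u in `[- T, T]) jf l u =
    (atan (m + l%:R) + atan (T + (- x0 - l%:R))) + J + (atan (m + l%:R) + atan (T + (- x1 - l%:R))).
  near=> T.
  have T1 : - T < m - x0 by rewrite ltrNl; near: T; apply: nbhs_pinfty_gt; exact: num_real.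
  have T2 : x1 - m < T by near: T; apply: nbhs_pinfty_gt; exact: num_real.
  have [i1 e1] := rint_cat (ltW uu) (ltW T2) (rint_pole l uu) (rint_pole l T2).
  have [_ ->] := rint_cat (ltW T1) (ltW (lt_trans uu T2)) (rint_pole l T1) i1.
  rewrite e1 -/J addrA; congr (_ + _ + _).
    transitivity (\int[mu]_(u in `[- T, m - x0]) (1 + (1 * u + (x0 + l%:R)) ^+ 2)^-1).
      apply: eq_Rintegral => u /set_mem; rewrite /= in_itv/= => /andP[_ um].
      have ua := le_lt_trans um ma.
      rewrite /jf g_left ?(ltW ua)// dg_left// mulr1 Im_invc normc_sqr !ImD !ReD !(ReI, ImI) Renat Imnat.
      by rewrite addr0 opprK sqrrN expr1n div1r mul1r addrC [x0 + u]addrC addrA.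
    rewrite Rint_atan_affine ?expr1n// !mul1r -atanN; congr (atan _ + atan _); ring.
  transitivity (\int[mu]_(u in `[x1 - m, T]) (1 + (- 1 * u + (x1 + l%:R)) ^+ 2)^-1).
    apply: eq_Rintegral => u /set_mem; rewrite /= in_itv/= => /andP[um _].
    have ub := lt_le_trans mb um.
    rewrite /jf g_right ?(ltW ub)// dg_right// mulrN1 ImN Im_invc normc_sqr !ImD !ReD !(ReI, ImI) Renat Imnat.
    by rewrite addr0 expr1n [- 1 * u]mulN1r [- u + _]addrC [x1 + _ - u]addrAC mulNr opprK div1r [_ + 1]addrC.
  rewrite Rint_atan_affine ?sqrrN ?expr1n// mulN1r opprB -atanN; congr (atan _ + atan _); ring.
have lim : \int[mu]_(u in `[- T, T]) jf l u @[T --> +oo] -->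
    (atan (m + l%:R) + pi / 2) + J + (atan (m + l%:R) + pi / 2).
  apply: cvg_trans; first by apply: near_eq_cvg; near=> T; apply/esym; near: T; exact: E.
  apply: cvgD; first apply: cvgD; last by apply: cvgD; [exact: cvg_cst|exact: atan_limy].
    by apply: cvgD; [exact: cvg_cst|exact: atan_limy].
  exact: cvg_cst.
have U : 2 * pi = (atan (m + l%:R) + pi / 2) + J + (atan (m + l%:R) + pi / 2).
  exact: cvg_unique (g_winding l) lim.
lra.
Unshelve. all: by end_near. Qed.

Lemma Rint_lincomb (D : set R) n (c : nat -> R) (f : nat -> R -> R) : measurable D ->
  (forall l, rint D (f l)) -> rint D (fun x => \sum_(l < n) c l * f l x) /\
  \int[mu]_(x in D) (\sum_(l < n) c l * f l x) = \sum_(l < n) c l * \int[mu]_(x in D) f l x.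
Proof.
move=> mD If; elim: n => [|n [IH1 IH2]].
  have E : (fun x => \sum_(l < 0) c l * f l x) = fun x => 0 * f 0%N x.
    by apply/funext => x; rewrite big_ord0 mul0r.
  by rewrite E RintZ// mul0r big_ord0; split => //; exact: rintZ.
have E : (fun x => \sum_(l < n.+1) c l * f l x) =
    fun x => \sum_(l < n) c l * f l x + c n * f n x.
  by apply/funext => x; rewrite big_ord_recr.
have ic := rintZ (c n) mD (If n).
by rewrite E RintD// IH2 RintZ// big_ord_recr; split => //; exact: rintD.
Qed.

Lemma is_derive_lincomb n (c : nat -> R) (h dh : nat -> R -> R) (y : R) :
  (forall l, is_derive y 1 (h l) (dh l y)) ->
  is_derive y 1 (fun y => \sum_(l < n) c l * h l y) (\sum_(l < n) c l * dh l y).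
Proof.
move=> hd; elim: n => [|n IH].
  have -> : (fun y => \sum_(l < 0) c l * h l y) = cst 0.
    by apply/funext => x; rewrite big_ord0.
  by rewrite big_ord0; exact: is_derive_cst.
rewrite big_ord_recr; apply: is_derive_ext (is_deriveD IH (is_deriveZ (c n) (hd n))) => // x.
by rewrite big_ord_recr.
Qed.

Lemma half_integer_dist N k : 2^-1 <= `|- N%:R - 2^-1 + k%:R : R|.
Proof.
have [kN|Nk] := leqP k N.
  rewrite -normrN ler_normr; apply/orP; left.
  have : k%:R <= N%:R :> R by rewrite ler_nat.
  lra.
rewrite ler_normr; apply/orP; left.
have : N.+1%:R <= k%:R :> R by rewrite ler_nat.
by rewrite -natr1; lra.
Qed.

Variables (z0 alpha t : R).
Hypotheses (alpha01 : 0 < alpha < 1) (t_gt0 : 0 < t).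
Let phi := mellin_kernel z0 alpha t.

Definition rres l : R := (- t) ^+ l / l`!%:R * Re (Gamma (z0 - alpha * l%:R)%:C)^-1.

Lemma kresE l : kres z0 alpha t l = (rres l)%:C.
Proof.
apply: complexP; first by rewrite /kres ReM !ReC ImC mul0r subr0.
by rewrite /kres ImM ImC mul0r addr0 Im_Gamma_real mulr0.
Qed.

(* Each pole contributes pi - 2 atan (m + l) to the imaginary part instead of 2 pi; the
   defects, together with the primitive T of the regular part, add up to the integral of
   phi over the vertical segment joining m - i to m + i, which is exponentially small. *)
Lemma contour_residues : exists C N0, forall N, (N0 <= N)%N ->
  let m := - N%:R - 2^-1 in
  [/\ m - x0 < a0, b0 < x1 - m &
    `|\int[mu]_(u in `[m - x0, x1 - m]) Im (phi (g u) * dg u) -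
      2 * pi * \sum_(l < N.+1) rres l| <= C * expR m].
Proof.
have [B B0 gB] := loop_compact; have ab := loop_ends.
have [C [Y [C0 Y0 bnd]]] := mellin_kernel_bound z0 t alpha01.
(* Large enough for m to lie to the left of the middle part of the loop and in the range of
   [mellin_kernel_bound]; the factor 2 is the length of the vertical segment. *)
exists (2 * C), (Num.truncn (B + Y + `|x0| + `|x1| + `|a0| + `|b0| + 2)).+1 => N NN m.
have NB : B + Y + `|x0| + `|x1| + `|a0| + `|b0| + 2 < N%:R.
  by apply: lt_le_trans (truncnS_gt _) _; rewrite ler_nat.
have := ler_norm (- x0); have := ler_norm (- x1); have := ler_norm (- a0); have := ler_norm b0.
rewrite ![`|- _|]normrN => h1 h2 h3 h4.
have p1 := normr_ge0 x0; have p2 := normr_ge0 x1; have p3 := normr_ge0 a0; have p4 := normr_ge0 b0.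
have mm : m = - N%:R - 2^-1 by []; clearbody m.
have ma : m - x0 < a0 by rewrite mm; lra.
have mb : b0 < x1 - m by rewrite mm; lra.
split => //; have uu : m - x0 < x1 - m by apply: lt_trans ma (lt_trans ab mb).
(* The parameter interval is enlarged by e to make its ends interior; 1 / 8 is below the margin 1 /
   4 of Q. *)
pose e : R := 8^-1; have e0 : 0 < e by rewrite invr_gt0.
have Aa : m - x0 - e < m - x0 by rewrite ltrBlDr ltrDl.
have bB : x1 - m < x1 - m + e by rewrite ltrDl.
(* m - 1 / 4 = - N - 3 / 4 separates the poles 0, ..., - N from the next one, so [knum N] is
   holomorphic on Q. *)
pose Q := rect (m - 4^-1) B (- (B + 2)) (B + 2).
have [BR BI] : (forall u, a0 <= u <= b0 -> - B <= Re (g u) <= B) /\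
    (forall u, a0 <= u <= b0 -> - B <= Im (g u) <= B).
  split=> u /gB h; rewrite -ler_norml; apply: le_trans h; [exact: normrRe|exact: normrIm].
have gQ u : m - x0 - e < u < x1 - m + e -> Q (g u).
  move=> /andP[]; rewrite /e => u1 u2; have [ua|au] := leP u a0.
    have := BR a0; rewrite lexx (ltW ab) (g_left (lexx a0)) ReI => /(_ isT) /andP[_ q].
    rewrite (g_left ua); split; rewrite ?ReI ?ImI; apply/andP; split; lra.
  have [bu|ub] := leP b0 u.
    have := BR b0; rewrite lexx (ltW ab) (g_right (lexx b0)) ReI => /(_ isT) /andP[_ q].
    rewrite (g_right bu); split; rewrite ?ReI ?ImI; apply/andP; split; lra.
  have uab : a0 <= u <= b0 by rewrite !ltW.
  have /andP[q1 q2] := BR u uab; have /andP[q3 q4] := BI u uab.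
  by split; apply/andP; split; rewrite ?mm; lra.
have Ql l : (l <= N)%N -> Q (- l%:R).
  move=> lN; have : l%:R <= N%:R :> R by rewrite ler_nat.
  have := ler0n R l => q1 q2.
  by split; rewrite ?ReN ?ImN ?Renat ?Imnat; apply/andP; split; rewrite ?mm; lra.
have Qp s : Q s -> 4^-1 <= Re s + N.+1%:R.
  by move=> [/andP[q _] _]; rewrite -[N.+1%:R]natr1; rewrite mm in q; lra.
have q0 : 0 < 4^-1 :> R by rewrite invr_gt0.
have bQ : cbounded Q by exact: rect_bounded.
have [T [T' [hT split]]] := mellin_kernel_split z0 alpha t_gt0 bQ (@rect_convex R _ _ _ _) q0 Qp Ql.
have gE u : m - x0 - e < u < x1 - m + e ->
    Im (phi (g u) * dg u) = Im (T' (g u) * dg u) + \sum_(l < N.+1) rres l * jf l u.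
  move=> ue; rewrite /phi (split _ (gQ u ue)); last by move=> k _; exact: g_avoid.
  rewrite mulrDl ImD mulr_suml Im_sum; congr (_ + _); apply: eq_bigr => l _.
  by rewrite kresE -mulrA ImM ImC mul0r addr0 ReC.
have gl : g (m - x0) = m +i* (-1).
  by rewrite (g_left (ltW ma)); congr (_ +i* _); ring.
have gr : g (x1 - m) = m +i* 1.
  by rewrite (g_right (ltW mb)); congr (_ +i* _); ring.
have [iT ET] := path_FTC g_deriv g_cont dg_lim uu Aa bB bQ hT gQ.
have [iS ES] := @Rint_lincomb `[m - x0, x1 - m] N.+1 rres jf (measurable_itv _) (fun l => rint_pole l uu).
have -> : \int[mu]_(u in `[m - x0, x1 - m]) Im (phi (g u) * dg u) =
    Im (T (m +i* 1)) - Im (T (m +i* (-1))) + \sum_(l < N.+1) rres l * (pi - 2 * atan (m + l%:R)).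
  transitivity (\int[mu]_(u in `[m - x0, x1 - m])
      (Im (T' (g u) * dg u) + \sum_(l < N.+1) rres l * jf l u)).
    apply: eq_Rintegral => u /set_mem; rewrite /= in_itv/= => /andP[u1 u2]; apply: gE.
    by rewrite (lt_le_trans Aa)// (le_lt_trans u2).
  rewrite (RintD (measurable_itv _) iT.2 iS) ET ES.
  rewrite gl gr; congr (_ + _); apply: eq_bigr => l _.
  by rewrite winding_truncated.
pose E y := Im (T (m +i* y)) + \sum_(l < N.+1) rres l * argq (m + l%:R) y.
have mN0 l : m + l%:R != 0.
  by rewrite mm -normr_gt0; apply: (lt_le_trans _ (half_integer_dist N l)); rewrite invr_gt0.
have mD (y : R) l : (m +i* y) + l%:R = (m + l%:R) +i* y.
  by apply: complexP; rewrite ?(ReD, ImD, Renat, Imnat) ?ReI ?ImI ?addr0.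
have mQ (y : R) : -2 < y < 2 -> Q (m +i* y).
  by move=> /andP[y1 y2]; split; rewrite ?ReI ?ImI; apply/andP; split; lra.
have dE (y : R) : -2 < y < 2 -> is_derive y 1 E (Re (phi (m +i* y))).
  move=> y2; have d1 : cderiv (fun y => T (m +i* y)) y (T' (m +i* y) * 'i).
    apply: (holo_path hT _ (cderiv_vline m y)).
    by near=> z; apply: mQ; near: z; exact: near_itvoo.
  have d2 := @is_derive_lincomb N.+1 rres (fun l => argq (m + l%:R))
    (fun l y => Re ((m + l%:R) +i* y)^-1) y (fun l => is_derive_argq y (mN0 l)).
  apply: is_derive_ext (is_deriveD d1.2 d2) => //.
  rewrite /phi (split _ (mQ y y2)); last first.
    move=> k _; rewrite mD; apply/eqP => /(congr1 (@complex.Re R)) /eqP.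
    by rewrite ReI Re0 (negPf (mN0 k)).
  rewrite ReD Re_sum ImM Re_i Im_i mulr0 addr0 mulr1; congr (_ + _); apply: eq_bigr => l _.
  by rewrite kresE ReM ImC mul0r subr0 ReC mD.
have N11 : -1 < 1 :> R by lra.
(* The mean value theorem replaces the integral over the segment by one value of the kernel, to
   which the bound applies since m is at distance at least 1 / 2 from every pole. *)
have [c] : exists2 c, c \in `]-1, 1[%R & E 1 - E (-1) = Re (phi (m +i* c)) * (1 - -1).
  apply: MVT => //.
    by move=> y; rewrite in_itv/= => /andP[y1 y2]; apply: dE; apply/andP; split; lra.
  apply: continuous_at_within => y; rewrite /= in_itv/= => /andP[y1 y2].
  by apply: is_derive_cont (dE y _); apply/andP; split; lra.
rewrite in_itv/= => /andP[c1 c2] Ec.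
have -> : Im (T (m +i* 1)) - Im (T (m -i* 1)) +
    \sum_(l < N.+1) rres l * (pi - 2 * atan (m + l%:R)) - 2 * pi * \sum_(l < N.+1) rres l =
    E 1 - E (-1).
  rewrite /E mulr_sumr -[LHS]addrA opprD [RHS]addrACA -!sumrB; congr (_ + _).
  apply: eq_bigr => l _; have lN : l%:R <= N%:R :> R by rewrite ler_nat -ltnS.
  have ml : m + l%:R < 0 by rewrite mm; lra.
  by rewrite /argq mulN1r div1r atanN (atan_inv_neg ml); field.
rewrite Ec normrM mulrC [X in X * _]ger0_norm; last by lra.
have -> : 1 - -1 = 2 :> R by lra.
rewrite -mulrA ler_pM2l//; apply: le_trans (normrRe _) _; rewrite -{2}(ReI m c); apply: bnd.
- by rewrite ReI mm; lra.
- by rewrite ImI ler_norml; apply/andP; split; apply: ltW.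
move=> k; rewrite mD; apply: le_trans (half_integer_dist N k) _.
by rewrite -mm -{1}(ReI (m + k%:R) c); exact: normrRe.
Unshelve. all: by end_near. Qed.

(** The number N of shifts depends on the point; near u the kernel is the quotient of [knum N] by a
    product without zeros on the loop. *)
Lemma ccont_mellin_kernel u : ccont (fun v => phi (g v)) u.
Proof.
pose N := (Num.truncn (`|Re (g u)| + 1)).+1.
have NR : `|Re (g u)| + 1 < N%:R by exact: truncnS_gt.
pose Q : set R[i] := [set s | normc s <= normc (g u) + 1 /\ 4^-1 <= Re s + N.+1%:R].
have bQ : cbounded Q by exists (normc (g u) + 1); [rewrite addr_ge0 ?normc_ge0|move=> s []].
have q0 : 0 < 4^-1 :> R by rewrite invr_gt0.
have [K' hK] := holo_knum z0 alpha t bQ q0 (fun s h => h.2).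
have [C C0 LC] := holo_lip bQ hK.
have gu : Q (g u).
  split; first by rewrite lerDl.
  have := ler_norm (- Re (g u)); rewrite normrN -[N.+1%:R]natr1; lra.
have near_Q : \forall y \near u, Q (g y).
  have lim := cont_normc (ccontD (g_cont u) (ccont_cst (- g u) u)).
  rewrite /prop_for /continuous_at subrr normc0 in lim.
  have near1 : \forall y \near u, normc (g y - g u) <= 1 by exact: (cvgr_le _ lim _ ltr01).
  near=> y; have h : normc (g y - g u) <= 1 by near: y.
  split.
    by rewrite -[g y](subrK (g u)) addrC; apply: le_trans (normc_triangle _ _) _; rewrite lerD2l.
  have := le_trans (normrRe _) h; rewrite ReB => /(le_trans (ler_norm _)) => h2.
  have := le_trans (normrRe _) h; rewrite ReB ler_norml => /andP[h3 _].
  have := ler_norm (- Re (g u)); rewrite normrN -[N.+1%:R]natr1; lra.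
have ck : ccont (fun v => knum z0 alpha t N (g v)) u.
  by apply: (ccont_lip_comp (C := C)) => //; near=> y; apply: LC => //; near: y.
have cr n : ccont (fun v => rising (g v) n) u.
  elim: n => [|n IH].
    have -> : (fun v => rising (g v) 0) = fun=> 1.
      by apply/funext => v; rewrite /rising big_ord0.
    exact: ccont_cst.
  have -> : (fun v => rising (g v) n.+1) = fun v => rising (g v) n * (g v + n%:R).
    by apply/funext => v; rewrite risingS.
  by apply: ccontM => //; apply: ccontD => //; exact: ccont_cst.
have rn0 n : rising (g u) n != 0.
  elim: n => [|n IH]; first by rewrite /rising big_ord0 oner_neq0.
  by rewrite risingS mulf_neq0// g_avoid.
have cq : ccont (fun v => knum z0 alpha t N (g v) * (rising (g v) N.+1)^-1) u.
  by apply: ccontM => //; exact: ccontV.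
have E : \forall y \near u, phi (g y) = knum z0 alpha t N (g y) * (rising (g y) N.+1)^-1.
  near=> y; apply: mellin_kernel_knum; apply: lt_le_trans q0 _.
  by have [] : Q (g y) by near: y.
have aux (p : R[i] -> R) :
    {for u, continuous (fun v => p (knum z0 alpha t N (g v) * (rising (g v) N.+1)^-1))} ->
    {for u, continuous (fun v => p (phi (g v)))}.
  move=> cp; rewrite /prop_for /continuous_at (nbhs_singleton E).
  apply: cvg_trans cp; apply: near_eq_cvg; near=> y; congr p; apply/esym; near: y; exact: E.
by split; apply: aux; [exact: cq.1|exact: cq.2].
Unshelve. all: by end_near. Qed.

Let f u := Im (phi (g u) * dg u).

(** Treats both ends at once: c is the direction of travel and e the sign that makes e * u
    nonnegative on the interval. *)
Lemma rint_tail (I : interval R) (c x e : R) : (forall u, [set` I] u -> dg u = c%:C) -> `|c| = 1 ->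
  measurable [set` I] -> e ^+ 2 = 1 ->
  (exists C : R, 0 <= C /\ forall u, [set` I] u -> 0 <= e * u /\ normc (phi (g u)) <= C * expR (x - e * u)) ->
  rint [set` I] f.
Proof.
move=> dgc c1 mI e2 [C [C0 bnd]].
apply: (eq_rint mI (h := fun u => c * Im (phi (g u)))).
  by move=> u Iu; rewrite /f dgc// ImM ImC ReC mulr0 add0r mulrC.
apply: rintZ => //.
apply: (rint_dominated (g := fun u => C * expR x * 4 * (1 + u ^+ 2)^-1)) => //.
- apply: measurable_funS (_ : measurable_fun setT (fun u => Im (phi (g u)))) => //.
  by apply: continuous_measurable_fun => u; exact: (ccont_mellin_kernel u).2.
- by apply: rintZ => //; apply: integrableS rint_cauchy_kernel.
move=> u /bnd [eu bu]; apply: le_trans (normrIm _) _; apply: le_trans bu _.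
rewrite expRD -[leRHS]mulrA mulrA; apply: ler_wpM2l; first by rewrite mulr_ge0 ?expR_ge0.
have -> : u ^+ 2 = (e * u) ^+ 2 by rewrite exprMn e2 mul1r.
exact: expRN_cauchy.
Qed.

Lemma normc_shift_Im s (c : R) : `|Im s| = 1 -> 2^-1 <= normc (s + c%:C).
Proof.
move=> s1; apply: le_trans (normrIm _); rewrite ImD ImC addr0 s1; lra.
Qed.

Lemma rint_contour : rint setT f.
Proof.
have ab := loop_ends.
have [C [Y [C0 Y0 bnd]]] := mellin_kernel_bound z0 t alpha01.
pose a := - (1 + Y + `|x0| + `|a0|); pose b := 1 + Y + `|x1| + `|b0|.
have := ler_norm x0; have := ler_norm x1; have := ler_norm (- a0); have := ler_norm b0.
rewrite ![`|- _|]normrN => h1 h2 h3 h4.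
have p1 := normr_ge0 x0; have p2 := normr_ge0 x1; have p3 := normr_ge0 a0; have p4 := normr_ge0 b0.
have aa : a < a0 by rewrite /a; lra.
have bb : b0 < b by rewrite /b; lra.
have a00 : a <= 0 by rewrite /a; lra.
have b00 : 0 <= b by rewrite /b; lra.
have ax : a + x0 <= - Y by rewrite /a; lra.
have bx : x1 - b <= - Y by rewrite /b; lra.
have ab' : a < b by lra.
have i2 : rint `[a, b] f.
  apply: (path_cintable (A := a - 1) (B := b + 1) g_deriv dg_lim ab' _ _ _).2.
  - by rewrite ltrBlDr ltrDl.
  - by rewrite ltrDl.
  - by move=> u _; exact: ccont_mellin_kernel.
have i1 : rint `]-oo, a[ f.
  apply: (@rint_tail _ 1 x0 (-1)) => //.
  - by move=> u; rewrite /= in_itv/= => ua; rewrite dg_left// (lt_trans ua).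
  - by rewrite normr1.
  - by rewrite sqrrN expr1n.
  exists C; split => // u; rewrite /= in_itv/= => ua; have ua0 : u <= a0 by lra.
  split; first by lra.
  rewrite (g_left ua0) mulN1r opprK -{2}[x0 + u](ReI _ (-1)); apply: bnd.
  - by rewrite ReI; lra.
  - by rewrite ImI normrN normr1.
  - by move=> k; rewrite natC; apply: normc_shift_Im; rewrite ImI normrN normr1.
have i3 : rint `]b, +oo[ f.
  apply: (@rint_tail _ (-1) x1 1) => //.
  - move=> u; rewrite /= in_itv/= andbT => bu; rewrite dg_right ?rmorphN1//; exact: lt_trans bu.
  - by rewrite normrN normr1.
  - by rewrite expr1n.
  exists C; split => // u; rewrite /= in_itv/= andbT => bu; have bu0 : b0 <= u by lra.
  split; first by lra.
  rewrite (g_right bu0) mul1r -{2}[x1 - u](ReI _ 1); apply: bnd.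
  - by rewrite ReI; lra.
  - by rewrite ImI normr1.
  - by move=> k; rewrite natC; apply: normc_shift_Im; rewrite ImI normr1.
have -> : [set: R] = (`]-oo, a[ `|` `[a, b]) `|` `]b, +oo[.
  apply/esym; apply/seteqP; split => // u _.
  have [ua|au] := ltP u a; first by left; left; rewrite /= in_itv.
  have [ub|bu] := leP u b; first by left; right; rewrite /= in_itv/= au.
  by right; rewrite /= in_itv/= andbT.
apply: rint_setU => //; first exact: measurableU.
  apply/disj_setPS => u [[|]] /=; rewrite !in_itv/= ?andbT.
    by move=> h; rewrite ltNge (ltW (lt_trans h ab')).
  by move=> /andP[_ h]; rewrite ltNge h.
apply: rint_setU => //.
by apply/disj_setPS => u [] /=; rewrite !in_itv/= => h /andP[]; rewrite leNgt h.
Qed.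

Lemma contour_integral_series :
  2 * pi * \sum_(l < N.+1) rres l @[N --> \oo] --> \int[mu]_(u in setT) f u.
Proof.
have [C [N0 HN]] := contour_residues.
pose m (n : nat) : R := - n%:R - 2^-1.
have lim : (\int[mu]_(u in `[m n - x0, x1 - m n]) f u) @[n --> \oo] --> \int[mu]_(u in setT) f u.
  apply: (@Rint_exhaust _ setT (fun n => `[m n - x0, x1 - m n]%classic)) => //; last exact: rint_contour.
  move=> u _; exists (Num.truncn (`|u| + `|x0| + `|x1|)).+1 => // n /= nn.
  have nR : `|u| + `|x0| + `|x1| < n%:R.
    by apply: lt_le_trans (truncnS_gt _) _; rewrite ler_nat.
  have := ler_norm u; have := ler_norm (- u); have := ler_norm (- x0); have := ler_norm (- x1).
  rewrite ![`|- _|]normrN => h1 h2 h3 h4.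
  have p1 := normr_ge0 x0; have p2 := normr_ge0 x1; have p3 := normr_ge0 u.
  by rewrite /= in_itv/= /m; apply/andP; split; lra.
have e0 : `|C| * n.+1%:R^-1 @[n --> \oo] --> (0 : R).
  rewrite -(mulr0 `|C|); apply: cvgM; [exact: cvg_cst|exact: inv_nat_cvg0].
have d0 : (2 * pi * \sum_(l < n.+1) rres l - \int[mu]_(u in `[m n - x0, x1 - m n]) f u)
    @[n --> \oo] --> (0 : R).
  apply/norm_cvg0P; apply: (squeeze_cvgr _ (cvg_cst 0) e0).
  exists N0 => // n /= /HN [_ _ h]; rewrite normr_ge0/= distrC; apply: le_trans h _.
  apply: (@le_trans _ _ (`|C| * expR (- n%:R - 2^-1))).
    by rewrite ler_wpM2r ?expR_ge0// ler_norm.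
  rewrite ler_wpM2l// -opprD expRN lerV2_pos//; apply: le_trans (expR_ge1Dx _).
  by rewrite -natr1; lra.
have -> : (fun N => 2 * pi * \sum_(l < N.+1) rres l) =
    fun n => (2 * pi * \sum_(l < n.+1) rres l - \int[mu]_(u in `[m n - x0, x1 - m n]) f u) +
      \int[mu]_(u in `[m n - x0, x1 - m n]) f u.
  by apply/funext => n; rewrite subrK.
by rewrite -[X in _ --> X]add0r; exact: cvgD.
Unshelve. all: by end_near. Qed.

End loop.
End contour_integral.

(** * The Fox function as a residue series *)

Section fox_series.
Context {R : realType}.

Lemma piecewise_C1_lim (f : R -> R) (s : seq R) :
  (forall u, u \notin s -> derivable f u 1 /\ {for u, continuous (derive1 f)}) ->
  (forall u, u \in s -> cvg (derive1 f x @[x --> u^'-]) /\ cvg (derive1 f x @[x --> u^'+])) ->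
  forall u, one_sided_lim (derive1 f) u.
Proof.
move=> h1 h2 u; have [us|us] := boolP (u \in s); first exact: h2.
exact: one_sided_lim_cont (h1 u us).2.
Qed.

Lemma derive1_near (f k : R -> R) (u d : R) : (\forall y \near u, k y = f y) ->
  is_derive u 1 k d -> derive1 f u = d.
Proof. by move=> kf /(near_eq_is_derive kf) [_ <-]; rewrite derive1E. Qed.

Lemma foxH_series (L : R -> R[i]) (r alpha t : R) :
  loop_around (Gamma_poles (r - 1) 1) L -> 0 < alpha < 1 -> 0 < t ->
  t `^ (r - 1) * \sum_(l < N.+1) rres (r * (1 - alpha)) alpha t l @[N --> \oo] -->
    Re (foxH L (r - alpha, alpha) (r - 1, 1) t).
Proof.
move=> [[cRe [s1 [Re1s Re2s]]] [cIm [s2 [Im1s Im2s]]] [a [xa La]] [b [xb Lb]] Lp Lw] a01 t0.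
(* Translation by r - 1 puts the poles at the integers - l and turns r - alpha + alpha s into z0 +
   alpha (s + r - 1) with z0 = r (1 - alpha); t^(-s) then yields the factor t^(r - 1). *)
pose g u : R[i] := L u + (r - 1)%:C; pose dg := path_derive L.
have gRe u : Re (g u) = Re (L u) + (r - 1) by rewrite ReD ReC.
have gIm u : Im (g u) = Im (L u) by rewrite ImD ImC addr0.
pose sg := s1 ++ s2.
have g_cont u : ccont g u.
  split; last by apply: cont_ext (cIm u) => y; rewrite gIm.
  by apply: cont_ext (cvgD (cRe u) (cvg_cst (r - 1))) => y; rewrite gRe.
have g_deriv u : u \notin sg -> cderiv g u (dg u) /\ ccont dg u.
  rewrite mem_cat negb_or => /andP[/Re1s [dR cR] /Im1s [dI cI]]; split; last first.
    by split; [exact: cR|exact: cI].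
  split.
    apply: is_derive_ext (is_deriveD (DeriveDef dR erefl) (is_derive_cst (r - 1) u 1)) => [y|].
      by rewrite gRe.
    by rewrite addr0 -derive1E.
  apply: is_derive_ext (DeriveDef dI erefl) => [y|]; first by rewrite gIm.
  by rewrite -derive1E.
have dg_lim u : one_sided_lim (fun x => Re (dg x)) u /\ one_sided_lim (fun x => Im (dg x)) u.
  by split; [exact: (piecewise_C1_lim Re1s Re2s)|exact: (piecewise_C1_lim Im1s Im2s)].
have g_left u : u <= a -> g u = (xa + (r - 1) + u) +i* (-1).
  by move=> /La E; apply: complexP; rewrite ?gRe ?gIm E ?ReI ?ImI// addrAC.
have dg_left u : u < a -> dg u = 1.
  move=> ua; have n : \forall y \near u, L y = (xa + y) +i* (-1).
    by near=> y; apply: La; apply: ltW; near: y; exact: lt_nbhsl.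
  apply: complexP; rewrite /dg/path_derive ?ReI ?ImI.
    apply: (@derive1_near _ (fun y => xa + y)); first by near=> y; rewrite (near n y).
    by apply: is_derive_ext (is_deriveD (is_derive_cst xa u 1) (is_derive_id u 1)) => //; rewrite add0r.
  apply: (@derive1_near _ (fun=> -1)); first by near=> y; rewrite (near n y).
have g_right u : b <= u -> g u = (xb + (r - 1) - u) +i* 1.
  by move=> /Lb E; apply: complexP; rewrite ?gRe ?gIm E ?ReI ?ImI// addrAC.
have dg_right u : b < u -> dg u = -1.
  move=> ub; have n : \forall y \near u, L y = (xb - y) +i* 1.
    by near=> y; apply: Lb; apply: ltW; near: y; exact: lt_nbhsr.
  apply: complexP; rewrite /dg/path_derive ?ReI ?ImI.
    apply: (@derive1_near _ (fun y => xb - y)); first by near=> y; rewrite (near n y).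
    apply: is_derive_ext (is_deriveB (is_derive_cst xb u 1) (is_derive_id u 1)) => //.
    by rewrite sub0r.
  apply: (@derive1_near _ (fun=> 1)); first by near=> y; rewrite (near n y).
  by rewrite oppr0; exact: is_derive_cst.
have gpole (l : nat) u : L u - Gamma_poles (r - 1) 1 l = g u + l%:R.
  rewrite /Gamma_poles divr1 natC /g -[RHS]addrA -(rmorphD (real_complex R)).
  by congr (_ + _); rewrite -(rmorphN (real_complex R)) opprK.
have g_avoid (l : nat) u : g u + l%:R != 0 by rewrite -gpole subr_eq0.
have g_winding (l : nat) :
    \int[mu]_(u in `[- T, T]) Im ((g u + l%:R)^-1 * dg u) @[T --> +oo] --> (2 * pi : R).
  have [_] := Lw l; apply: cvg_trans; apply: near_eq_cvg; near=> T.
  rewrite /path_integral /cintegral ImI; apply: eq_Rintegral => u _.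
  by rewrite gpole.
have p0 := pi_gt0 R; pose z0 := r * (1 - alpha).
have lim := contour_integral_series g_deriv g_cont dg_lim g_left dg_left g_right dg_right
  g_avoid g_winding (z0 := z0) a01 t0.
have IJ := rint_contour g_deriv g_cont dg_lim g_left dg_left g_right dg_right g_avoid z0 t a01.
set J := \int[mu]_u _ in lim.
have FE u : Gamma ((r - 1)%:C + 1%:C * L u) / Gamma ((r - alpha)%:C + alpha%:C * L u) *
    cpow t (- L u) * dg u = (t `^ (r - 1))%:C * (mellin_kernel z0 alpha t (g u) * dg u).
  have e1 : (r - 1)%:C + 1%:C * L u = g u by rewrite rmorph1 mul1r addrC.
  have e2 : (r - alpha)%:C + alpha%:C * L u = z0%:C + alpha%:C * g u.
    rewrite /g mulrDr addrCA addrC -rmorphM -rmorphD; congr (_%:C + _).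
    by rewrite /z0; ring.
  have e3 : cpow t (- L u) = (t `^ (r - 1))%:C * cpow t (- g u).
    rewrite /powR gt_eqF// -cexpC /cpow -cexpD; congr cexp.
    by rewrite rmorphM -mulrDl /g opprD addrCA subrr addr0.
  by rewrite e1 e2 e3 /mellin_kernel [_ / _ * (_ * _)]mulrCA -!mulrA.
have -> : Re (foxH L (r - alpha, alpha) (r - 1, 1) t) = t `^ (r - 1) * ((2 * pi)^-1 * J).
  rewrite /foxH ReM Re_invc Im_invc normc_sqr ReI ImI mul0r mul0r sub0r !mulNr opprK.
  rewrite /path_integral /cintegral ImI /=.
  have -> : \int[mu]_u Im (Gamma ((r - 1)%:C + 1%:C * L u) / Gamma ((r - alpha)%:C + alpha%:C * L u) *
    cpow t (- L u) * path_derive L u) = t `^ (r - 1) * J.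
    rewrite -RintZ//; apply: eq_Rintegral => u _; rewrite -/(dg u) FE.
    by rewrite ImM ImC mul0r addr0 ReC.
  rewrite expr0n add0r mulrCA; congr (_ * (_ * _)).
  by rewrite expr2 invfM mulrA mulfV ?mul1r// gt_eqF// mulr_gt0.
have -> : (fun N => t `^ (r - 1) * \sum_(l < N.+1) rres z0 alpha t l) =
    fun N => t `^ (r - 1) * ((2 * pi)^-1 * (2 * pi * \sum_(l < N.+1) rres z0 alpha t l)).
  apply/funext => N; congr (_ * _); rewrite mulrA mulVf ?mul1r//.
  by rewrite gt_eqF// mulr_gt0.
by apply: cvgM; [exact: cvg_cst|apply: cvgM; [exact: cvg_cst|exact: lim]].
Unshelve. all: by end_near. Qed.

End fox_series.

(** * The law of the product *)

Section product_law.
Context d (T : measurableType d) (R : realType) (P : probability T R).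
Variables (Z Y : {RV P >-> R}) (rho f : R -> R) (a : R).
Hypotheses (mrho : measurable_fun setT rho) (mf : measurable_fun setT f)
  (rho0 : forall z, 0 <= rho z) (f0 : forall y, 0 <= f y)
  (dZ : forall A : set R, measurable A -> distribution P Z A = (\int[mu]_t (\1_A t * rho t)%:E)%E)
  (dY : forall A : set R, measurable A -> distribution P Y A = (\int[mu]_t (\1_A t * f t)%:E)%E)
  (ZY : independent_RV P Z Y).

Let pair (w : T) : R * R := (Z w, Y w).

Let mpair : measurable_fun setT pair.
Proof. by apply: measurable_fun_pair; exact: measurable_funP. Qed.

(** Independence is the product formula on rectangles, which determine the measure. *)
Lemma joint_law (B : set (R * R)) : measurable B ->
  P (pair @^-1` B) = (distribution P Z \x distribution P Y)%E B.
Proof.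
move=> mB; pose m := measure_function_pushforward__canonical__measure_function_Measure P mpair.
rewrite (@product_measure_unique _ _ _ _ _ (distribution P Z) (distribution P Y) m)// => A C mA mC; exact: ZY.
Qed.

Lemma measurable_mulpow : measurable_fun setT (fun p : R * R => p.1 `^ a * p.2).
Proof.
by apply: measurable_funM => //; exact: (measurableT_comp (measurable_powR a)).
Qed.

Lemma law_powR_mul (A : set R) : measurable A -> distribution P (powR_mul Z Y a) A =
  (\int[mu]_z \int[mu]_y (rho z * f y * \1_A (z `^ a * y))%:E)%E.
Proof.
move=> mA; pose B : set (R * R) := (fun p => p.1 `^ a * p.2) @^-1` A.
have mB : measurable B by rewrite -[B]setTI; exact: measurable_mulpow.
rewrite -[LHS]/(P (pair @^-1` B)) joint_law//.
have mh : measurable_fun setT (fun p : R * R => (f p.2 * \1_A (p.1 `^ a * p.2))%:E).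
  apply/measurable_EFinP; apply: measurable_funM; first exact: measurableT_comp.
  apply: (measurableT_comp (_ : measurable_fun setT (\1_A : R -> R))) => //.
  exact: measurable_mulpow.
have h0 (p : R * R) : (0 <= (f p.2 * \1_A (p.1 `^ a * p.2))%:E)%E by rewrite lee_fin mulr_ge0.
have ind1 z y : \1_(xsection B z) y = \1_A (z `^ a * y) :> R.
  by rewrite !indicE; congr (nat_of_bool _)%:R; rewrite mem_xsection; apply/idP/idP => /set_mem h; exact: mem_set.
have -> : ((distribution P Z \x distribution P Y) B =
    \int[distribution P Z]_z \int[mu]_y (f y * \1_A (z `^ a * y))%:E)%E.
  rewrite /product_measure1 /=; apply: eq_integral => z _ /=.
  rewrite dY; last exact: measurable_xsection.
  by apply: eq_integral => y _; rewrite ind1 mulrC.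
rewrite (@fubini_tonelli _ _ _ _ _ (distribution P Z) mu _ mh)//.
have ind2 y : (\int[distribution P Z]_z (f y * \1_A (z `^ a * y))%:E =
    \int[mu]_z (rho z * f y * \1_A (z `^ a * y))%:E)%E.
  pose S : set R := (fun z => z `^ a * y) @^-1` A.
  have mS : measurable S.
    by rewrite -[S]setTI; exact: (measurable_fun_pair1 y measurable_mulpow).
  have iS z : \1_A (z `^ a * y) = \1_S z :> R by rewrite !indicE; congr (nat_of_bool _)%:R; apply/idP/idP => /set_mem h; exact: mem_set.
  transitivity ((f y)%:E * distribution P Z S)%E.
    rewrite -[S]setIT -(integral_indic (distribution P Z) measurableT mS).
    rewrite -ge0_integralZl_EFin//.
    by apply/measurable_EFinP; exact: measurable_indic.
  rewrite dZ// -ge0_integralZl_EFin//; last 2 first.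
  - by move=> z _; rewrite lee_fin mulr_ge0.
  - by apply/measurable_EFinP; apply: measurable_funM => //; exact: measurable_indic.
  by apply: eq_integral => z _; rewrite iS -EFinM; congr EFin; ring.
transitivity (\int[mu]_y \int[mu]_z (rho z * f y * \1_A (z `^ a * y))%:E)%E.
  by apply: eq_integral => y _; exact: ind2.
pose k (p : R * R) := (rho p.1 * f p.2 * \1_A (p.1 `^ a * p.2))%:E.
have mk : measurable_fun setT k.
  apply/measurable_EFinP; apply: measurable_funM.
    by apply: measurable_funM; exact: measurableT_comp.
  apply: (measurableT_comp (_ : measurable_fun setT (\1_A : R -> R))) => //.
  exact: measurable_mulpow.
have k0 p : (0 <= k p)%E by rewrite lee_fin !mulr_ge0.
exact/esym/(@fubini_tonelli _ _ _ _ _ mu mu k).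
Qed.
End product_law.

(** * Scale mixtures of densities *)

Section mixture.
Context {R : realType}.

Lemma powRD_gt0 (x a b : R) : 0 < x -> x `^ (a + b) = x `^ a * x `^ b.
Proof. by move=> x0; rewrite /powR gt_eqF// mulrDl expRD. Qed.

(** Substitution y = z^(- a) w in the inner integral, then Tonelli, so that the indicator of A
    depends on the outer variable only. For z <= 0 the inner integrals vanish with rho. *)
Lemma mixture_scaling (rho f : R -> R) (a : R) (A : set R) :
  measurable_fun setT rho -> measurable_fun setT f ->
  (forall z, 0 <= rho z) -> (forall y, 0 <= f y) -> (forall z, z <= 0 -> rho z = 0) ->
  measurable A ->
  (\int[mu]_z \int[mu]_y (rho z * f y * \1_A (z `^ a * y))%:E =
   \int[mu]_w \int[mu]_z (rho z * z `^ (- a) * f (z `^ (- a) * w) * \1_A w)%:E)%E.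
Proof.
move=> mrho mf rho0 f0 rhoN mA.
pose k (p : R * R) := (rho p.1 * p.1 `^ (- a) * f (p.1 `^ (- a) * p.2) * \1_A p.2)%:E.
have mp : measurable_fun setT (fun p : R * R => p.1 `^ (- a)).
  exact: (measurableT_comp (measurable_powR (- a))).
have mk : measurable_fun setT k.
  apply/measurable_EFinP; apply: measurable_funM; last first.
    by apply: measurableT_comp => //; exact: measurable_indic.
  apply: measurable_funM; first by apply: measurable_funM => //; exact: measurableT_comp.
  by apply: (measurableT_comp mf); exact: measurable_funM.
have k0 p : (0 <= k p)%E by rewrite lee_fin !mulr_ge0 ?powR_ge0.
transitivity (\int[mu]_z \int[mu]_w (rho z * z `^ (- a) * f (z `^ (- a) * w) * \1_A w)%:E)%E;
  last exact: (@fubini_tonelli _ _ _ _ _ mu mu k).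
apply: eq_integral => z _; have [z0|z0] := leP z 0.
  by apply: eq_integral => y _; rewrite rhoN// !mul0r.
have c0 : 0 < z `^ (- a) by rewrite powR_gt0.
have cc : z `^ a * z `^ (- a) = 1 by rewrite -powRD_gt0// subrr powRr0.
have mF : measurable_fun setT (fun y => (rho z * f y * \1_A (z `^ a * y))%:E).
  apply/measurable_EFinP; apply: measurable_funM.
    by apply: measurable_funM.
  by apply: (measurableT_comp (_ : measurable_fun setT (\1_A : R -> R))).
rewrite (@ge0_integral_affine _ (z `^ (- a)) 0 setT)//; last first.
  by move=> y _; rewrite lee_fin !mulr_ge0.
rewrite preimage_setT -ge0_integralZl_EFin ?powR_ge0//; last 2 first.
- by move=> y _; rewrite lee_fin !mulr_ge0.
- by apply: (measurableT_comp mF); exact: measurable_affine.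
apply: eq_integral => y _; rewrite -EFinM addr0 mulrA cc mul1r; congr EFin; ring.
Qed.

(** Extension by 0 makes the density measurable and nonnegative on the whole line, as Tonelli and
    the substitution require. *)
Lemma density_restrict d (T : measurableType d) (P : probability T R) (X : {RV P >-> R}) (h : R -> R) :
  has_density_pos P X h -> let f := h \_ `]0, +oo[ in
  [/\ measurable_fun setT f, forall y, 0 <= f y, forall y, y <= 0 -> f y = 0,
    forall y, 0 < y -> f y = h y &
    forall A : set R, measurable A -> distribution P X A = (\int[mu]_t (\1_A t * f t)%:E)%E].
Proof.
move=> [mh h0 dX] f; have fE y : f y = if 0 < y then h y else 0.
  rewrite /f patchE; case: ifPn => [/set_mem|/negP ny]; first by rewrite /= in_itv/= andbT => ->.
  by case: ifPn => // y0; case: ny; apply/mem_set; rewrite /= in_itv/= andbT.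
split.
- exact/(measurable_restrictT h (measurable_itv _)).
- by move=> y; rewrite fE; case: ifP => // /h0.
- by move=> y y0; rewrite fE ltNge y0.
- by move=> y y0; rewrite fE y0.
move=> A mA; rewrite dX// integral_mkcond; apply: eq_integral => t _.
rewrite patchE indicE fE; case: ifPn => [/set_mem[At]|/negP nt].
  by rewrite /= in_itv/= andbT (mem_set At) mul1r => ->.
case: ifPn => t0; last by rewrite mulr0.
have [/set_mem At|_] := boolP (t \in A); last by rewrite mul0r.
by case: nt; apply/mem_set; split => //=; rewrite in_itv/= andbT.
Qed.

(** [fine] sends both infinities to 0, so a positive value certifies finiteness. *)
Lemma fine_pos (x : \bar R) (c : R) : 0 < c -> fine x = c -> x = c%:E.
Proof. by case: x => [x _ <-//| |] c0 /= E; rewrite -E ltxx in c0. Qed.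

(** The exponent r (1 - alpha) - 1 arises as (r - 1) - alpha - alpha (r - 1), from the density of Z,
    the Jacobian and the power in the density of Y. *)
Lemma mixture_kernel (r alpha : R) (g f : R -> R) (w : R) : 0 < r -> 0 < w ->
  measurable_fun setT f -> (forall y, 0 <= f y) ->
  (forall y, 0 < y -> f y = y `^ (r - 1) * (g y / pi)) ->
  \int[mu]_(x in `]0, +oo[) (gam (r * (1 - alpha)) x * g (w * x `^ (- alpha))) = pi * expR (- w) ->
  let rho := gamma_density r \_ `]0, +oo[ in
  measurable_fun setT rho -> (forall z, 0 <= rho z) ->
  (\int[mu]_z (rho z * z `^ (- alpha) * f (z `^ (- alpha) * w))%:E = (rho w)%:E)%E.
Proof.
move=> r0 w0 mf f0 fE G rho mrho rho0.
have p0 := pi_gt0 R; have g0 := rgamma_gt0 r0.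
have rhoE z : 0 < z -> rho z = (rgamma r)^-1 * z `^ (r - 1) * expR (- z).
  move=> z0; rewrite /rho patchE ifT; last by apply/mem_set; rewrite /= in_itv/= andbT.
  by rewrite /gamma_density Gamma_euler// euler_Gamma_real ReC.
have rhoN z : ~ `]0, +oo[%classic z -> rho z = 0.
  by move=> zn; rewrite /rho patchE ifN//; apply/negP => /set_mem.
pose C := w `^ (r - 1) / (rgamma r * pi).
have C0 : 0 < C by rewrite divr_gt0 ?powR_gt0// mulr_gt0.
pose phi z := rho z * z `^ (- alpha) * f (z `^ (- alpha) * w).
have phi0 z : 0 <= phi z by rewrite !mulr_ge0 ?powR_ge0.
have mphi : measurable_fun setT phi.
  apply: measurable_funM; first by apply: measurable_funM.
  by apply: (measurableT_comp mf); apply: measurable_funM.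
have phiE z : 0 < z -> gam (r * (1 - alpha)) z * g (w * z `^ (- alpha)) = C^-1 * phi z.
  move=> z0; rewrite /phi rhoE// fE ?mulr_gt0 ?powR_gt0// [w * _]mulrC.
  rewrite powRM ?powR_ge0 ?(ltW w0)// -powRrM gam_powR// /C.
  have -> : z `^ (r * (1 - alpha) - 1) = z `^ (r - 1) * z `^ (- alpha) * z `^ (- alpha * (r - 1)).
    by rewrite -!powRD_gt0//; congr powR; ring.
  have F (x1 x2 x3 e y q G' p : R) : q != 0 -> G' != 0 -> p != 0 ->
      x1 * x2 * x3 * e * y = (q / (G' * p))^-1 * (G'^-1 * x1 * e * x2 * (x3 * q * (y / p))).
    by move=> q0 G0 p1; field; rewrite q0 G0 p1.
  by apply: F; rewrite gt_eqF// powR_gt0.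
have E : (\int[mu]_(x in `]0%R, +oo[) (gam (r * (1 - alpha)) x * g (w * x `^ (- alpha)))%:E =
    (C^-1)%:E * \int[mu]_z (phi z)%:E)%E.
  rewrite -ge0_integralZl_EFin ?invr_ge0 ?(ltW C0)//; last 2 first.
  - by move=> z _; rewrite lee_fin.
  - exact/measurable_EFinP.
  rewrite [LHS]integral_mkcond; apply: eq_integral => z _; rewrite patchE.
  case: ifPn => [/set_mem|/negP nz]; first by move=> /itv0y z0; rewrite phiE.
  by rewrite /phi rhoN ?mul0r ?mule0// => zz; apply: nz; exact: mem_set.
(* The value is positive, so the extended integral is finite without a separate proof of
   integrability. *)
have := fine_pos (mulr_gt0 p0 (expR_gt0 (- w))) G; rewrite E => {}E.
have -> : (\int[mu]_z (phi z)%:E = C%:E * ((C^-1)%:E * \int[mu]_z (phi z)%:E))%E.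
  by rewrite muleA -EFinM mulfV ?mul1e// gt_eqF.
rewrite E -EFinM rhoE// /C; congr EFin.
have F (q G' p e : R) : G' != 0 -> p != 0 -> q / (G' * p) * (p * e) = G'^-1 * q * e.
  by move=> G0 p1; field; rewrite G0 p1.
by apply: F; rewrite gt_eqF.
Qed.

End mixture.

Theorem theorem3p2 (R : realType) (d : measure_display) (T : measurableType d)
    (P : probability T R) (r alpha : R) (L : R -> R[i]) (Z Y : {RV P >-> R})
    (r_gt0 : 0 < r) (alpha_gt0 : 0 < alpha) (alpha_lt1 : alpha < 1)
    (L_loop : loop_around (Gamma_poles (r - 1) 1) L)
    (Z_density : has_density_pos P Z (gamma_density r))
    (Y_density : has_density_pos P Y
       (fun t => complex.Re (foxH L (r - alpha, alpha) (r - 1, 1) t)))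
    (ZY_indep : independent_RV P Z Y) :
  eq_law P Z (powR_mul Z Y alpha).
Proof.
have a01 : 0 < alpha < 1 by rewrite alpha_gt0.
have [g [gser gint]] := wright_function a01.
pose z0 := r * (1 - alpha).
have z00 : 0 < z0 by rewrite mulr_gt0// subr_gt0.
have p0 := pi_gt0 R.
have foxE t : 0 < t -> Re (foxH L (r - alpha, alpha) (r - 1, 1) t) = t `^ (r - 1) * (g z0 t / pi).
  move=> t0; apply: cvg_unique (foxH_series L_loop a01 t0) _.
    exact: Rhausdorff.
  apply: cvgM; first exact: cvg_cst.
  (* The residues are summed for l <= N, the series for l < N; the index shift does not change the
     limit. *)
  have := gser z0 t (ltW t0); rewrite -(cvg_shiftS (fun N => \sum_(l < N) _)); exact.
have [mrho rho0 rhoN _ dZ] := density_restrict Z_density.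
have [mf f0 fN fE dY] := density_restrict Y_density.
move=> A mA; rewrite (law_powR_mul alpha mrho mf rho0 f0 dZ dY ZY_indep mA).
rewrite (mixture_scaling _ mrho mf)// dZ//; apply: eq_integral => w _.
(* For w <= 0 the density of Z is 0, and z^(- alpha) w <= 0 lies where the density of Y is 0 too. *)
have [w0|w0] := leP w 0.
  rewrite rhoN// mulr0 integral0_eq// => z _.
  by rewrite fN ?mulr0 ?mul0r// mulr_ge0_le0 ?powR_ge0.
have fg y : 0 < y -> (fun t => Re (foxH L (r - alpha, alpha) (r - 1, 1) t)) \_ `]0, +oo[ y =
    y `^ (r - 1) * (g z0 y / pi).
  by move=> y0; rewrite fE// foxE.
have K := mixture_kernel r_gt0 w0 mf f0 fg (gint z0 w z00 (ltW w0)) mrho rho0.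
rewrite indicE; have [_|_] := boolP (w \in A).
  by rewrite mul1r -K; apply: eq_integral => z _; rewrite mulr1.
by rewrite mul0r integral0_eq// => z _; rewrite mulr0.
Qed.
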